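(* Let $(\varepsilon_k)$ be a sequence of positive numbers decreasing to zero such that $F_{\varepsilon_k}$ $\Gamma$-converges (with respect to convergence in $\Omega\cap\varepsilon P$) to the functional $F^\ell_{\rm hom}\colon L^1(\Omega)\to[0,+\infty]$ given by $F^\ell_{\rm hom}(u)=\int_\Omega f^\ell_{\rm hom}(\nabla u)\,dx+\int_{S_u\cap\Omega}\hat g(\nu_u)\,d\mathcal H^{n-1}$ for $u\in GSBV^2(\Omega)$ and $+\infty$ otherwise. Let $g\in L^\infty(\Omega)$ and set, for $u\in L^1(\Omega)$, $$G_\varepsilon(u):=\int_{\Omega\cap\varepsilon P}|u-g|\,dx,\qquad G(u):=C_P\int_\Omega|u-g|\,dx,\qquad C_P:=\mathcal L^n(Q\cap P).$$ For every $k\in\mathbb N$ let $u_k\in L^1(\Omega)$ be a solution to $$m_k:=\min\{F_{\varepsilon_k}(u)+G_{\varepsilon_k}(u):\ u\in L^1(\Omega)\}.$$ Then, up to subsequences (not relabelled), $u_k$ converges in $\Omega\cap\varepsilon_kP$ to a function $\bar u\in SBV^2(\Omega)$ which solves $$m:=\min\{F^\ell_{\rm hom}(u)+G(u):\ u\in L^1(\Omega)\}.$$ Moreover $m_k\to m$ as $k\to+\infty$.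
   Context: Let $n\ge2$ and let $\Omega\subset\mathbb R^n$ be open, bounded, with Lipschitz boundary. $Q_r:=(-r/2,r/2)^n$, $Q:=Q_1$, and $P:=\mathbb R^n\setminus\bigcup_{i\in\mathbb Z^n}(i+\overline{Q_{1/2}})$; $\varepsilon P$ is its $\varepsilon$-dilation. The weights satisfy $0<\beta_\varepsilon\le1$, $\beta_\varepsilon\searrow0$ as $\varepsilon\to0$, and $\ell:=\lim_{\varepsilon\to0}\beta_\varepsilon/\varepsilon\in[0,+\infty]$ exists. $GSBV(U)$ is the set of $u\in L^1(U)$ such that $(u\wedge m)\vee(-m)\in SBV(U)$ for all $m\in\mathbb N$; $GSBV^2(U)$ (resp. $SBV^2(U)$) is the set of $u\in GSBV(U)$ (resp. $SBV(U)$) with $\nabla u\in L^2(U)$ and $\mathcal H^{n-1}(S_u)<+\infty$; $S_u$ is the discontinuity set, $\nu_u$ its generalised normal. $F_\varepsilon(u):=\int_\Omega|\nabla u|^2dx+\mathcal H^{n-1}(S_u\cap(\Omega\cap\varepsilon P))+\beta_\varepsilon\mathcal H^{n-1}(S_u\cap(\Omega\setminus\varepsilon P))$ if $u\in GSBV^2(\Omega)$, and $F_\varepsilon(u):=+\infty$ otherwise in $L^1(\Omega)$. Convergence in $\Omega\cap\varepsilon P$: $(u_\varepsilon)\subset L^1(\Omega)$ converges to $u\in L^1(\Omega)$ if there is $(\tilde u_\varepsilon)\subset L^1(\Omega)$ with $\tilde u_\varepsilon=u_\varepsilon$ in $\Omega\cap\varepsilon P$ and $\tilde u_\varepsilon\to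 u$ strongly in $L^1(\Omega)$. $\Gamma$-convergence of $F_{\varepsilon_k}$ to $F$ means: for every $u\in L^1(\Omega)$, (i) $F(u)\le\liminf_kF_{\varepsilon_k}(u_k)$ whenever $u_k\to u$ in this sense; (ii) there is $\bar u_k\to u$ in this sense with $F(u)\ge\limsup_kF_{\varepsilon_k}(\bar u_k)$. Here $f^\ell_{\rm hom}\colon\mathbb R^n\to[0,+\infty)$ is a convex function with $\hat f(\xi)\le f^\ell_{\rm hom}(\xi)\le|\xi|^2$, where $\hat f(\xi):=\inf\{\int_{Q\cap P}|\xi+Dw|^2dx:\ w\in H^1_{\rm per}(Q\cap P)\}$ (periodic $H^1$ functions), and $$\hat g(\nu):=\lim_{\varepsilon\to0^+}\inf\big\{\mathcal H^{n-1}(S_w\cap(Q^\nu\cap\varepsilon P)):\ w\in\mathcal P(Q^\nu\cap\varepsilon P),\ w=u^\nu_{0,1}\text{ in a neighbourhood of }\partial Q^\nu\big\},$$ where $Q^\nu$ is the unit cube centred at $0$ with one face orthogonal to $\nu\in\mathbb S^{n-1}$, $u^\nu_{0,1}(x)=1$ if $\langle x,\nu\rangle\ge0$ and $0$ otherwise, and $\mathcal P(U)$ is the set of $u\in SBV(U)$ with $\nabla u=0$ a.e., $\mathcal H^{n-1}(S_u)<+\infty$ and $u\in\{0,1\}$ a.e. in $U$. *)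

(* Defs.v *)
From HB Require Import structures.
From mathcomp Require Import all_boot all_order all_algebra.
From mathcomp Require Import all_classical all_reals all_analysis.
Set Implicit Arguments.
Unset Strict Implicit.
Unset Printing Implicit Defensive.
Import Order.TTheory GRing.Theory Num.Theory.
Import numFieldNormedType.Exports.
Local Open Scope classical_set_scope.
Local Open Scope ring_scope.
Local Open Scope ereal_scope.

(* The library norm of 'rV[R]_n is the sup norm: it is used only for the
   topology. Lengths are measured with the Euclidean norm. *)
Definition dot (R : realType) (n : nat) (x y : 'rV[R]_n) : R :=
  (\sum_(i < n) x ord0 i * y ord0 i)%R.

Definition enorm (R : realType) (n : nat) (x : 'rV[R]_n) : R :=
  Num.sqrt (dot x x).

Definition eball (R : realType) (n : nat) (x : 'rV[R]_n) (r : R) :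
  set 'rV[R]_n := [set y | (enorm (y - x) < r)%R].

(* mu_ext takes the infimum over coverings by measurable sets; on this copy of
   T every set is measurable, so coverings are unrestricted, and a gauge
   excludes a set by giving it the value +oo. *)
Definition allsets (T : Type) : Type := T.

Section allsets.
Variable T : pointedType.
HB.instance Definition _ := Pointed.on (allsets T).
Let allsets0 : [set: set (allsets T)] set0. Proof. by []. Qed.
Let allsetsC (A : set (allsets T)) :
  [set: set (allsets T)] A -> [set: set (allsets T)] (~` A).
Proof. by []. Qed.
Let allsets_bigcup (F : (set (allsets T))^nat) :
  (forall i, [set: set (allsets T)] (F i)) ->
  [set: set (allsets T)] (\bigcup_i F i).
Proof. by []. Qed.
HB.instance Definition _ := @isMeasurable.Build default_measure_display
  (allsets T) [set: set (allsets T)] allsets0 allsetsC allsets_bigcup.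
End allsets.

Definition cover_measure (R : realType) (T : pointedType)
    (gauge : set T -> \bar R) : set T -> \bar R :=
  mu_ext (gauge : set (allsets T) -> \bar R).

(* Lebesgue (outer) measure of R^n. *)
Definition box_gauge (R : realType) (n : nat) (S : set 'rV[R]_n) : \bar R :=
  if S == set0 then 0 else
  ereal_inf [set (\prod_(i < n) (ab.2 ord0 i - ab.1 ord0 i))%:E |
    ab in [set ab : 'rV[R]_n * 'rV[R]_n |
      forall x, S x -> forall i, (ab.1 ord0 i <= x ord0 i <= ab.2 ord0 i)%R]].

Definition leb_outer (R : realType) (n : nat) : set 'rV[R]_n -> \bar R :=
  cover_measure (@box_gauge R n).

Section leb_outer_measure.
Variables (R : realType) (n : nat).
Let gauge0 : box_gauge (set0 : set 'rV[R]_n) = 0.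
Proof. by rewrite /box_gauge eqxx. Qed.
Let gauge_ge0 (S : set 'rV[R]_n) : 0 <= box_gauge S.
Proof.
rewrite /box_gauge; case: eqVneq => // /set0P[x Sx].
apply: le_ereal_inf_tmp => _ [[a b] /= Sab <-].
rewrite lee_fin; apply: prodr_ge0 => i _; rewrite subr_ge0.
by have /andP[] := Sab _ Sx i; exact: le_trans.
Qed.
HB.instance Definition _ := isOuterMeasure.Build R 'rV[R]_n (@leb_outer R n)
  (@mu_ext0 _ (allsets 'rV[R]_n) R _ gauge0 gauge_ge0)
  (@mu_ext_ge0 _ (allsets 'rV[R]_n) R _ gauge_ge0)
  (@le_mu_ext _ (allsets 'rV[R]_n) R _)
  (@mu_ext_sigma_subadditive _ (allsets 'rV[R]_n) R _ gauge_ge0).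
End leb_outer_measure.

(* Lebesgue measure on the sigma-algebra of Lebesgue (i.e. Caratheodory)
   measurable sets. *)
Definition leb (R : realType) (n : nat) :
  {measure set (caratheodory_type (@leb_outer R n)) -> \bar R} :=
  (@leb_outer R n : {outer_measure set 'rV[R]_n -> \bar R}).

(* Hausdorff measure of dimension s, with the normalisation for which it
   agrees with s-dimensional Lebesgue measure on s-planes. *)
Definition ediam (R : realType) (n : nat) (S : set 'rV[R]_n) : \bar R :=
  ereal_sup [set (enorm (xy.1 - xy.2))%:E | xy in S `*` S].

Definition unit_ball_volume (R : realType) (s : nat) : R :=
  fine (@leb R s (eball 0%R 1%R)).

Definition hausdorff_gauge (R : realType) (n s : nat) (delta : R)
    (S : set 'rV[R]_n) : \bar R :=
  if S == set0 then 0
  else if ediam S <= delta%:E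
       then (unit_ball_volume R s * (fine (ediam S) / 2) ^+ s)%:E
       else +oo.

Definition hausdorff_outer (R : realType) (n s : nat) :
    set 'rV[R]_n -> \bar R := fun A =>
  ereal_sup [set cover_measure (@hausdorff_gauge R n s delta) A |
             delta in [set delta : R | (0 < delta)%R]].

Section hausdorff_outer_measure.
Variables (R : realType) (n s : nat).
Let gauge0 (delta : R) : hausdorff_gauge s delta (set0 : set 'rV[R]_n) = 0.
Proof. by rewrite /hausdorff_gauge eqxx. Qed.
Let gauge_ge0 (delta : R) (S : set 'rV[R]_n) : 0 <= hausdorff_gauge s delta S.
Proof.
rewrite /hausdorff_gauge; case: eqVneq => // /set0P[x Sx].
case: ifPn => // _; rewrite lee_fin mulr_ge0//.
  by rewrite fine_ge0.
rewrite exprn_ge0// divr_ge0// fine_ge0//.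
apply: le_ereal_sup_tmp; exists (enorm (x - x))%:E; first by exists (x, x).
by rewrite lee_fin sqrtr_ge0.
Qed.
Let cover_ge0 (delta : R) (A : set 'rV[R]_n) :
  0 <= cover_measure (@hausdorff_gauge R n s delta) A.
Proof. exact: (@mu_ext_ge0 _ (allsets 'rV[R]_n)). Qed.
Let hausdorff0 : @hausdorff_outer R n s set0 = 0.
Proof.
apply/eqP; rewrite eq_le; apply/andP; split.
  apply: ge_ereal_sup => _ [delta _ <-].
  by rewrite /cover_measure (@mu_ext0 _ (allsets 'rV[R]_n)).
apply: le_ereal_sup_tmp.
by exists (cover_measure (@hausdorff_gauge R n s 1%R) set0); first exists 1%R => /=.
Qed.
Let hausdorff_ge0 (A : set 'rV[R]_n) : 0 <= @hausdorff_outer R n s A.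
Proof.
apply: le_ereal_sup_tmp.
by exists (cover_measure (@hausdorff_gauge R n s 1%R) A); first exists 1%R => /=.
Qed.
Let le_hausdorff : {homo @hausdorff_outer R n s : A B / A `<=` B >-> A <= B}.
Proof.
move=> A B AB; apply: ge_ereal_sup => _ [delta d0 <-].
apply: le_ereal_sup_tmp; exists (cover_measure (@hausdorff_gauge R n s delta) B).
  by exists delta.
exact: (@le_mu_ext _ (allsets 'rV[R]_n)).
Qed.
Let hausdorff_subadditive : sigma_subadditive (@hausdorff_outer R n s).
Proof.
move=> F; apply: ge_ereal_sup => _ [delta d0 <-].
apply: (@le_trans _ _
  (\sum_(i <oo) cover_measure (@hausdorff_gauge R n s delta) (F i))).
  exact: (@mu_ext_sigma_subadditive _ (allsets 'rV[R]_n)).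
apply: lee_nneseries => [i _ _|i _]; first exact: cover_ge0.
apply: le_ereal_sup_tmp; exists (cover_measure (@hausdorff_gauge R n s delta) (F i)).
  by exists delta.
by [].
Qed.
HB.instance Definition _ := isOuterMeasure.Build R 'rV[R]_n
  (@hausdorff_outer R n s)
  hausdorff0 hausdorff_ge0 le_hausdorff hausdorff_subadditive.
End hausdorff_outer_measure.

Definition hausdorff (R : realType) (n s : nat) :
  {measure set (caratheodory_type (@hausdorff_outer R n s)) -> \bar R} :=
  (@hausdorff_outer R n s : {outer_measure set 'rV[R]_n -> \bar R}).

Definition L1 (R : realType) (n : nat) (U : set 'rV[R]_n) (u : 'rV[R]_n -> R) :
    Prop :=
  (@leb R n).-integrable U (EFin \o u).

Definition L2 (R : realType) (n : nat) (U : set 'rV[R]_n) (u : 'rV[R]_n -> R) :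
    Prop :=
  measurable_fun (U : set (caratheodory_type (@leb_outer R n))) u /\
  \int[@leb R n]_(x in U) ((u x) ^+ 2)%:E < +oo.

Definition Linfty (R : realType) (n : nat) (U : set 'rV[R]_n)
    (u : 'rV[R]_n -> R) : Prop :=
  measurable_fun (U : set (caratheodory_type (@leb_outer R n))) u /\
  exists M : R, {ae @leb R n, forall x, U x -> (`|u x| <= M)%R}.

(* Approximate limits are taken in measure and may be infinite, as is usual for
   GSBV functions: u has approximate limit a along D at x if, for every
   neighbourhood V of a, the points y of D with u y outside V have density 0
   at x. *)
Definition has_density0 (R : realType) (n : nat) (E : set 'rV[R]_n)
    (x : 'rV[R]_n) : Prop :=
  @leb R n (E `&` eball x r) * (r ^- n)%:E @[r --> 0%R^'+] --> 0.

Definition ap_lim (R : realType) (n : nat) (D : set 'rV[R]_n)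
    (u : 'rV[R]_n -> R) (x : 'rV[R]_n) (a : \bar R) : Prop :=
  forall V : set (\bar R), nbhs a V ->
    has_density0 (D `&` [set y | ~ V (u y)%:E]) x.

Definition Sdisc (R : realType) (n : nat) (U : set 'rV[R]_n)
    (u : 'rV[R]_n -> R) : set 'rV[R]_n :=
  [set x | U x /\ ~ exists a : \bar R, ap_lim U u x a].

Definition is_jump (R : realType) (n : nat) (U : set 'rV[R]_n)
    (u : 'rV[R]_n -> R) (x : 'rV[R]_n) (a b : \bar R) (nu : 'rV[R]_n) : Prop :=
  [/\ a != b, enorm nu = 1%R,
      ap_lim (U `&` [set y | (0 < dot (y - x) nu)%R]) u x a &
      ap_lim (U `&` [set y | (dot (y - x) nu < 0)%R]) u x b].

(* (u^+, u^-, nu_u) at x, which is unique up to exchanging u^+ and u^- and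
   changing the sign of nu_u; the default value is only used on an
   H^(n-1)-negligible part of the discontinuity set of a GSBV function. *)
Definition jump_triple (R : realType) (n : nat) (U : set 'rV[R]_n)
    (u : 'rV[R]_n -> R) (x : 'rV[R]_n) : \bar R * \bar R * 'rV[R]_n :=
  xget (0, 0, 0%R) [set t | is_jump U u x t.1.1 t.1.2 t.2].

Definition jump (R : realType) (n : nat) (U : set 'rV[R]_n)
    (u : 'rV[R]_n -> R) (x : 'rV[R]_n) : \bar R :=
  (jump_triple U u x).1.1 - (jump_triple U u x).1.2.

Definition normal (R : realType) (n : nat) (U : set 'rV[R]_n)
    (u : 'rV[R]_n -> R) (x : 'rV[R]_n) : 'rV[R]_n :=
  (jump_triple U u x).2.

(* xi is the approximate gradient of u at x if (u y - c - <xi, y - x>)/|y - x|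
   has approximate limit 0 at x, c being the approximate limit of u. *)
Definition is_ap_grad (R : realType) (n : nat) (U : set 'rV[R]_n)
    (u : 'rV[R]_n -> R) (x xi : 'rV[R]_n) : Prop :=
  exists c : R,
    ap_lim (U `\ x) (fun y => (u y - c - dot xi (y - x)) / enorm (y - x))%R x 0.

Definition ap_grad (R : realType) (n : nat) (U : set 'rV[R]_n)
    (u : 'rV[R]_n -> R) (x : 'rV[R]_n) : 'rV[R]_n :=
  xget 0%R [set xi | is_ap_grad U u x xi].

Definition partial (R : realType) (n : nat) (i : 'I_n) (phi : 'rV[R]_n -> R)
    (x : 'rV[R]_n) : R :=
  'D_(delta_mx ord0 i) phi x.

(* C^1_c(U) *)
Definition test_function (R : realType) (n : nat) (U : set 'rV[R]_n)
    (phi : 'rV[R]_n -> R) : Prop :=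
  [/\ forall x, differentiable phi x,
      forall i : 'I_n, continuous (partial i phi),
      compact (closure [set x | phi x != 0%R]) &
      closure [set x | phi x != 0%R] `<=` U].

(* u is in L^1(U) and its distributional derivative on U is the finite measure
   Du = grad u L^n + (u^+ - u^-) nu_u H^(n-1) restricted to S_u. *)
Definition SBV (R : realType) (n : nat) (U : set 'rV[R]_n)
    (u : 'rV[R]_n -> R) : Prop :=
  [/\ L1 U u,
      \int[@leb R n]_(x in U) (enorm (ap_grad U u x))%:E < +oo,
      \int[@hausdorff R n n.-1]_(x in Sdisc U u) `|jump U u x| < +oo &
      forall (i : 'I_n) (phi : 'rV[R]_n -> R), test_function U phi ->
        \int[@leb R n]_(x in U) (u x * partial i phi x)%:E =
        - (\int[@leb R n]_(x in U) (ap_grad U u x ord0 i * phi x)%:E +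
           \int[@hausdorff R n n.-1]_(x in Sdisc U u)
              (jump U u x * (normal U u x ord0 i * phi x)%:E))].

Definition trunc (R : realType) (n : nat) (m : nat) (u : 'rV[R]_n -> R)
    (x : 'rV[R]_n) : R :=
  Num.max (Num.min (u x) m%:R) (- m%:R)%R.

Definition GSBV (R : realType) (n : nat) (U : set 'rV[R]_n)
    (u : 'rV[R]_n -> R) : Prop :=
  L1 U u /\ forall m : nat, SBV U (trunc m u).

Definition SBV2 (R : realType) (n : nat) (U : set 'rV[R]_n)
    (u : 'rV[R]_n -> R) : Prop :=
  [/\ SBV U u,
      \int[@leb R n]_(x in U) (enorm (ap_grad U u x) ^+ 2)%:E < +oo &
      @hausdorff R n n.-1 (Sdisc U u) < +oo].

Definition GSBV2 (R : realType) (n : nat) (U : set 'rV[R]_n)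
    (u : 'rV[R]_n -> R) : Prop :=
  [/\ GSBV U u,
      \int[@leb R n]_(x in U) (enorm (ap_grad U u x) ^+ 2)%:E < +oo &
      @hausdorff R n n.-1 (Sdisc U u) < +oo].

(* The class P(U) of partitions of U in two sets. *)
Definition partitions (R : realType) (n : nat) (U : set 'rV[R]_n)
    (u : 'rV[R]_n -> R) : Prop :=
  [/\ SBV U u,
      {ae @leb R n, forall x, U x -> ap_grad U u x = 0%R},
      @hausdorff R n n.-1 (Sdisc U u) < +oo &
      {ae @leb R n, forall x, U x -> u x = 0%R \/ u x = 1%R}].

Definition frontier (T : topologicalType) (A : set T) : set T :=
  closure A `\` A°.

(* Near each boundary point Om is, in the direction nu, the strict epigraph of
   a Lipschitz function of the projection on the hyperplane orthogonal to nu. *)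
Definition lipschitz_boundary (R : realType) (n : nat) (Om : set 'rV[R]_n) :
    Prop :=
  forall x, frontier Om x ->
    exists (nu : 'rV[R]_n) (r : R) (gamma : 'rV[R]_n -> R),
      [/\ enorm nu = 1%R, (0 < r)%R, lipschitz gamma &
          forall y, eball x r y ->
            (Om y <-> (gamma (y - dot y nu *: nu) < dot y nu)%R)].

Definition cube (R : realType) (n : nat) (r : R) : set 'rV[R]_n :=
  [set x | forall i, (- (r / 2) < x ord0 i < r / 2)%R].

Definition perforated (R : realType) (n : nat) : set 'rV[R]_n :=
  ~` \bigcup_(z in [set: 'rV[int]_n])
       [set (map_mx intr z + y)%R | y in closure (@cube R n (1 / 2)%R)].

Definition eps_perforated (R : realType) (n : nat) (eps : R) :
    set 'rV[R]_n :=
  [set (eps *: y)%R | y in @perforated R n].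

Definition is_unit_cube (R : realType) (n : nat) (nu : 'rV[R]_n)
    (A : set 'rV[R]_n) : Prop :=
  exists M : 'M[R]_n,
    [/\ M *m M^T = 1%:M, exists i, row i M = nu &
        A = [set x *m M | x in @cube R n 1%R]].

Definition Fe (R : realType) (n : nat) (Om : set 'rV[R]_n) (eps beta_eps : R)
    (u : 'rV[R]_n -> R) : \bar R :=
  if `[< GSBV2 Om u >] then
    \int[@leb R n]_(x in Om) (enorm (ap_grad Om u x) ^+ 2)%:E
    + @hausdorff R n n.-1 (Sdisc Om u `&` (Om `&` eps_perforated eps))
    + beta_eps%:E *
      @hausdorff R n n.-1 (Sdisc Om u `&` (Om `\` eps_perforated eps))
  else +oo.

Definition Fhom (R : realType) (n : nat) (Om : set 'rV[R]_n)
    (f : 'rV[R]_n -> R) (g : 'rV[R]_n -> \bar R) (u : 'rV[R]_n -> R) : \bar R :=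
  if `[< GSBV2 Om u >] then
    \int[@leb R n]_(x in Om) (f (ap_grad Om u x))%:E
    + \int[@hausdorff R n n.-1]_(x in Sdisc Om u `&` Om) g (normal Om u x)
  else +oo.

(* w is in H^1_per(Q \cap P) with weak gradient Dw: w is the restriction of a
   Z^n-periodic function on P whose weak gradient on P is Dw. *)
Definition H1per (R : realType) (n : nat) (w : 'rV[R]_n -> R)
    (Dw : 'rV[R]_n -> 'rV[R]_n) : Prop :=
  [/\ forall (z : 'rV[int]_n) x,
        w (x + map_mx intr z)%R = w x /\ Dw (x + map_mx intr z)%R = Dw x,
      L2 (@cube R n 1%R `&` @perforated R n) w,
      forall i : 'I_n,
        L2 (@cube R n 1%R `&` @perforated R n) (fun x => Dw x ord0 i) &
      forall (i : 'I_n) (phi : 'rV[R]_n -> R),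
        test_function (@perforated R n) phi ->
        \int[@leb R n]_(x in @perforated R n) (w x * partial i phi x)%:E =
        - \int[@leb R n]_(x in @perforated R n) (Dw x ord0 i * phi x)%:E].

Definition fhat (R : realType) (n : nat) (xi : 'rV[R]_n) : \bar R :=
  ereal_inf [set \int[@leb R n]_(x in @cube R n 1%R `&` @perforated R n)
                    (enorm (xi + w.2 x) ^+ 2)%:E |
             w in [set w | H1per w.1 w.2]].

Definition u01 (R : realType) (n : nat) (nu x : 'rV[R]_n) : R :=
  if (0 <= dot x nu)%R then 1%R else 0%R.

(* Qn nu is the chosen cube Q^nu. *)
Definition ghat (R : realType) (n : nat) (Qn : 'rV[R]_n -> set 'rV[R]_n)
    (nu : 'rV[R]_n) : \bar R :=
  lim (ereal_inf [set @hausdorff R n n.-1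
                    (Sdisc (Qn nu `&` eps_perforated eps) w `&`
                     (Qn nu `&` eps_perforated eps)) |
         w in [set w | partitions (Qn nu `&` eps_perforated eps) w /\
           exists V : set 'rV[R]_n,
             [/\ open V, frontier (Qn nu) `<=` V &
               {ae @leb R n, forall x,
                 (V `&` (Qn nu `&` eps_perforated eps)) x ->
                 w x = u01 nu x}]]] @[eps --> 0%R^'+]).

Definition Ge (R : realType) (n : nat) (Om : set 'rV[R]_n) (g : 'rV[R]_n -> R)
    (eps : R) (u : 'rV[R]_n -> R) : \bar R :=
  \int[@leb R n]_(x in Om `&` eps_perforated eps) (`|u x - g x|%R)%:E.

Definition CP (R : realType) (n : nat) : \bar R :=
  @leb R n (@cube R n 1%R `&` @perforated R n).

Definition Glim (R : realType) (n : nat) (Om : set 'rV[R]_n)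
    (g : 'rV[R]_n -> R) (u : 'rV[R]_n -> R) : \bar R :=
  CP R n * \int[@leb R n]_(x in Om) (`|u x - g x|%R)%:E.


Definition perf_cvg (R : realType) (n : nat) (Om : set 'rV[R]_n)
    (eps : nat -> R) (u_ : nat -> 'rV[R]_n -> R) (u : 'rV[R]_n -> R) : Prop :=
  exists v_ : nat -> 'rV[R]_n -> R,
    [/\ forall k, L1 Om (v_ k),
        forall k, {ae @leb R n, forall x, (Om `&` eps_perforated (eps k)) x ->
                     v_ k x = u_ k x} &
        \int[@leb R n]_(x in Om) (`|v_ k x - u x|%R)%:E @[k --> \oo] --> 0].

Definition Gamma_cvg (R : realType) (n : nat) (Om : set 'rV[R]_n)
    (eps : nat -> R) (F_ : nat -> ('rV[R]_n -> R) -> \bar R)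
    (F : ('rV[R]_n -> R) -> \bar R) : Prop :=
  forall u, L1 Om u ->
    (forall u_ : nat -> 'rV[R]_n -> R,
       (forall k, L1 Om (u_ k)) -> perf_cvg Om eps u_ u ->
       F u <= limn_einf (fun k => F_ k (u_ k))) /\
    (exists u_ : nat -> 'rV[R]_n -> R,
       [/\ forall k, L1 Om (u_ k), perf_cvg Om eps u_ u &
           limn_esup (fun k => F_ k (u_ k)) <= F u]).

Definition inf_value (R : realType) (n : nat) (Om : set 'rV[R]_n)
    (J : ('rV[R]_n -> R) -> \bar R) : \bar R :=
  ereal_inf [set J v | v in L1 Om].

Definition is_minimizer (R : realType) (n : nat) (Om : set 'rV[R]_n)
    (J : ('rV[R]_n -> R) -> \bar R) (u : 'rV[R]_n -> R) : Prop :=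
  L1 Om u /\ forall v, L1 Om v -> J u <= J v.

(* Main.v *)
Require Import Defs.
From mathcomp Require Import all_boot all_order all_algebra.
From mathcomp Require Import all_classical all_reals all_analysis measurable_realfun.
From mathcomp Require Import ring lra zify.

(** Truncating a minimizer u_k at a level m >= ||g||_oo decreases both terms of
    the energy, so u_k is bounded by m a.e. on Om /\ eps_k P, and w_k = trunc m u_k
    satisfies |int w_k d_j phi| <= K for every test function phi on Om /\ eps_k P
    with |phi| <= 1: in the perforated set the jumps are penalised with
    coefficient 1.  No extension theorem is needed for compactness.  The set
    eps P is a union of slabs orthogonal to the axes; two fine cells of a coarse
    cube of side delta that lie in slabs are joined by a lattice path moving inside
    slabs, and a discrete Poincare inequality along these paths gives, for all
    eps small with respect to delta, constants c_D with
      sum_D int_(D /\ eps P) |w_k - c_D| <= C K delta.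
    Hence the w_k are totally bounded on Om /\ eps_k P, and since
    int_(Om /\ eps P) f tends to C_P int_Om f for f in L^1, a diagonal argument
    yields a limit U in L^1(Om) of a subsequence.  The Gamma-liminf inequality,
    applied to that subsequence completed by a recovery sequence of U, and
    recovery sequences of competitors give the minimality of U and m_k -> m. *)

Set Implicit Arguments.
Unset Strict Implicit.
Unset Printing Implicit Defensive.
Import Order.TTheory GRing.Theory Num.Theory.
Import numFieldNormedType.Exports.
Local Open Scope ring_scope.

(** * A discrete Poincare inequality *)

(** The obstacle is that jumps inside the holes are charged only with the weight [beta], which tends
    to 0: no uniform bound in BV of Om is available, and only test functions supported in the
    perforated set can be used. Point values of w_k are therefore replaced by averages against bumps
    on a fine grid of side [eta]; the increment between two neighbouring averages is the integral of
    w_k against a partial derivative. It is admissible when another coordinate lies in a slab. This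
    is where dimension at least 2 enters: a move in direction j leaves that coordinate unchanged, so
    a whole line stays in the slab. The mesh [eta] is chosen last, depending even on w_k, to make
    the averaging error small; this is harmless because the path inequality produces only the
    product eta N = delta. Approximate gradients and jumps come with no information on
    measurability, so integrals of nonnegative functions are treated as suprema over simple
    functions. Finally, U is bounded by m and has finite limit energy, which turns GSBV^2 into
    SBV^2. *)

Section discrete_poincare.
Context (R : realType) (n N' : nat).
Local Notation N := N'.+1.
Local Notation cell := {ffun 'I_n -> 'I_N}.
Implicit Types (x y z : cell) (j l : 'I_n) (S T s : seq 'I_n).
Variable a : cell -> R.
Variable good : 'I_n -> pred 'I_N.

Definition upd x j (t : 'I_N) : cell := [ffun l => if l == j then t else x l].

Definition mix S z y : cell := [ffun l => if l \in S then y l else z l].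

(** The coordinate j is excluded so that the condition is constant along lines in direction j
    ([corridor_upd]): such a line stays in one slab orthogonal to another axis. *)
Definition corridor j x : bool := [exists l, (l != j) && good l (x l)].

(** Increments outside corridors are set to 0 because nothing bounds the increments across holes. *)
Definition edge j x : R :=
  if corridor j x && (x j < N')%N then `|a (upd x j (inord (x j).+1)) - a x| else 0.

Definition line_var j x : R := \sum_(t : 'I_N) edge j (upd x j t).

Lemma edge_ge0 j x : 0 <= edge j x.
Proof. by rewrite /edge; case: ifP. Qed.

Lemma upd_upd x j (s t : 'I_N) : upd (upd x j s) j t = upd x j t.
Proof. by apply/ffunP => l; rewrite !ffunE; case: eqP. Qed.

Lemma upd_id x j : upd x j (x j) = x.
Proof. by apply/ffunP => l; rewrite !ffunE; case: eqP => [->|]. Qed.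

Lemma corridor_upd j x t : corridor j (upd x j t) = corridor j x.
Proof.
by apply: eq_existsb => l; rewrite ffunE; case: eqP => //= _.
Qed.

Lemma telescope_le (G : nat -> R) (m u t : nat) : (u <= m)%N -> (t <= m)%N ->
  `|G t - G u| <= \sum_(0 <= k < m) `|G k.+1 - G k|.
Proof.
wlog ut : u t / (u <= t)%N.
  move=> H um tm; have [ut|/ltnW tu] := leqP u t; first exact: H.
  by rewrite distrC; exact: H.
move=> um tm; rewrite -(telescope_sumr _ ut).
apply: le_trans (ler_norm_sum _ _ _) _.
rewrite [leRHS](big_cat_nat (n := u))//= [X in _ <= _ + X](big_cat_nat (n := t))//=.
by rewrite addrCA lerDl addr_ge0// sumr_ge0.
Qed.

Lemma line_var_le j x (s t : 'I_N) : corridor j x ->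
  `|a (upd x j t) - a (upd x j s)| <= line_var j x.
Proof.
move=> cx; pose G k := a (upd x j (inord k)).
have := @telescope_le G N' s t (ltn_ord s) (ltn_ord t).
rewrite /G !inord_val => /le_trans; apply.
(* The index N' is the last one and has no successor, so its edge is 0. *)
rewrite /line_var big_ord_recr/= [X in _ <= _ + X](_ : _ = 0); last first.
  by rewrite /edge ffunE eqxx/= ltnn andbF.
rewrite addr0 big_mkord; apply: ler_sum => k _.
rewrite /edge corridor_upd cx ffunE eqxx/= ltn_ord/= upd_upd.
have -> : inord k = widen_ord (leqnSn N') k by apply: val_inj; rewrite /= inordK// ltnS ltnW.
by rewrite /=.
Qed.

Lemma mix_cons S z y j : mix (j :: S) z y = upd (mix S z y) j (y j).
Proof. by apply/ffunP => l; rewrite !ffunE !inE; case: eqP => [->|]. Qed.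

Lemma eq_mix S T z y : S =i T -> mix S z y = mix T z y.
Proof. by move=> ST; apply/ffunP => l; rewrite !ffunE ST. Qed.

Fixpoint path_sum S s z y : R :=
  if s is j :: s' then line_var j (mix S z y) + path_sum (j :: S) s' z y else 0.

(** The coordinate i0 is never moved, so every intermediate cell keeps the good value z i0 and each
    move takes place in its corridor. *)
Lemma path_sum_le (i0 : 'I_n) s S T z y : good i0 (z i0) ->
  i0 \notin S -> i0 \notin s -> T =i s ++ S ->
  `|a (mix S z y) - a (mix T z y)| <= path_sum S s z y.
Proof.
move=> gz; elim: s S => [|j s ih] S i0S.
  by move=> _ /(eq_mix z y) ->; rewrite subrr normr0.
rewrite inE negb_or => /andP[i0j i0s] /= ST.
apply: le_trans (ler_distD (a (mix (j :: S) z y)) _ _) _; apply: lerD.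
  rewrite mix_cons -[X in a X - _](upd_id _ j).
  apply: line_var_le; apply/existsP; exists i0; rewrite i0j ffunE (negbTE i0S).
  exact: gz.
apply: ih => //; first by rewrite inE negb_or i0j.
by move=> l; rewrite ST !inE !mem_cat !inE orbCA.
Qed.

(** Exchanging the coordinates in S between z and y is an involution of pairs of cells; after this
    change of variables the summand depends on z alone. *)
Lemma sum_swap S (F : cell -> R) :
  \sum_z \sum_y F (mix S z y) = N%:R ^+ n * \sum_x F x.
Proof.
pose sw (p : cell * cell) := (mix S p.1 p.2, mix S p.2 p.1).
have swK : involutive sw.
  move=> [z y]; rewrite /sw /=; congr (_, _); apply/ffunP => l; rewrite !ffunE;
    by case: (l \in S).
rewrite pair_bigA/= (reindex_inj (inv_inj swK))/=.
rewrite (eq_bigr (fun p : cell * cell => F p.1)); last first.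
  by move=> [z y] _ /=; congr F; apply/ffunP => l; rewrite !ffunE; case: (l \in S).
rewrite -(pair_bigA _ (fun z _ => F z))/=.
rewrite mulr_sumr; apply: eq_bigr => z _.
by rewrite sumr_const card_ffun !card_ord -natrX mulr_natl.
Qed.

(** Here the involution exchanges x j with the running parameter t of the line. *)
Lemma sum_line_var j : \sum_x line_var j x = N%:R * \sum_x edge j x.
Proof.
pose sw (p : cell * 'I_N) := (upd p.1 j p.2, p.1 j).
have swK : involutive sw.
  move=> [z t]; rewrite /sw /=; congr (_, _); first by rewrite upd_upd upd_id.
  by rewrite ffunE eqxx.
rewrite /line_var pair_bigA/= (reindex_inj (inv_inj swK))/=.
rewrite (eq_bigr (fun p : cell * 'I_N => edge j p.1)); last first.
  by move=> [z t] _ /=; rewrite upd_upd upd_id.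
rewrite -(pair_bigA _ (fun z _ => edge j z))/=.
rewrite mulr_sumr; apply: eq_bigr => z _.
by rewrite sumr_const card_ord mulr_natl.
Qed.

Lemma sum_line_var_mix S j : \sum_z \sum_y line_var j (mix S z y) =
  N%:R ^+ n.+1 * \sum_x edge j x.
Proof. by rewrite sum_swap sum_line_var mulrA exprSr. Qed.

Lemma sum_path_sum s S : \sum_z \sum_y path_sum S s z y =
  N%:R ^+ n.+1 * \sum_(j <- s) \sum_x edge j x.
Proof.
elim: s S => [|j s ih] S /=.
  by rewrite big_nil mulr0 big1// => z _; rewrite big1.
under eq_bigr do rewrite big_split/=.
by rewrite big_split/= ih sum_line_var_mix big_cons mulrDr.
Qed.

Definition all_good y : bool := [forall l, good l (y l)].

(* Join z to y by moving first the coordinates other than i0, inside the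
   corridor of i0, and then i0 inside a corridor of y. *)
Lemma poincare_pairs (i0 : 'I_n) : (1 < n)%N ->
  \sum_(z : cell | good i0 (z i0)) \sum_(y | all_good y) `|a z - a y| <=
  N%:R ^+ n.+1 * \sum_j \sum_x edge j x.
Proof.
move=> n1; pose s := [seq j <- enum 'I_n | j != i0].
have i0s : i0 \notin s by rewrite mem_filter eqxx.
have Ss : s =i s ++ [::] by rewrite cats0.
have sE l : (l \in s) = (l != i0) by rewrite mem_filter mem_enum andbT.
(* A second direction: its final value y l0 is good and provides the corridor for the last move, the
   one along i0. *)
have [l0 l0i0] : exists l0 : 'I_n, l0 != i0.
  have n0 := ltnW n1; have [->|i00] := eqVneq i0 (Ordinal n0).
    by exists (Ordinal n1).
  by exists (Ordinal n0); rewrite eq_sym.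
have lv0 j x : 0 <= line_var j x by apply: sumr_ge0 => t _; exact: edge_ge0.
have ps0 s' S' z y : 0 <= path_sum S' s' z y.
  by elim: s' S' => //= j s' ih S'; rewrite addr_ge0.
have key z y : good i0 (z i0) -> all_good y ->
    `|a z - a y| <= path_sum [::] s z y + line_var i0 (mix s z y).
  move=> gz /forallP gy.
  have mz : mix [::] z y = z by apply/ffunP => l; rewrite ffunE.
  have my : upd (mix s z y) i0 (y i0) = y.
    apply/ffunP => l; rewrite !ffunE sE; by case: eqP => [->|].
  apply: le_trans (ler_distD (a (mix s z y)) _ _) _; apply: lerD.
    by rewrite -{1}mz; apply: (path_sum_le (i0 := i0)) => //; exact: Ss.
  rewrite -{2}my -{1}(upd_id (mix s z y) i0) distrC.
  apply: line_var_le; apply/existsP; exists l0; rewrite l0i0 ffunE sE l0i0.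
  exact: gy.
apply: (@le_trans _ _ (\sum_z \sum_y (path_sum [::] s z y + line_var i0 (mix s z y)))).
  rewrite big_mkcond; apply: ler_sum => z _; case: ifPn => gz; last first.
    by apply: sumr_ge0 => y _; rewrite addr_ge0.
  rewrite big_mkcond; apply: ler_sum => y _; case: ifPn => gy; last by rewrite addr_ge0.
  exact: key.
under eq_bigr do rewrite big_split/=.
rewrite big_split/= sum_path_sum sum_line_var_mix -mulrDr.
(* The directions in s together with i0 run over all directions once. *)
rewrite le_eqVlt; apply/orP; left; apply/eqP; congr (_ * _).
by rewrite [RHS](bigD1 i0)//= addrC; congr (_ + _); rewrite big_filter big_enum_cond.
Qed.

(** Averaging over the targets: if every all-good y exceeded the mean, the sum over y would violate
    [poincare_pairs] summed over i0. *)
Lemma poincare_center : (1 < n)%N -> (0 < #|all_good|)%N ->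
  exists2 y, all_good y &
  #|all_good|%:R * \sum_i0 \sum_(z : cell | good i0 (z i0)) `|a z - a y| <=
  n%:R * N%:R ^+ n.+1 * \sum_j \sum_x edge j x.
Proof.
move=> n1 /card_gt0P[y0 y0g].
set F := fun y => \sum_i0 \sum_(z : cell | good i0 (z i0)) `|a z - a y|.
set X := n%:R * _ * _.
have tot : \sum_(y | all_good y) F y <= X.
  rewrite /F exchange_big/=.
  rewrite (eq_bigr (fun i0 => \sum_(z : cell | good i0 (z i0)) \sum_(y | all_good y) `|a z - a y|)); last first.
    by move=> i0 _; rewrite exchange_big.
  apply: le_trans (ler_sum _ (fun i0 _ => poincare_pairs i0 n1)) _.
  by rewrite sumr_const card_ord /X -mulrA mulr_natl.
apply: contrapT => nex.
have lt y : all_good y -> X / #|all_good|%:R < F y.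
  move=> gy; rewrite ltNge; apply/negP => Fy; apply: nex; exists y => //.
  rewrite mulrC -ler_pdivlMr// ltr0n; apply/card_gt0P; by exists y0.
have c0 : 0 < #|all_good|%:R :> R by rewrite ltr0n; apply/card_gt0P; exists y0.
have : \sum_(y | all_good y) (X / #|all_good|%:R) < \sum_(y | all_good y) F y.
  rewrite [ltLHS](bigD1 y0)//= [ltRHS](bigD1 y0)//=; apply: ltr_leD; first exact: lt.
  by apply: ler_sum => y /andP[gy _]; exact: ltW (lt _ gy).
rewrite sumr_const -[X in X < _]mulr_natl mulrCA divff ?mulr1 ?gt_eqF//.
by rewrite ltNge tot.
Qed.

Lemma card_all_good : #|all_good|%:R = \prod_j #|good j|%:R :> R.
Proof.
have -> : #|all_good| = #|family good|.
  by apply: eq_card => y; rewrite !inE; apply/forallP/familyP => h l; exact: h.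
rewrite card_family -natr_prod; congr _%:R.
by rewrite foldrE big_map big_enum.
Qed.

End discrete_poincare.

(** * Frequency of the slabs on a fine grid *)

Section good_count.
Context (R : realType).

(** The closed interval of length [eta] starting at s + eta r lies in one component of the slabs,
    which have period e and width e / 2. *)
Definition in_corridor (e eta s : R) (r : nat) : bool :=
  `[< exists q : int, e * (q%:~R + 1 / 4) < s + eta * r%:R /\
                      s + eta * r.+1%:R < e * (q%:~R + 3 / 4) >].

Lemma corridor_hit (e eta s : R) (h : nat) (r : nat) : 0 < eta -> 64 * eta <= e ->
  7 / 64 * e <= h%:R * eta -> h%:R * eta <= e / 8 ->
  exists2 t : 'I_11, true & in_corridor e eta s (r + t * h).
Proof.
move=> eta0 etae h1 h2; have e0 : 0 < e by lra.
pose x := (s + eta * r%:R) / e.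
pose k := h%:R * eta / e.
have k1 : 7 / 64 <= k by rewrite ler_pdivlMr.
have k2 : k <= 1 / 8 by rewrite ler_pdivrMr//; lra.
have k0 : 0 < k by lra.
(* In units of e, the first slab whose left end lies strictly beyond x. *)
pose q := Num.floor (x - 1 / 4) + 1.
have q1 : x < q%:~R + 1 / 4 by have := floorD1_gt (x - 1 / 4); rewrite -/q; lra.
have q2 : q%:~R + 1 / 4 <= x + 1.
  by have := floor_le_tmp (x - 1 / 4); rewrite /q intrD; lra.
pose D := q%:~R + 1 / 4 - x.
have D0 : 0 <= D / k by rewrite divr_ge0//; rewrite /D; lra.
have /andP[t1 t2] := truncn_itv D0.
set t := Num.truncn (D / k) in t1 t2.
rewrite ler_pdivlMr// in t1; rewrite ltr_pdivrMr// in t2.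
(* The slab starts within distance 1 and a step is at least 7/64, so t <= 9 and step t + 1 enters
   the slab. It overshoots by at most 1/8, and 1/8 + 1/64 is below the width 1/2. *)
have tlt : (t.+1 < 11)%N.
  rewrite -(ltr_nat R) -natr1.
  have : t%:R * (7 / 64) <= 1 :> R.
    by apply: le_trans (_ : t%:R * k <= _); [rewrite ler_wpM2l|rewrite /D in t1; lra].
  lra.
exists (Ordinal tlt) => //; apply/asboolP; exists q.
have xe : s + eta * r%:R = e * x by rewrite /x; field; lra.
have ke : eta * h%:R = e * k by rewrite /k; field; lra.
have E : s + eta * (r + t.+1 * h)%N%:R = e * (x + t.+1%:R * k).
  transitivity (s + eta * r%:R + t.+1%:R * (eta * h%:R)).
    by rewrite natrD natrM; ring.
  by rewrite xe ke; ring.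
have E2 : s + eta * (r + t.+1 * h).+1%:R = e * (x + t.+1%:R * k) + eta.
  by rewrite -[(r + _).+1%:R]natr1 mulrDr addrA E mulr1.
rewrite [X in (r + X * h)%N]/= E E2 ltr_pM2l//.
move: t2 t1; rewrite -[t.+1%:R]natr1 /D => t2 t1; split; first lra.
have : x + (t%:R + 1) * k + 1 / 64 < q%:~R + 3 / 4 by lra.
rewrite -(ltr_pM2l e0); lra.
Qed.

(* Steps of h cells are about e / 8 long, so that one of r, r + h, ..., r + 10 h
   lies in a corridor. *)
Lemma good_count (e eta s : R) (N : nat) : 0 < eta -> 64 * eta <= e ->
  5 * e <= 2 * (N%:R * eta) ->
  N%:R <= 22 * #|[pred r : 'I_N | in_corridor e eta s r]|%:R :> R.
Proof.
move=> eta0 etae eN; have e0 : 0 < e by lra.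
(* Rounding e / (8 eta) down shortens a step by at most eta <= e / 64, whence the lower bound 7/64 =
   1/8 - 1/64. *)
pose h := Num.truncn (e / (8 * eta)).
have h0 : 0 <= e / (8 * eta) by rewrite divr_ge0//; lra.
have /andP[h1 h2] := truncn_itv h0.
rewrite -/h ler_pdivlMr in h1; last lra.
rewrite -/h ltr_pdivrMr in h2; last lra.
have hN : 20 * h%:R <= N%:R :> R.
  rewrite -(ler_pM2r eta0); nra.
have {}hN : (20 * h <= N)%N by rewrite -(ler_nat R) natrM.
set g := #|_|.
(* Double counting of pairs of a start r and a shift t: each start has a hit, and each shift, being
   injective, yields at most g hits. As 20 h <= N, at least half of the cells are starts, hence the
   constant 22 = 2 * 11. *)
have key : (N - 10 * h <= 11 * g)%N.
  have -> : (11 * g = \sum_(t < 11) g)%N by rewrite sum_nat_const card_ord.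
  apply: (@leq_trans (\sum_(t < 11) \sum_(r < N - 10 * h) in_corridor e eta s (r + t * h))%N).
    rewrite exchange_big/=; apply: (@leq_trans (\sum_(r < N - 10 * h) 1)%N).
      by rewrite sum1_card card_ord.
    apply: leq_sum => r _; have [||t _ ht] := @corridor_hit e eta s h r eta0 etae; [..|by rewrite (bigD1 t)//= ht].
    - by move: h2; rewrite -natr1; lra.
    - lra.
  apply: leq_sum => t _; rewrite /g -sum1_card [X in (_ <= X)%N]big_mkcond/=.
  rewrite (eq_bigr (fun r : 'I_N => in_corridor e eta s r : nat)); last first.
    by move=> r _; rewrite ?inE; case: in_corridor.
  have tN (r : 'I_(N - 10 * h)) : (r + t * h < N)%N.
    have := ltn_ord r; have : (t * h <= 10 * h)%N by rewrite leq_mul2r -ltnS ltn_ord orbT.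
    lia.
  pose f r := Ordinal (tN r).
  have finj : injective f.
    by move=> r1 r2 /(congr1 val)/= /addIn/val_inj.
  rewrite -(big_map f xpredT (fun r : 'I_N => in_corridor e eta s r : nat)).
  have uf : uniq [seq f r | r <- index_enum 'I_(N - 10 * h)].
    by rewrite map_inj_uniq ?index_enum_uniq.
  rewrite (big_uniq _ uf)/=.
  rewrite [X in (_ <= X)%N](bigID (fun r => r \in [seq f r | r <- index_enum 'I_(N - 10 * h)]))/=.
  exact: leq_addr.
have : (N <= 22 * g)%N by lia.
by rewrite -(ler_nat R) natrM.
Qed.

End good_count.

Local Open Scope classical_set_scope.
Local Open Scope ring_scope.
Local Open Scope ereal_scope.

(** * Lebesgue measure *)

Section leb_box.
Context (R : realType) (n : nat).
Hypothesis n_gt0 : (0 < n)%N.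
Implicit Types (a b x : 'rV[R]_n) (S : set 'rV[R]_n).
Local Notation mu := (@leb R n).

Definition cbox a b : set 'rV[R]_n :=
  [set x | forall i, (a ord0 i <= x ord0 i <= b ord0 i)%R].

Definition obox a b : set 'rV[R]_n :=
  [set x | forall i, (a ord0 i < x ord0 i < b ord0 i)%R].

Definition vol a b : R := (\prod_(i < n) (b ord0 i - a ord0 i))%R.

Lemma box_gauge_ge0 S : 0 <= box_gauge S.
Proof.
rewrite /box_gauge; case: eqVneq => // /set0P[x Sx].
apply: le_ereal_inf_tmp => _ [[a b] /= Sab <-].
rewrite lee_fin; apply: prodr_ge0 => i _; rewrite subr_ge0.
by have /andP[] := Sab _ Sx i; exact: le_trans.
Qed.

Lemma box_gauge_le a b S : S `<=` cbox a b -> (forall i, a ord0 i <= b ord0 i)%R ->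
  box_gauge S <= (vol a b)%:E.
Proof.
move=> Sab ab; rewrite /box_gauge; case: ifPn => _.
  by rewrite lee_fin; apply: prodr_ge0 => i _; rewrite subr_ge0.
by apply: ereal_inf_lbound; exists (a, b).
Qed.

Lemma box_gauge_adherent S (c : R) : (0 < c)%R -> box_gauge S < c%:E ->
  exists ab : 'rV[R]_n * 'rV[R]_n, [/\ S `<=` cbox ab.1 ab.2,
    (forall i, ab.1 ord0 i <= ab.2 ord0 i)%R & (vol ab.1 ab.2 < c)%R].
Proof.
move=> c0; rewrite /box_gauge; case: eqVneq => [-> _|S0].
  (* The empty set is covered by a degenerate box, of volume 0 because n > 0. *)
  exists (0, 0)%R; split => //=.
  by rewrite /vol (bigD1 (Ordinal n_gt0))//= subrr mul0r.
move=> /ereal_inf_lt[_ [[a b] /= Sab <-]]; rewrite lte_fin => vc.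
exists (a, b); split => //.
move/set0P : S0 => [x Sx] i; have /andP[] := Sab _ Sx i; exact: le_trans.
Qed.

Lemma mu_cover_le S (F : (set 'rV[R]_n)^nat) : S `<=` \bigcup_k F k ->
  mu S <= \sum_(k <oo) box_gauge (F k).
Proof. by move=> SF; apply: ereal_inf_lbound; exists F. Qed.

Lemma mu_le_gauge S : mu S <= box_gauge S.
Proof.
apply: (le_trans (@mu_cover_le S (fun k => if k == 0%N then S else set0) _)).
  by move=> x Sx; exists 0%N.
rewrite nneseries_recl//=; last first.
  by move=> k _; exact: box_gauge_ge0.
rewrite eseries0 ?adde0// => -[|k]//= _ _.
by rewrite /box_gauge eqxx.
Qed.

(** The gauge is itself an infimum over boxes: part of the gap between mu S and c is spent
    geometrically to pick an actual box around each set of a covering. *)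
Lemma mu_cover_adherent S (c : R) : mu S < c%:E ->
  exists A B : nat -> 'rV[R]_n, [/\ S `<=` \bigcup_k cbox (A k) (B k),
    forall k i, (A k ord0 i <= B k ord0 i)%R &
    \sum_(k <oo) (vol (A k) (B k))%:E < c%:E].
Proof.
move=> Sc.
have [d Sd dc] : exists2 d : R, mu S < d%:E & (d < c)%R.
  have := Sc; have : 0 <= mu S by exact: measure_ge0.
  case: (mu S) => // r _; rewrite lte_fin => rc.
  by exists ((r + c) / 2)%R; rewrite ?lte_fin; lra.
move: Sd => /ereal_inf_lt[_ [F [_ SF] <-] Fd].
have e0 : (0 < c - d)%R by lra.
have gF k : box_gauge (F k) < +oo.
  apply: le_lt_trans (lt_trans Fd (ltry _)).
  apply: (@le_trans _ _ (\sum_(i < k.+1) box_gauge (F i))).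
    rewrite big_ord_recr/=; apply: leeDr.
    by apply: sume_ge0 => i _; exact: box_gauge_ge0.
  rewrite -(big_mkord xpredT (fun i => box_gauge (F i))); apply: nneseries_lim_ge => i _ _.
  exact: box_gauge_ge0.
have H k : exists ab : 'rV[R]_n * 'rV[R]_n, [/\ F k `<=` cbox ab.1 ab.2,
    (forall i, ab.1 ord0 i <= ab.2 ord0 i)%R &
    (vol ab.1 ab.2)%:E <= box_gauge (F k) + ((c - d) / (2 ^ k.+1)%:R)%:E].
  have ek : (0 < (c - d) / (2 ^ k.+1)%:R)%R by rewrite divr_gt0// ltr0n expn_gt0.
  have gk := gF k; have g0 := box_gauge_ge0 (F k).
  have E : box_gauge (F k) = (fine (box_gauge (F k)))%:E.
    by rewrite fineK// ge0_fin_numE.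
  have [|| ab [h1 h2 h3]] := @box_gauge_adherent (F k)
      (fine (box_gauge (F k)) + ((c - d) / (2 ^ k.+1)%:R)).
  - by rewrite ltr_wpDl// fine_ge0.
  - by rewrite {1}E lte_fin ltrDl.
  - by exists ab; split => //; rewrite E -EFinD lee_fin ltW.
have [G HG] := choice H.
exists (fun k => (G k).1), (fun k => (G k).2); split.
- by move=> x /SF[k _ Fkx]; exists k => //; have [+ _ _] := HG k; apply.
- by move=> k; have [] := HG k.
- apply: (@le_lt_trans _ _ (\sum_(k <oo) box_gauge (F k) + (c - d)%:E)).
    apply: le_trans (epsilon_trick _ _ _); last 2 first.
    + by move=> k; exact: box_gauge_ge0.
    + exact: ltW.
    apply: lee_nneseries => k _; last by have [] := HG k.
    move=> _; rewrite lee_fin; apply: prodr_ge0 => i _; rewrite subr_ge0.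
    by have [_ + _] := HG k; apply.
  have -> : c%:E = d%:E + (c - d)%:E by rewrite -EFinD addrC subrK.
  by rewrite lteD2rE.
Qed.

(* One coordinate at a time, both sides are integrated against the
   one-dimensional Lebesgue measure. *)
Lemma vol_cover a b (A B : nat -> 'rV[R]_n) :
  (forall i, a ord0 i <= b ord0 i)%R ->
  (forall k i, A k ord0 i <= B k ord0 i)%R ->
  obox a b `<=` \bigcup_k cbox (A k) (B k) ->
  (vol a b)%:E <= \sum_(k <oo) (vol (A k) (B k))%:E.
Proof.
move=> ab AB cov.
(* Induction on the number j of coordinates already integrated: these contribute a length, the
   others an indicator. For j = 0 the inequality is the covering hypothesis, for j = n it compares
   volumes. *)
pose lhs j (x : 'rV[R]_n) : R := (\prod_(i < n) (if (i < j)%N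
  then b ord0 i - a ord0 i else \1_(`]a ord0 i, b ord0 i[%classic) (x ord0 i)))%R.
pose rhs k j (x : 'rV[R]_n) : R := (\prod_(i < n) (if (i < j)%N
  then B k ord0 i - A k ord0 i
  else \1_(`[A k ord0 i, B k ord0 i]%classic) (x ord0 i)))%R.
have rhs0 k j x : (0 <= rhs k j x)%R.
  by apply: prodr_ge0 => i _; case: ifP => // _; rewrite subr_ge0.
suff H j x : (j <= n)%N -> (lhs j x)%:E <= \sum_(k <oo) (rhs k j x)%:E.
  have := H n 0%R (leqnn _).
  suff -> : lhs n 0%R = vol a b.
    move=> /le_trans; apply; apply: lee_nneseries => k _; first by move=> _; rewrite lee_fin.
    by rewrite lee_fin le_eqVlt; apply/orP; left; apply/eqP; apply: eq_bigr => i _; rewrite ltn_ord.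
  by apply: eq_bigr => i _; rewrite ltn_ord.
elim: j x => [x _|j ih x jn].
  have [xab|xab] := pselect (obox a b x).
    have [k _ xk] := cov _ xab.
    have -> : lhs 0%N x = 1%R.
      apply: big1 => i _ /=; rewrite indicE mem_set//=.
      by rewrite in_itv/=; exact: xab.
    have r1 : rhs k 0%N x = 1%R.
      apply: big1 => i _ /=; rewrite indicE mem_set//=.
      by rewrite in_itv/=; exact: xk.
    apply: (@le_trans _ _ (\sum_(i < k.+1) (rhs i 0%N x)%:E)).
      rewrite big_ord_recr/= r1; apply: leeDr.
      by apply: sume_ge0 => i _; rewrite lee_fin.
    by rewrite -(big_mkord xpredT (fun i => (rhs i 0%N x)%:E)); apply: nneseries_lim_ge => i _ _; rewrite lee_fin.
  have -> : lhs 0%N x = 0%R.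
    move: xab => /existsNP[i /negP xi]; rewrite /lhs (bigD1 i)//= indicE memNset ?mul0r//=.
    by rewrite in_itv/=; apply/negP.
  by apply: nneseries_ge0 => k _ _; rewrite lee_fin.
pose jo := Ordinal jn.
pose upd (t : R) : 'rV[R]_n := (\row_i if i == jo then t else x ord0 i)%R.
have Hint (c d : R) (F : 'I_n -> R) (J : set R) :
    (forall i, i != jo -> 0 <= F i)%R ->
    lebesgue_measure J = (d - c)%:E -> measurable J -> 
    \int[lebesgue_measure]_t (\1_J t * \prod_(i < n | i != jo) F i)%:E =
    ((d - c) * \prod_(i < n | i != jo) F i)%:E.
  move=> F0 Jcd mJ; under eq_integral do rewrite mulrC EFinM.
  rewrite ge0_integralZl//; last 2 first.
  - by apply/measurable_EFinP; exact: measurable_indic.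
  - by rewrite lee_fin; apply: prodr_ge0 => i; exact: F0.
  by rewrite integral_indic// setIT EFinM muleC; congr (_ * _); exact: Jcd.
have Hl : (lhs j.+1 x)%:E = \int[lebesgue_measure]_t (lhs j (upd t))%:E.
  transitivity (\int[lebesgue_measure]_t (\1_(`]a ord0 jo, b ord0 jo[%classic) t * \prod_(i < n | i != jo) (if (i < j)%N
  then b ord0 i - a ord0 i else \1_(`]a ord0 i, b ord0 i[%classic) (x ord0 i)))%:E).
    rewrite (@Hint (a ord0 jo) (b ord0 jo))//; last 2 first.
    + by move=> i _; case: ifP => // _; rewrite subr_ge0.
    + rewrite lebesgue_measure_itv/= lte_fin; have := ab jo.
      by rewrite le_eqVlt => /orP[/eqP->|->]; rewrite ?ltxx ?subrr// -EFinD.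
    congr EFin; rewrite /lhs (bigD1 jo)//= leqnn; congr (_ * _)%R.
    apply: eq_bigr => i ij; rewrite ltnS leq_eqVlt.
    by rewrite -[X in X || _]/(nat_of_ord i == nat_of_ord jo) (inj_eq val_inj) (negbTE ij).
  apply: eq_integral => t _; congr EFin.
  rewrite /lhs [RHS](bigD1 jo)//= ltnn /upd mxE eqxx; congr (_ * _)%R.
  by apply: eq_bigr => i ij; rewrite mxE (negbTE ij).
have Hr k : (rhs k j.+1 x)%:E = \int[lebesgue_measure]_t (rhs k j (upd t))%:E.
  transitivity (\int[lebesgue_measure]_t (\1_(`[A k ord0 jo, B k ord0 jo]%classic) t * \prod_(i < n | i != jo) (if (i < j)%N
  then B k ord0 i - A k ord0 i else \1_(`[A k ord0 i, B k ord0 i]%classic) (x ord0 i)))%:E).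
    rewrite (@Hint (A k ord0 jo) (B k ord0 jo))//; last 2 first.
    + by move=> i _; case: ifP => // _; rewrite subr_ge0.
    + rewrite lebesgue_measure_itv/= lte_fin; have := AB k jo.
      by rewrite le_eqVlt => /orP[/eqP->|->]; rewrite ?ltxx ?subrr// -EFinD.
    congr EFin; rewrite /rhs (bigD1 jo)//= leqnn; congr (_ * _)%R.
    apply: eq_bigr => i ij; rewrite ltnS leq_eqVlt.
    by rewrite -[X in X || _]/(nat_of_ord i == nat_of_ord jo) (inj_eq val_inj) (negbTE ij).
  apply: eq_integral => t _; congr EFin.
  rewrite /rhs [RHS](bigD1 jo)//= ltnn /upd mxE eqxx; congr (_ * _)%R.
  by apply: eq_bigr => i ij; rewrite mxE (negbTE ij).
have mupd : forall J : set R, measurable J -> forall F : 'I_n -> R,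
    measurable_fun [set: R] (fun t => (\1_J t * \prod_(i < n | i != jo) F i)%:E).
  move=> J mJ F; apply/measurable_EFinP; apply: measurable_funM => //.
have mr k : measurable_fun [set: R] (fun t => (rhs k j (upd t))%:E).
  rewrite [X in measurable_fun _ X](_ : _ = fun t => (\1_(`[A k ord0 jo, B k ord0 jo]%classic) t * \prod_(i < n | i != jo) (if (i < j)%N
  then B k ord0 i - A k ord0 i else \1_(`[A k ord0 i, B k ord0 i]%classic) (x ord0 i)))%:E); first exact: mupd.
  apply/funext => t; congr EFin.
  rewrite /rhs (bigD1 jo)//= ltnn /upd mxE eqxx; congr (_ * _)%R.
  by apply: eq_bigr => i ij; rewrite mxE (negbTE ij).
have ml : measurable_fun [set: R] (fun t => (lhs j (upd t))%:E).
  rewrite [X in measurable_fun _ X](_ : _ = fun t => (\1_(`]a ord0 jo, b ord0 jo[%classic) t * \prod_(i < n | i != jo) (if (i < j)%N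
  then b ord0 i - a ord0 i else \1_(`]a ord0 i, b ord0 i[%classic) (x ord0 i)))%:E); first exact: mupd.
  apply/funext => t; congr EFin.
  rewrite /lhs (bigD1 jo)//= ltnn /upd mxE eqxx; congr (_ * _)%R.
  by apply: eq_bigr => i ij; rewrite mxE (negbTE ij).
rewrite Hl; under eq_eseriesr do rewrite Hr.
rewrite -integral_nneseries//; last by move=> k t _; rewrite lee_fin.
apply: ge0_le_integral => //.
- move=> t _; rewrite lee_fin; apply: prodr_ge0 => i _; case: ifP => // _.
  by rewrite subr_ge0.
- apply: (@ge0_emeasurable_sum _ _ _ _ _ xpredT); last by move=> k _; exact: mr.
  by move=> k t _ _; rewrite lee_fin.
- by move=> t _; exact/ih/ltnW.
Qed.

(** Leaving S free between the open and the closed box serves open cubes and half-open cells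
    alike. *)
Lemma leb_box a b S : (forall i, a ord0 i <= b ord0 i)%R ->
  obox a b `<=` S -> S `<=` cbox a b -> mu S = (vol a b)%:E.
Proof.
move=> ab oS Sc; apply/eqP; rewrite eq_le; apply/andP; split.
  by apply: le_trans (mu_le_gauge _) _; exact: box_gauge_le.
rewrite leNgt; apply/negP => /mu_cover_adherent[A [B [cov AB]]].
by apply/negP; rewrite -leNgt; apply: vol_cover => // x /oS/cov.
Qed.

End leb_box.

Section leb_measurable.
Context (R : realType) (n : nat).
Hypothesis n_gt0 : (0 < n)%N.
Implicit Types (a b x : 'rV[R]_n) (S U : set 'rV[R]_n).
Local Notation mu := (@leb R n).
Local Notation lmeasurable A :=
  (measurable (A : set (caratheodory_type (@leb_outer R n)))).

Lemma vol_ge0 a b : (forall i, a ord0 i <= b ord0 i)%R -> (0 <= vol a b)%R.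
Proof. by move=> ab; apply: prodr_ge0 => i _; rewrite subr_ge0. Qed.

Lemma mu_le_vol (S : set 'rV[R]_n) (A B : nat -> 'rV[R]_n) :
  (forall k i, A k ord0 i <= B k ord0 i)%R ->
  S `<=` \bigcup_k cbox (A k) (B k) -> mu S <= \sum_(k <oo) (vol (A k) (B k))%:E.
Proof.
move=> AB /mu_cover_le/le_trans; apply.
apply: lee_nneseries => k _; first by move=> _; exact: box_gauge_ge0.
exact: box_gauge_le.
Qed.

(** A hyperplane orthogonal to an axis cuts a box into two boxes whose volumes add up, so a nearly
    optimal covering of X splits into coverings of its two parts. *)
Lemma halfspace_measurable (i : 'I_n) (t : R) :
  lmeasurable [set x : 'rV[R]_n | (x ord0 i < t)%R].
Proof.
apply: le_caratheodory_measurable => X; set H := [set x | _].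
suff: leb_outer (X `&` H) + leb_outer (X `&` ~` H) <= leb_outer X by [].
have [->|Xoo] := eqVneq (leb_outer X) +oo; first by rewrite leey.
have X0 : 0 <= leb_outer X by exact: (measure_ge0 mu).
have Xfin : leb_outer X \is a fin_num by rewrite ge0_fin_numE// ltey.
apply/lee_addgt0Pr => e e0.
have XE := fineK Xfin.
have : mu X < (fine (leb_outer X) + e)%:E.
  by rewrite -[mu X]/(leb_outer X) -XE lte_fin ltrDl.
move=> /(mu_cover_adherent n_gt0)[A [B [cov AB sAB]]].
(* Clamping t to the i-th side of the box keeps both halves boxes, possibly degenerate. *)
pose s k := Num.max (A k ord0 i) (Num.min (B k ord0 i) t).
pose B1 k : 'rV[R]_n := (\row_j if j == i then s k else B k ord0 j)%R.
pose A2 k : 'rV[R]_n := (\row_j if j == i then s k else A k ord0 j)%R.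
have As k : (A k ord0 i <= s k)%R by rewrite le_max lexx.
have sB k : (s k <= B k ord0 i)%R by rewrite ge_max AB ge_min lexx.
have AB1 k j : (A k ord0 j <= B1 k ord0 j)%R by rewrite mxE; case: eqP => [->|].
have AB2 k j : (A2 k ord0 j <= B k ord0 j)%R by rewrite mxE; case: eqP => [->|].
have volE k : vol (A k) (B k) = (vol (A k) (B1 k) + vol (A2 k) (B k))%R.
  rewrite /vol (bigD1 i)//= [X in _ = (X + _)%R](bigD1 i)//= [X in _ = (_ + X)%R](bigD1 i)//= !mxE eqxx.
  set p := (\prod_(_ < _ | _) _)%R; set q := (\prod_(_ < _ | _) _)%R; set r := (\prod_(_ < _ | _) _)%R.
  have -> : q = p by apply: eq_bigr => j ji; rewrite mxE (negbTE ji).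
  have -> : r = p by apply: eq_bigr => j ji; rewrite mxE (negbTE ji).
  ring.
rewrite -XE -EFinD; apply: le_trans (ltW sAB).
under eq_eseriesr do rewrite volE EFinD.
rewrite nneseriesD; last 2 first.
- by move=> k _ _; rewrite lee_fin vol_ge0.
- by move=> k _ _; rewrite lee_fin vol_ge0.
apply: leeD.
- apply: mu_le_vol => // x [/cov[k _ xk] Hx]; exists k => // j.
  have /andP[h1 h2] := xk j; rewrite h1 mxE; case: eqP => // ?; subst j.
  by rewrite /s le_max le_min h2 (ltW Hx) orbT.
- apply: mu_le_vol => // x [/cov[k _ xk] /negP]; rewrite -leNgt => Hx; exists k => // j.
  have /andP[h1 h2] := xk j; rewrite h2 andbT mxE; case: eqP => // ?; subst j.
  by rewrite /s ge_max h1/= ge_min Hx orbT.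
Qed.

Lemma halfspace_ge_measurable (i : 'I_n) (t : R) :
  lmeasurable [set x : 'rV[R]_n | (t <= x ord0 i)%R].
Proof.
have := measurableC (halfspace_measurable i t); congr measurable.
by apply/seteqP; split => x /=; rewrite leNgt => /negP.
Qed.

Lemma coord_measurable (i : 'I_n) :
  measurable_fun [set: caratheodory_type (@leb_outer R n)]
    (fun x : 'rV[R]_n => x ord0 i).
Proof.
apply: (measurability _ (RGenCInfty.measurableE R)) => _ [_ [t ->] <-].
rewrite setTI; have := halfspace_ge_measurable i t; congr measurable.
by apply/seteqP; split => x /=; rewrite in_itv/= andbT.
Qed.

Lemma forall_measurable (P : 'I_n -> set 'rV[R]_n) :
  (forall i, lmeasurable (P i)) -> lmeasurable [set x | forall i, P i x].
Proof.
move=> mP; have := @fin_bigcap_measurable _ (caratheodory_type (@leb_outer R n)) _ [set: 'I_n] P (@finite_finset _ _) (fun i _ => mP i).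
congr measurable; apply/seteqP; split => x /=.
  by move=> h i; exact: h.
by move=> h i _; exact: h.
Qed.

Lemma coord_itv_measurable (i : 'I_n) (I : interval R) :
  lmeasurable [set x : 'rV[R]_n | x ord0 i \in I].
Proof.
have := @coord_measurable i measurableT _ (measurable_itv I); rewrite setTI.
by congr measurable.
Qed.

Lemma obox_measurable a b : lmeasurable (obox a b).
Proof.
have := forall_measurable (fun i => coord_itv_measurable i `]a ord0 i, b ord0 i[).
congr measurable; apply/seteqP; split => x /= h i; have := h i; rewrite in_itv//.
Qed.

Lemma cbox_measurable a b : lmeasurable (cbox a b).
Proof.
have := forall_measurable (fun i => coord_itv_measurable i `[a ord0 i, b ord0 i]).
congr measurable; apply/seteqP; split => x /= h i; have := h i; rewrite in_itv//.
Qed.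

Lemma ball_oboxE x (r : R) : (0 < r)%R ->
  ball x r = obox (\row_i (x ord0 i - r))%R (\row_i (x ord0 i + r))%R.
Proof.
move=> r0; apply/seteqP; split => y /=.
  move=> [_ h] i; rewrite !mxE; have := h ord0 i; rewrite /ball/= ltr_norml; lra.
move=> h; split => // j i; rewrite ord1 /ball/= ltr_norml; have := h i; rewrite !mxE; lra.
Qed.

(** An open set is the countable union of the rational sup-norm balls that it contains, and these
    balls are open boxes. *)
Lemma open_leb_measurable U : open U -> lmeasurable U.
Proof.
move=> oU.
pose rv (q : 'rV[rat]_n) : 'rV[R]_n := map_mx ratr q.
pose F (qr : 'rV[rat]_n * rat) : set 'rV[R]_n :=
  if `[< (0 < ratr qr.2 :> R)%R /\ ball (rv qr.1) (ratr qr.2) `<=` U >]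
  then ball (rv qr.1) (ratr qr.2) else set0.
have -> : U = \bigcup_qr F qr.
  apply/seteqP; split => x.
    move=> Ux; have := oU; rewrite openE => /(_ _ Ux)/nbhs_ballP[r /= r0 xrU].
    (* A radius in (r/4, r/2) and a centre within r/4 of x: the ball contains x and stays in the
       ball of radius r, as r/4 + r/2 < r. *)
    have [|q] := @rat_in_itvoo R (r / 4) (r / 2); first lra.
    rewrite in_itv/= => /andP[q1 q2].
    have H i : exists p : rat, (ratr p \in `](x ord0 i - r / 4)%R, (x ord0 i + r / 4)%R[).
      by apply: rat_in_itvoo; lra.
    have [p Hp] := choice H.
    exists (\row_i p i, q)%R => //; rewrite /F /= asboolT.
      split; first lra.
      move=> i j; rewrite ord1 /ball/= !mxE; have := Hp j; rewrite in_itv/= ltr_norml; lra.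
    split; first lra.
    move=> y [_ hy]; apply: xrU; split => // i j; rewrite ord1.
    have := hy ord0 j; rewrite /ball/= !mxE; have := Hp j.
    rewrite in_itv/= !ltr_norml; lra.
  by move=> [qr _]; rewrite /F; case: asboolP => // -[_ +]; apply.
apply: countable_bigcupT_measurable => [|qr]; first exact: countableP.
rewrite /F; case: asboolP => [[q0 _]|_]; last exact: measurable0.
by rewrite ball_oboxE//; exact: obox_measurable.
Qed.

Lemma closed_leb_measurable U : closed U -> lmeasurable U.
Proof.
by move=> /closed_openC/open_leb_measurable/measurableC; rewrite setCK.
Qed.

Lemma continuous_leb_measurable (f : 'rV[R]_n -> R) : continuous f ->
  measurable_fun [set: caratheodory_type (@leb_outer R n)] f.
Proof.
move=> cf; apply: (measurability _ (RGenOInfty.measurableE R)) => _ [_ [t ->] <-].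
rewrite setTI; apply: open_leb_measurable.
by move/continuousP : cf; apply; exact: interval_open.
Qed.

Lemma coord_le_norm x (i : 'I_n) : (`|x ord0 i| <= `|x|)%R.
Proof.
by rewrite [leRHS]/Num.norm/= mx_normrE; apply/bigmax_geP; right => /=; exists (ord0, i).
Qed.

Lemma bounded_coord U : bounded_set U -> exists2 M : R, (0 < M)%R &
  forall x, U x -> forall i, (`|x ord0 i| < M)%R.
Proof.
move=> [M [_ HM]]; exists (`|M| + 2)%R; first by have := normr_ge0 M; lra.
move=> x Ux i; have := HM (`|M| + 1)%R; have := ler_norm M => MM.
move=> /(_ _ _ Ux) xM; apply: le_lt_trans (coord_le_norm _ _) _.
by apply: le_lt_trans (xM _) _; lra.
Qed.

Lemma bounded_leb_lty U : bounded_set U -> mu U < +oo.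
Proof.
move=> /bounded_coord[M M0 HM].
apply: le_lt_trans (mu_le_gauge _) _.
apply: (@le_lt_trans _ _ (vol (\row_i (- M)%R) (\row_i M))%:E); last exact: ltry.
apply: box_gauge_le => [x Ux|] i; rewrite !mxE; last lra.
by rewrite -ler_norml ltW// HM.
Qed.

End leb_measurable.

(** * Translation invariance of Lebesgue measure *)

Section leb_translation.
Context (R : realType) (n : nat).
Hypothesis n_gt0 : (0 < n)%N.
Implicit Types (a b x v : 'rV[R]_n) (S U : set 'rV[R]_n).
Local Notation mu := (@leb R n).
Local Notation MT := (caratheodory_type (@leb_outer R n)).
Local Notation lmeasurable A :=
  (measurable (A : set (caratheodory_type (@leb_outer R n)))).

Lemma leb_translation_le v S :
  mu ((fun x => x + v)%R @^-1` S) <= mu S.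
Proof.
have [Soo|Soo] := eqVneq (mu S) +oo; first by rewrite Soo leey.
have Sfin : mu S \is a fin_num by rewrite ge0_fin_numE// ltey.
apply/lee_addgt0Pr => e e0.
have SE := fineK Sfin.
have : mu S < (fine (mu S) + e)%:E by rewrite -{1}SE lte_fin ltrDl.
move=> /(mu_cover_adherent n_gt0)[A [B [cov AB sAB]]].
apply: (@le_trans _ _ (\sum_(k <oo) (vol (A k - v)%R (B k - v)%R)%:E)).
  apply: mu_le_vol => [k i|x /cov[k _ xk]]; first by rewrite !mxE lerB.
  by exists k => // i; have := xk i; rewrite !mxE lerBlDr lerBrDr.
apply: le_trans (_ : _ <= (fine (mu S) + e)%:E) _; last by rewrite EFinD SE.
apply: le_trans _ (ltW sAB); apply: lee_nneseries => k _.
  by move=> _; rewrite lee_fin vol_ge0// => i; rewrite !mxE lerB.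
rewrite le_eqVlt; apply/orP; left; apply/eqP; congr EFin.
by apply: eq_bigr => i _; rewrite !mxE; ring.
Qed.

Lemma leb_translation v S : mu ((fun x => x + v)%R @^-1` S) = mu S.
Proof.
apply/eqP; rewrite eq_le leb_translation_le/=.
have := leb_translation_le (- v) ((fun x => x + v)%R @^-1` S).
congr (_ <= _); congr (mu _); apply/seteqP; split => x /=; by rewrite subrK.
Qed.

(** Since the outer measure is translation invariant, the Caratheodory splitting by S of the test
    set moved by v transfers back to X. *)
Lemma translation_measurable v :
  measurable_fun [set: MT] ((fun x => x + v)%R : MT -> MT).
Proof.
move=> _ S mS; rewrite setTI; apply: le_caratheodory_measurable => X.
set t := fun x : 'rV[R]_n => (x + v)%R.
have XE : X = t @^-1` ((fun x => x - v)%R @^-1` X).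
  by apply/seteqP; split => x /=; rewrite /t addrK.
rewrite [in leRHS]XE [in leLHS]XE preimage_setC -!preimage_setI.
have H A : leb_outer (t @^-1` A) = leb_outer A by exact: leb_translation.
apply: (@le_trans _ _ (leb_outer ((fun x => x - v)%R @^-1` X `&` S) +
   leb_outer ((fun x => x - v)%R @^-1` X `&` ~` S))).
  by rewrite le_eqVlt; apply/orP; left; apply/eqP; congr (_ + _); exact: H.
rewrite le_eqVlt; apply/orP; left; apply/eqP; apply/esym.
transitivity (leb_outer ((fun x => x - v)%R @^-1` X)); first exact: H.
exact: mS.
Qed.

Lemma ge0_integral_translation v (f : 'rV[R]_n -> \bar R) :
  measurable_fun [set: MT] f -> (forall x, 0 <= f x) ->
  \int[mu]_x f (x + v)%R = \int[mu]_x f x.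
Proof.
move=> mf f0.
have := @ge0_integral_pushforward _ _ MT MT R _ (translation_measurable v) mu setT f measurableT mf (fun y _ => f0 y).
rewrite preimage_setT => <-.
by congr (integral _ _ _); apply/funext => A; exact: (leb_translation v A).
Qed.

End leb_translation.

(** * Erosion of open sets and outer regularity *)

Section inner.
Context (R : realType) (n : nat).
Hypothesis n_gt0 : (0 < n)%N.
Implicit Types (a b x v : 'rV[R]_n) (S U : set 'rV[R]_n).
Local Notation mu := (@leb R n).
Local Notation MT := (caratheodory_type (@leb_outer R n)).
Local Notation lmeasurable A :=
  (measurable (A : set (caratheodory_type (@leb_outer R n)))).

Definition inner U (t : R) : set 'rV[R]_n := [set x | ball x t `<=` U].

Lemma inner_closed U (t : R) : closed (inner U t).
Proof.
rewrite -openC [X in open X](_ : _ = \bigcup_(y in ~` U) ball y t); last first.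
  apply/seteqP; split => x.
    move=> /existsNP[y /not_implyP[xy Uy]]; exists y => //.
    exact: ball_sym.
  by move=> [y Uy /ball_sym yx] /(_ _ yx).
apply: bigcup_open => y _; have [t0|t0] := ltP 0%R t; first exact: ball_open.
rewrite [X in open X](_ : _ = set0); first exact: open0.
by apply/seteqP; split => // z [z0 _]; move: t0; rewrite leNgt z0.
Qed.

Lemma inner_measurable U (t : R) : lmeasurable (inner U t).
Proof. exact: (closed_leb_measurable n_gt0 (@inner_closed U t)). Qed.

Lemma le_inner U (s t : R) : (s <= t)%R -> inner U t `<=` inner U s.
Proof. by move=> st x xU y /(le_ball st)/xU. Qed.

(** The layers left by eroding with radius 1/(k+1) decrease to the empty set because U is open;
    their measures are finite, so they tend to 0. *)
Lemma inner_small U (tau : R) : open U -> mu U < +oo -> (0 < tau)%R ->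
  exists2 t : R, (0 < t)%R & mu (U `\` inner U t) <= tau%:E.
Proof.
move=> oU Uoo tau0.
pose F (k : nat) := U `\` inner U (k.+1%:R^-1)%R.
have mU := open_leb_measurable n_gt0 oU.
have mF k : lmeasurable (F k) by apply: measurableD => //; exact: inner_measurable.
have F0 : \bigcap_k F k = set0.
  apply/seteqP; split => // x xF.
  have [Ux _] := xF 0%N I.
  have := oU; rewrite openE => /(_ _ Ux)/nbhs_ballP[r /= r0 xrU].
  have [k kr] := @ltr_add_invr R 0 r r0.
  rewrite add0r in kr.
  have [_] := xF k I; apply.
  by move=> y /(le_ball (ltW kr))/xrU.
have := @nonincreasing_cvg_mu _ MT R mu F.
rewrite F0 measure0 => /(_ _ mF measurable0 _)/fine_cvgP.
case.
- by apply: le_lt_trans Uoo; apply: le_outer_measure => x [].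
- move=> k l kl; apply/subsetPset => x [Ux xk]; split => // xl; apply: xk.
  by apply: le_inner xl; rewrite lef_pV2 ?posrE// ler_nat ltnS.
move=> [N1 _ fin] /cvgrPdist_lt/(_ _ tau0)[N2 _ HN].
exists ((maxn N1 N2).+1%:R^-1)%R => //.
have := fin (maxn N1 N2) (leq_maxl _ _); have := HN (maxn N1 N2) (leq_maxr _ _).
rewrite -[(mu \o F) _]/(mu (F (maxn N1 N2))) => h1 h2.
rewrite -[X in mu X]/(F (maxn N1 N2)) -(fineK h2) lee_fin.
by move: h1; rewrite sub0r normrN => h1; apply/ltW; apply: le_lt_trans (ler_norm _) h1.
Qed.

Lemma vol_enlarge a b (e : R) : (0 < e)%R -> exists2 t : R, (0 < t)%R &
  (vol (a - const_mx t)%R (b + const_mx t)%R <= vol a b + e)%R.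
Proof.
move=> e0.
have : (\prod_(i <- index_enum 'I_n) (b ord0 i - a ord0 i + (t + t)))%R @[t --> (0:R)%R]
   --> (\prod_(i <- index_enum 'I_n) (b ord0 i - a ord0 i) : R)%R.
  elim: (index_enum _) => [|i s ih].
    rewrite big_nil [X in X @ _](_ : _ = cst 1%R); first exact: cvg_cst.
    by apply/funext => t; rewrite big_nil.
  rewrite big_cons [X in X @ _](_ : _ = (fun t => (b ord0 i - a ord0 i + (t + t)) *
      \prod_(j <- s) (b ord0 j - a ord0 j + (t + t)))%R); last first.
    by apply/funext => t; rewrite big_cons.
  apply: cvgM ih; set c := (b ord0 i - a ord0 i)%R.
  suff : (c + (t + t))%R @[t --> (0:R)%R] --> (c + (0 + 0))%R by rewrite !addr0.
  by apply: cvgD; [exact: cvg_cst|apply: cvgD; exact: cvg_id].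
move=> /cvgrPdist_le/(_ _ e0)/nbhs_ballP[r /= r0 Hr].
exists (r / 2)%R; first by rewrite divr_gt0.
have := Hr (r / 2)%R; rewrite /ball/= sub0r normrN ger0_norm; last lra.
have rr : (r / 2 < r)%R by lra.
move=> /(_ rr); rewrite ler_norml => /andP[h _].
rewrite /vol (eq_bigr (fun i => (b ord0 i - a ord0 i + (r / 2 + r / 2))%R)).
  by lra.
by move=> i _; rewrite !mxE; ring.
Qed.

(** The closed boxes of a nearly optimal covering are enlarged to open ones, the k-th at a cost
    proportional to 2^-k. *)
Lemma outer_regular S (tau : R) : mu S < +oo -> (0 < tau)%R ->
  exists U, [/\ open U, S `<=` U & mu U <= mu S + tau%:E].
Proof.
move=> Soo tau0.
have Sfin : mu S \is a fin_num by rewrite ge0_fin_numE.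
have SE := fineK Sfin.
have : mu S < (fine (mu S) + tau / 2)%:E by rewrite -{1}SE lte_fin ltrDl; lra.
move=> /(mu_cover_adherent n_gt0)[A [B [cov AB sAB]]].
have H k : exists t : R, (0 < t)%R /\ (vol (A k - const_mx t) (B k + const_mx t)
    <= vol (A k) (B k) + (tau / 2) / (2 ^ k.+1)%:R)%R.
  have [|t t0 Ht] := @vol_enlarge (A k) (B k) ((tau / 2) / (2 ^ k.+1)%:R)%R.
    by rewrite !divr_gt0// ltr0n expn_gt0.
  by exists t.
have [t Ht] := choice H.
pose A' k := (A k - const_mx (t k))%R; pose B' k := (B k + const_mx (t k))%R.
have AB' k i : (A' k ord0 i <= B' k ord0 i)%R.
  by rewrite !mxE; have := AB k i; have [] := Ht k; lra.
exists (\bigcup_k obox (A' k) (B' k)); split.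
- apply: bigcup_open => k _.
  rewrite openE => x xk; have [t0 _] := Ht k.
  pose r := (\big[Num.min/1]_(i < n) Num.min (x ord0 i - A' k ord0 i) (B' k ord0 i - x ord0 i))%R.
  apply/nbhs_ballP; exists r => /=.
    rewrite /r; elim/big_ind : _ => // [u w|i _]; first by rewrite lt_min => -> ->.
    by have := xk i; rewrite lt_min !subr_gt0.
  move=> y [_ hy] i; have := hy ord0 i.
  have : (r <= Num.min (x ord0 i - A' k ord0 i) (B' k ord0 i - x ord0 i))%R.
    exact: bigmin_le_cond.
  by rewrite le_min /ball/= ltr_norml; lra.
- move=> x /cov[k _ xk]; exists k => // i; have := xk i; have [t0 _] := Ht k.
  by rewrite !mxE; lra.
- apply: (@le_trans _ _ (\sum_(k <oo) (vol (A' k) (B' k))%:E)).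
    apply: mu_le_vol => // x [k _ xk]; exists k => // i.
    by have := xk i => /andP[/ltW -> /ltW ->].
  apply: (@le_trans _ _ (\sum_(k <oo) ((vol (A k) (B k))%:E + ((tau / 2) / (2 ^ k.+1)%:R)%:E))).
    apply: lee_nneseries => k _; last by rewrite -EFinD lee_fin; have [] := Ht k.
    by move=> _; rewrite lee_fin vol_ge0.
  apply: le_trans (epsilon_trick _ _ _) _; last 1 first.
  + apply: (@le_trans _ _ ((fine (mu S) + tau / 2)%:E + (tau / 2)%:E)).
      by rewrite leeD2rE// ltW.
    by rewrite -SE -!EFinD lee_fin; lra.
  + by move=> k; rewrite lee_fin vol_ge0.
  + by rewrite divr_ge0// ltW.
Qed.

End inner.

Section disjoint_sum.
Context d (T : measurableType d) (R : realType) (mu : {measure set T -> \bar R}).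

Lemma sum_disjoint_integral_le (I : finType) (P : pred I) (C : I -> set T)
    (D : set T) (F : T -> \bar R) :
  measurable D -> (forall i, measurable (C i)) ->
  (forall i j x, P i -> P j -> C i x -> C j x -> i = j) ->
  (forall i, P i -> C i `<=` D) ->
  measurable_fun D F -> (forall x, 0 <= F x) ->
  \sum_(i | P i) \int[mu]_(x in C i) F x <= \int[mu]_(x in D) F x.
Proof.
move=> mD mC disj CD mF F0.
rewrite -big_filter; set s := [seq i <- _ | _].
have sP i : i \in s -> P i by rewrite mem_filter => /andP[].
have sD : \big[setU/set0]_(i <- s) C i `<=` D.
  by rewrite big_seq; elim/big_ind : _ => // [A B AD BD x [/AD|/BD]//|i /sP/CD].
rewrite -ge0_integral_bigsetU//.
- apply: ge0_subset_integral => //; exact: bigsetU_measurable.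
- by rewrite filter_uniq// index_enum_uniq.
- move=> i j /= /sP Pi /sP Pj [x [Cix Cjx]]; exact: disj Cix Cjx.
- apply: measurable_funS mF => //.
Qed.

End disjoint_sum.

(** * Piecewise constant approximation in L^1 on fine cells *)

Section approximable.
Context d (T : measurableType d) (R : realType) (mu : {measure set T -> \bar R}).
Variable B : T -> R -> set T.
Hypothesis le_B : forall x (e1 e2 : R), (e1 <= e2)%R -> B x e1 `<=` B x e2.
Implicit Types f g : T -> R.

Definition mesh_family (I : finType) (C : I -> set T) (e : R) : Prop :=
  [/\ forall i, measurable (C i), forall i j x, C i x -> C j x -> i = j &
      forall i x y, C i x -> C i y -> B x e y].

(* Fine disjoint families of cells admit piecewise constant approximations of f
   in L^1; the mesh size needed does not depend on the position of the cells. *)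
Definition approximable f : Prop :=
  forall tau : R, (0 < tau)%R -> exists2 e : R, (0 < e)%R &
  forall (I : finType) (C : I -> set T), mesh_family C e ->
  exists2 h : I -> R, forall i, (0 <= h i)%R &
    \sum_i \int[mu]_(x in C i) (`|f x - h i|%R)%:E <= tau%:E.

Hypothesis regular : forall (E : set T) (tau : R), measurable E -> mu E < +oo ->
  (0 < tau)%R -> exists U N : set T, exists2 e : R, (0 < e)%R &
    [/\ measurable U /\ measurable N, E `<=` U, mu (U `\` E) <= tau%:E,
      mu N <= tau%:E & forall x, U x -> ~ N x -> B x e `<=` U].

(** A cell gets the value 1 when it is contained in U, and 0 otherwise. An error then occurs either
    at a point of U outside E, or at a point of E whose cell leaves U; the latter points lie in
    N. *)
Lemma approximable_indic (E : set T) : measurable E -> mu E < +oo ->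
  approximable \1_E.
Proof.
move=> mE Eoo tau tau0.
have tau2 : (0 < tau / 2)%R by lra.
have [U [N [e e0 [[mU mN] EU UE Ntau UN]]]] := regular mE Eoo tau2.
exists e => // I C [mC dC eC].
exists (fun i => if `[< C i `<=` U >] then 1 else 0)%R.
  by move=> i; case: ifP.
pose G (x : T) : R := (\1_(U `\` E) x + \1_N x)%R.
have mUE : measurable (U `\` E) by exact: measurableD.
have mG : measurable_fun [set: T] (EFin \o G).
  by apply/measurable_EFinP; apply: measurable_funD; exact: measurable_indic.
have G0 x : 0 <= (EFin \o G) x by rewrite lee_fin addr_ge0.
apply: (@le_trans _ _ (\sum_i \int[mu]_(x in C i) (EFin \o G) x)).
  apply: lee_sum => i _; apply: ge0_le_integral => //.
  - apply/measurable_EFinP; apply: measurableT_comp => //.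
    by apply: measurable_funB => //; exact: measurable_indic.
  - exact: measurable_funTS.
  - move=> x Cix; rewrite lee_fin /G.
    case: asboolP => CU.
      have Ux := CU _ Cix.
      rewrite !indicE; have [/set_mem Ex|/negP Ex] := boolP (x \in E).
        by rewrite subrr normr0 addr_ge0.
      rewrite [x \in _ `\` E]mem_set; last by split => // ?; apply: Ex; exact: mem_set.
      by rewrite sub0r normrN normr1 lerDl.
    rewrite subr0; have [/set_mem Ex|/negP Ex] := boolP (x \in E); last first.
      by rewrite indicE memNset ?normr0 ?addr_ge0// => /mem_set.
    have Ux := EU _ Ex.
    rewrite [\1_N x]indicE [x \in N]mem_set.
      by rewrite indicE mem_set// normr1 lerDr.
    apply: contrapT => xN; apply: CU => y Ciy; apply: (UN x Ux xN).
    exact: eC Cix Ciy.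
apply: (@le_trans _ _ (\int[mu]_x (EFin \o G) x)).
  by apply: sum_disjoint_integral_le => // i j x _ _; exact: dC.
rewrite (_ : EFin \o G = (fun x => (\1_(U `\` E) x)%:E + (\1_N x)%:E)); last by apply/funext => x; rewrite /= EFinD.
rewrite ge0_integralD//; last 2 first.
- by apply/measurable_EFinP; exact: measurable_indic.
- by apply/measurable_EFinP; exact: measurable_indic.
rewrite !integral_indic// !setIT.
have -> : tau%:E = (tau / 2)%:E + (tau / 2)%:E by rewrite -EFinD; congr EFin; lra.
exact: leeD.
Qed.

Lemma approximable0 : approximable (fun=> 0%R).
Proof.
move=> tau tau0; exists 1%R => // I C _; exists (fun=> 0%R) => //.
rewrite big1 ?lee_fin ?ltW// => i _; apply: integral0_eq => x _.
by rewrite subrr normr0.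
Qed.

Lemma approximableD f g :
  measurable_fun [set: T] f -> measurable_fun [set: T] g ->
  approximable f -> approximable g -> approximable (fun x => f x + g x)%R.
Proof.
move=> mf mg af ag tau tau0; have tau2 : (0 < tau / 2)%R by lra.
have [e e0 He] := af _ tau2; have [e' e'0 Hd] := ag _ tau2.
exists (Num.min e e'); first by rewrite lt_min e0.
move=> I C [mC dC sC].
have [|h h0 Hh] := He I C.
  by split => // i x y Cx /(sC _ _ _ Cx); apply: le_B; rewrite ge_min lexx.
have [|k k0 Hk] := Hd I C.
  by split => // i x y Cx /(sC _ _ _ Cx); apply: le_B; rewrite ge_min lexx orbT.
exists (fun i => h i + k i)%R; first by move=> i; rewrite addr_ge0.
have -> : tau%:E = (tau / 2)%:E + (tau / 2)%:E by rewrite -EFinD; congr EFin; lra.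
apply: le_trans (leeD Hh Hk); rewrite -big_split/=; apply: lee_sum => i _.
have mh (c : R) (u : T -> R) : measurable_fun [set: T] u ->
    measurable_fun (C i : set T) (fun x => (`|u x - c|%R)%:E).
  move=> mu'; apply/measurable_EFinP; apply: measurableT_comp => //.
  by apply: measurable_funB => //; exact: measurable_funTS.
rewrite -ge0_integralD//; last 2 first.
- exact: (mh _ f).
- exact: (mh _ g).
apply: ge0_le_integral => //.
- apply: (mh _ (fun x => f x + g x)%R); exact: measurable_funD.
- by apply: emeasurable_funD; [exact: (mh _ f)|exact: (mh _ g)].
- move=> x _; rewrite -EFinD lee_fin.
  by rewrite (_ : f x + g x - _ = (f x - h i) + (g x - k i))%R ?ler_normD//; ring.
Qed.

Lemma approximableZ f (c : R) : measurable_fun [set: T] f ->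
  (0 <= c)%R -> approximable f -> approximable (fun x => c * f x)%R.
Proof.
move=> mf c0 af tau tau0; have tau2 : (0 < tau / (c + 1))%R by rewrite divr_gt0//; lra.
have [e e0 He] := af _ tau2; exists e => // I C mC; have [h h0 Hh] := He I C mC.
exists (fun i => c * h i)%R; first by move=> i; rewrite mulr_ge0.
have c1 : (0 < c + 1)%R by lra.
apply: (@le_trans _ _ (\sum_i (c%:E * \int[mu]_(x in C i) (`|f x - h i|%R)%:E))).
  apply: lee_sum => i _; case: mC => mC _ _.
  rewrite -ge0_integralZl//; last first.
  - apply/measurable_EFinP; apply: measurableT_comp => //.
    by apply: measurable_funB => //; exact: measurable_funTS.
  rewrite le_eqVlt; apply/orP; left; apply/eqP; apply: eq_integral => x _.
  by rewrite -EFinM -mulrBr normrM ger0_norm.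
rewrite -ge0_sume_distrr; last by move=> i _; apply: integral_ge0 => x _; rewrite lee_fin.
apply: (@le_trans _ _ (c%:E * (tau / (c + 1))%:E)); first by apply: lee_wpmul2l.
rewrite -EFinM lee_fin mulrCA; apply: ler_piMr; first exact: ltW.
by rewrite ler_pdivrMr//; lra.
Qed.

Lemma approximable_lim f : measurable_fun [set: T] f ->
  (forall tau : R, (0 < tau)%R -> exists g, [/\ measurable_fun [set: T] g,
     approximable g & \int[mu]_x (`|f x - g x|%R)%:E <= tau%:E]) ->
  approximable f.
Proof.
move=> mf H tau tau0; have tau2 : (0 < tau / 2)%R by lra.
have [g [mg ag fg]] := H _ tau2; have [e e0 He] := ag _ tau2.
exists e => // I C mC; have [h h0 Hh] := He I C mC; exists h => //.
case: mC => mC dC _.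
have -> : tau%:E = (tau / 2)%:E + (tau / 2)%:E by rewrite -EFinD; congr EFin; lra.
have mfg : measurable_fun [set: T] (fun x => (`|f x - g x|%R)%:E).
  by apply/measurable_EFinP; apply: measurableT_comp => //; exact: measurable_funB.
apply: le_trans (leeD _ Hh); last first.
  apply: le_trans fg.
  apply: (@sum_disjoint_integral_le _ _ _ mu I xpredT C setT) => //.
  by move=> i j x _ _; exact: dC.
rewrite -big_split/=; apply: lee_sum => i _.
have mh (u : T -> R) : measurable_fun [set: T] u ->
    measurable_fun (C i : set T) (fun x => (`|u x - h i|%R)%:E).
  move=> mu'; apply/measurable_EFinP; apply: measurableT_comp => //.
  by apply: measurable_funB => //; exact: measurable_funTS.
rewrite -ge0_integralD//; last 2 first.
- exact: measurable_funTS.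
- exact: (mh g).
apply: ge0_le_integral => //.
- exact: (mh f).
- by apply: emeasurable_funD; [exact: measurable_funTS|exact: (mh g)].
- move=> x _; rewrite -EFinD lee_fin.
  by rewrite (_ : f x - h i = (f x - g x) + (g x - h i))%R ?ler_normD//; ring.
Qed.

Import HBNNSimple.

Lemma approximable_nnsfun (f : {nnsfun T >-> R}) :
  \int[mu]_x (f x)%:E < +oo -> approximable f.
Proof.
move=> foo.
(* Chebyshev's inequality: a level set at a positive height has finite measure. The height 0, whose
   level set may be infinite, is treated apart below. *)
have pieces (y : R) : (0 < y)%R -> mu (f @^-1` [set y]) < +oo.
  move=> y0; apply: (@le_lt_trans _ _ (y^-1%:E * \int[mu]_x (f x)%:E)); last first.
    by rewrite lte_mul_pinfty// lee_fin invr_ge0 ltW.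
  rewrite -lee_pdivrMl ?invr_gt0// invrK.
  rewrite -[X in _ * mu X]setIT -integral_indic// -ge0_integralZl//; last 2 first.
  - by apply/measurable_EFinP; exact: measurable_indic.
  - by rewrite lee_fin ltW.
  apply: ge0_le_integral => //.
  - by move=> x _; rewrite -EFinM lee_fin mulr_ge0// ltW.
  - by apply: measurable_funeM; apply/measurable_EFinP; exact: measurable_indic.
  - exact/measurable_EFinP.
  - move=> x _; rewrite -EFinM lee_fin indicE.
    by have [/set_mem/= ->|_] := boolP (x \in _); rewrite ?mulr1 ?mulr0.
rewrite (_ : (f : T -> R) = fun x =>
    (\sum_(y <- finmap.enum_fset (fset_set (range f))) y * \1_(f @^-1` [set y]) x)%R); last first.
  by apply/funext => x; rewrite [LHS]fimfunE fsbig_finite.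
have : forall y, y \in finmap.enum_fset (fset_set (range f)) -> (0 <= y)%R.
  by move=> y; rewrite in_fset_set// => /set_mem[x _ <-].
have mpiece y : measurable_fun [set: T] (fun x => y * \1_(f @^-1` [set y]) x)%R.
  by apply: measurable_funM => //; exact: measurable_indic.
elim: (finmap.enum_fset (fset_set (range f))) => [_|y s ih ys].
  rewrite (_ : (fun x => _) = fun=> 0%R); first exact: approximable0.
  by apply/funext => x; rewrite big_nil.
rewrite (_ : (fun x => _) = (fun x => y * \1_(f @^-1` [set y]) x +
    \sum_(j <- s) j * \1_(f @^-1` [set j]) x)%R); last first.
  by apply/funext => x; rewrite big_cons.
apply: approximableD => //.
- by apply: measurable_sum => j.
- have [->|y0] := eqVneq y 0%R.
    rewrite (_ : (fun x => _) = fun=> 0%R); first exact: approximable0.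
    by apply/funext => x; rewrite mul0r.
  apply: approximableZ; [exact: measurable_indic|by apply: ys; rewrite mem_head|].
  apply: approximable_indic => //; apply: pieces.
  by rewrite lt_neqAle eq_sym y0 ys// mem_head.
- by apply: ih => z zs; apply: ys; rewrite inE zs orbT.
Qed.

Lemma approximable_integrable f : measurable_fun [set: T] f ->
  (forall x, 0 <= f x)%R -> \int[mu]_x (f x)%:E < +oo -> approximable f.
Proof.
move=> mf f0 foo; apply: approximable_lim => // tau tau0.
have mEf : measurable_fun [set: T] (EFin \o f) by exact/measurable_EFinP.
pose f_ := nnsfun_approx measurableT mEf.
have f_cvg x : f_ k x @[k --> \oo] --> f x.
  have /= := @cvg_nnsfun_approx _ _ _ _ measurableT _ mEf (fun x _ => f0 x) x I.
  by move/fine_cvgP => [_]; apply.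
have f_le k x : (f_ k x <= f x)%R.
  rewrite -(cvg_lim _ (f_cvg x))//; apply: nondecreasing_cvgn_le.
    by move=> i j ij; exact/lefP/(nd_nnsfun_approx measurableT mEf ij).
  by apply/cvg_ex; exists (f x).
have fint : \int[mu]_x (f x)%:E \is a fin_num.
  by rewrite ge0_fin_numE// integral_ge0// => x _; rewrite lee_fin.
have : \int[mu]_x (f_ k x)%:E @[k --> \oo] --> \int[mu]_x (f x)%:E.
  have := @cvg_monotone_convergence _ T R mu setT measurableT
    (fun k x => (f_ k x)%:E).
  move=> /(_ _ _ _); rewrite (_ : (fun x => limn _) = EFin \o f); last first.
    apply/funext => x; apply/cvg_lim => //=.
    by apply: (cvg_comp _ _ (f_cvg x)); exact: cvg_id.
  apply.
  - by move=> k; apply/measurable_EFinP.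
  - by move=> k x _; rewrite lee_fin.
  - by move=> x _ i j ij; rewrite lee_fin; exact/lefP/(nd_nnsfun_approx measurableT mEf ij).
rewrite -(fineK fint) => /fine_cvgP[[N1 _ fin]] /cvgrPdist_lt/(_ _ tau0)[N2 _ HN].
pose k := maxn N1 N2.
have h1 := fin k (leq_maxl _ _); have h2 := HN k (leq_maxr _ _).
exists (f_ k); split => //.
  apply: approximable_nnsfun; apply: le_lt_trans foo.
  apply: ge0_le_integral => //.
  - by move=> x _; rewrite lee_fin.
  - exact/measurable_EFinP.
  - by move=> x _; rewrite lee_fin.
have E : \int[mu]_x (f x)%:E = \int[mu]_x (f_ k x)%:E + \int[mu]_x (`|f x - f_ k x|%R)%:E.
  rewrite -ge0_integralD//.
  - apply: eq_integral => x _; rewrite -EFinD ger0_norm ?subr_ge0//.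
    by congr EFin; ring.
  - by move=> x _; rewrite lee_fin.
  - exact/measurable_EFinP.
  - by apply/measurable_EFinP; apply: measurableT_comp => //; exact: measurable_funB.
set b := fine (\int[mu]_x (f_ k x)%:E).
have Eb : \int[mu]_x (f_ k x)%:E = b%:E by rewrite fineK.
have {}h2 : (`|fine (\int[mu]_x (f x)%:E) - b| < tau)%R by [].
have : (fine (\int[mu]_x (f x)%:E) - b)%:E = \int[mu]_x (`|f x - f_ k x|%R)%:E.
  by rewrite EFinB fineK// E Eb [X in X - _]addeC addeK.
by move=> <-; rewrite lee_fin; apply: le_trans (ler_norm _) (ltW h2).
Qed.

End approximable.

Section approximable_leb.
Context (R : realType) (n : nat).
Hypothesis n_gt0 : (0 < n)%N.
Local Notation mu := (@leb R n).
Local Notation MT := (caratheodory_type (@leb_outer R n)).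

(** Here N is the boundary layer of U: at the other points of U the ball of radius e stays in U by
    definition of [inner]. *)
Lemma leb_regular (E : set MT) (tau : R) : measurable E -> mu E < +oo ->
  (0 < tau)%R -> exists U N : set MT, exists2 e : R, (0 < e)%R &
    [/\ measurable U /\ measurable N, E `<=` U, mu (U `\` E) <= tau%:E,
      mu N <= tau%:E & forall x, U x -> ~ N x -> (ball (x : 'rV[R]_n) e : set MT) `<=` U].
Proof.
move=> mE Eoo tau0.
have [U [oU EU UE]] := outer_regular n_gt0 Eoo tau0.
have Uoo : mu U < +oo by apply: le_lt_trans UE _; rewrite lte_add_pinfty// ltry.
have [e e0 Ue] := inner_small n_gt0 oU Uoo tau0.
have mU := open_leb_measurable n_gt0 oU.
exists U, (U `\` inner U e); exists e => //; split => //.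
- by split => //; apply: measurableD => //; exact: (inner_measurable n_gt0).
- rewrite measureD//= (setIidr EU) leeBlDl// ge0_fin_numE//; exact: (measure_ge0 mu E).
- move=> x Ux xN y xy; have xU : inner U e x by apply: contrapT => ?; apply: xN.
  exact: xU.
Qed.

Lemma leb_approximable (f : MT -> R) : measurable_fun [set: MT] f ->
  (forall x, 0 <= f x)%R -> \int[mu]_x (f x)%:E < +oo ->
  approximable mu (@ball R 'rV[R]_n) f.
Proof.
move=> mf f0 foo; apply: approximable_integrable => //.
- by move=> x e1 e2; exact: le_ball.
- exact: leb_regular.
Qed.

End approximable_leb.

(** * Approximate limits and truncation *)

Section norms.
Context (R : realType) (n : nat).
Implicit Types (x y v xi : 'rV[R]_n).

Lemma sqr_coord_le v (i : 'I_n) : (v ord0 i ^+ 2 <= dot v v)%R.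
Proof.
rewrite /dot (bigD1 i)//= -expr2 lerDl.
by apply: sumr_ge0 => j _; rewrite -expr2 sqr_ge0.
Qed.

Lemma coord_le_enorm v (i : 'I_n) : (`|v ord0 i| <= enorm v)%R.
Proof. by rewrite -sqrtr_sqr ler_wsqrtr// sqr_coord_le. Qed.

Lemma enorm_ge0 v : (0 <= enorm v)%R.
Proof. exact: sqrtr_ge0. Qed.

Lemma enorm_le_sum v : (enorm v <= \sum_(i < n) `|v ord0 i|)%R.
Proof.
have s0 : (0 <= \sum_(i < n) `|v ord0 i|)%R by apply: sumr_ge0.
rewrite -(ger0_norm s0) -sqrtr_sqr ler_wsqrtr// expr2 mulr_suml.
apply: ler_sum => i _; apply: le_trans (ler_norm _) _; rewrite normrM.
apply: ler_wpM2l => //; rewrite (bigD1 i)//= lerDl; exact: sumr_ge0.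
Qed.

Lemma dotC x y : dot x y = dot y x.
Proof. by apply: eq_bigr => i _; rewrite mulrC. Qed.

Lemma dotNl x y : dot (- x)%R y = (- dot x y)%R.
Proof. by rewrite /dot -sumrN; apply: eq_bigr => i _; rewrite !mxE mulNr. Qed.

Lemma dotBl x y v : dot (x - y)%R v = (dot x v - dot y v)%R.
Proof. by rewrite /dot -sumrB; apply: eq_bigr => i _; rewrite !mxE mulrBl. Qed.

Lemma dot_le x y : (`|dot x y| <= (\sum_(i < n) `|x ord0 i|) * enorm y)%R.
Proof.
rewrite mulr_suml; apply: le_trans (ler_norm_sum _ _ _) _.
apply: ler_sum => i _; rewrite normrM ler_wpM2l//; exact: coord_le_enorm.
Qed.

Lemma enorm_eq0 v : enorm v = 0%R -> v = 0%R.
Proof.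
move=> v0; apply/rowP => i; rewrite !mxE; apply/eqP.
by rewrite -normr_le0 -v0 coord_le_enorm.
Qed.

Lemma eball_sub_ball x (r : R) : (0 < r)%R -> eball x r `<=` ball x r.
Proof.
move=> r0 y; rewrite /eball/= => xy; split => // i j; rewrite ord1 /ball/=.
by rewrite distrC; have := coord_le_enorm (y - x)%R j; rewrite !mxE => /le_lt_trans; apply.
Qed.

Lemma open_eball (U : set 'rV[R]_n) x : open U -> U x ->
  exists2 r : R, (0 < r)%R & eball x r `<=` U.
Proof.
rewrite openE => oU /oU/nbhs_ballP[r /= r0 xrU]; exists r => //.
by apply: subset_trans xrU; exact: eball_sub_ball.
Qed.

End norms.

Section density.
Context (R : realType) (n : nat).
Hypothesis n_gt0 : (0 < n)%N.
Implicit Types (x y v xi : 'rV[R]_n) (D E U : set 'rV[R]_n) (u : 'rV[R]_n -> R).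
Local Notation mu := (@leb R n).

Lemma has_density0_sub E F x (r0 : R) : (0 < r0)%R ->
  E `&` eball x r0 `<=` F -> has_density0 F x -> has_density0 E x.
Proof.
move=> r00 EF; apply: (@squeeze_cvge _ _ _ _ (fun=> 0)) => //; last exact: cvg_cst.
near=> r; have r_gt0 : (0 < r)%R by near: r; exact: nbhs_right_gt.
have r1 : 0 <= (r ^- n)%:E by rewrite lee_fin invr_ge0 exprn_ge0// ltW.
apply/andP; split; first by rewrite mule_ge0// (measure_ge0 mu).
apply: lee_wpmul2r => //.
apply: le_outer_measure => y [Ey xy]; split => //; apply: EF; split => //.
apply: lt_trans xy _; near: r; exact: nbhs_right_lt.
Unshelve. all: by end_near. Qed.

Lemma has_density0U E F x : has_density0 E x -> has_density0 F x ->
  has_density0 (E `|` F) x.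
Proof.
move=> dE dF.
have := cvgeD _ dE dF; rewrite add0e => /(_ _ isT) h.
apply: (@squeeze_cvge _ _ _ _ (fun=> 0)) h; last exact: cvg_cst.
near=> r; have r_gt0 : (0 < r)%R by near: r; exact: nbhs_right_gt.
have r1 : 0 <= (r ^- n)%:E by rewrite lee_fin invr_ge0 exprn_ge0// ltW.
apply/andP; split; first by rewrite mule_ge0// (measure_ge0 mu).
rewrite -ge0_muleDl ?(measure_ge0 mu)//; apply: lee_wpmul2r => //.
rewrite setIUl; exact: outer_measureU2.
Unshelve. all: by end_near. Qed.

Lemma has_density0_0 x : has_density0 (set0 : set 'rV[R]_n) x.
Proof.
rewrite /has_density0 (_ : (fun r : R => _) = cst 0); first exact: cvg_cst.
by apply/funext => r; rewrite set0I measure0 mul0e.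
Qed.

(* A cone contains, inside every small ball, a box of proportional size. *)
Lemma cone_density xi : xi != 0%R -> exists2 t : R, (0 < t)%R &
  forall E x (r0 : R), (0 < r0)%R ->
   (forall y, (0 < enorm (y - x) < r0)%R ->
      (t * enorm (y - x) <= dot xi (y - x))%R -> E y) ->
   ~ has_density0 E x.
Proof.
move=> xi0.
have [i xii] : exists i, xi ord0 i != 0%R.
  apply: contra_notP (negP xi0) => /forallNP h; apply/eqP/rowP => i; rewrite mxE.
  by apply/eqP/negPn/negP; exact: h.
pose l1 := (\sum_(i < n) `|xi ord0 i|)%R.
have l10 : (0 < l1)%R.
  rewrite /l1 (bigD1 i)//= ltr_wpDr// ?normr_gt0//; exact: sumr_ge0.
pose q := dot xi xi.
have q0 : (0 < q)%R.
  by apply: lt_le_trans (sqr_coord_le xi i); rewrite lt_neqAle sqr_ge0 eq_sym sqrf_eq0 xii.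
(* The box used below is centred at x + s xi with half-side k s. By the choice of k the scalar
   product with xi drops at most from s q to s q / 2; L bounds the distance to x by s L = r / 2, and
   t is the ratio of these two bounds. *)
pose k := (q / (2 * l1))%R.
have k0 : (0 < k)%R by rewrite divr_gt0// mulr_gt0.
have kl : (k * l1 = q / 2)%R by rewrite /k; field; lra.
pose L := (l1 + n%:R * k)%R.
have L0 : (0 < L)%R by rewrite ltr_wpDr// mulr_ge0// ltW.
pose t := (q / (2 * L))%R.
have t0 : (0 < t)%R by rewrite divr_gt0// mulr_gt0.
exists t => // E x r0 r00 coneE.
(* The ratio to r^n of the volume of the box, whose side is k r / L. *)
pose c := ((k / L) ^+ n)%R.
have c0 : (0 < c)%R by rewrite exprn_gt0// divr_gt0.
move=> /fine_cvgP[fin /cvgrPdist_lt/(_ _ c0) lt_c].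
have : \forall r \near (0%R : R)^'+, False.
  near=> r; have r_gt0 : (0 < r)%R by near: r; exact: nbhs_right_gt.
  have rr0 : (r < r0)%R by near: r; exact: nbhs_right_lt.
  have hfin : mu (E `&` eball x r) * (r ^- n)%:E \is a fin_num by near: r.
  have : (`|0 - fine (mu (E `&` eball x r) * (r ^- n)%:E)| < c)%R by near: r.
  rewrite sub0r normrN => hc.
  have {hc}: mu (E `&` eball x r) * (r ^- n)%:E < c%:E.
    by rewrite -(fineK hfin) lte_fin; apply: le_lt_trans (ler_norm _) hc.
  apply/negP; rewrite -leNgt.
  pose s := (r / (2 * L))%R.
  have s0 : (0 < s)%R by rewrite divr_gt0// mulr_gt0.
  have sL : (s * L = r / 2)%R by rewrite /s; field; lra.
  pose a : 'rV[R]_n := (\row_j (x ord0 j + s * xi ord0 j - k * s))%R.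
  pose b : 'rV[R]_n := (\row_j (x ord0 j + s * xi ord0 j + k * s))%R.
  have ks0 : (0 < k * s)%R by rewrite mulr_gt0.
  have muab : mu (cbox a b) = (vol a b)%:E.
    apply: (leb_box n_gt0) => [j|y yab j|//]; first by rewrite !mxE; lra.
    by have := yab j => /andP[/ltW-> /ltW->].
  have volE : vol a b = ((k * r / L) ^+ n)%R.
    rewrite /vol (eq_bigr (fun=> (k * r / L)%R)) ?prodr_const ?card_ord// => j _.
    by rewrite !mxE /s; field; lra.
  have -> : c%:E = mu (cbox a b) * (r ^- n)%:E.
    rewrite muab volE -EFinM; congr EFin; rewrite /c -exprVn -exprMn; congr (_ ^+ _)%R.
    by field; lra.
  apply: lee_wpmul2r; first by rewrite lee_fin invr_ge0 exprn_ge0// ltW.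
  apply: le_outer_measure => y yab.
  have yj j : (`|y ord0 j - x ord0 j - s * xi ord0 j| <= k * s)%R.
    by have := yab j; rewrite !mxE ler_norml; lra.
  have ylt : (enorm (y - x) <= s * L)%R.
    apply: le_trans (enorm_le_sum _) _.
    apply: (@le_trans _ _ (\sum_(j < n) (s * `|xi ord0 j| + k * s))%R).
      apply: ler_sum => j _; rewrite !mxE.
      have -> : (y ord0 j - x ord0 j = s * xi ord0 j + (y ord0 j - x ord0 j - s * xi ord0 j))%R by ring.
      apply: le_trans (ler_normD _ _) _; rewrite normrM (gtr0_norm s0).
      by rewrite lerD2l.
    rewrite big_split/= -mulr_sumr -/l1 sumr_const card_ord /L mulrDr.
    by rewrite lerD2l -mulr_natl le_eqVlt; apply/orP; left; apply/eqP; ring.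
  have ydot : (s * q / 2 <= dot xi (y - x))%R.
    apply: (@le_trans _ _ (\sum_(j < n) (s * (xi ord0 j * xi ord0 j) - `|xi ord0 j| * (k * s)))%R).
      rewrite sumrB -mulr_sumr -mulr_suml -/l1 -/(dot xi xi) -/q.
      by rewrite mulrA [(l1 * k)%R]mulrC kl; lra.
    apply: ler_sum => j _; rewrite !mxE.
    have -> : (y ord0 j - x ord0 j = s * xi ord0 j + (y ord0 j - x ord0 j - s * xi ord0 j))%R by ring.
    set w := (_ - s * _)%R; rewrite mulrDr mulrCA lerD2l.
    rewrite lerNl; apply: le_trans (ler_norm _) _; rewrite normrN normrM.
    by apply: ler_wpM2l => //; exact: yj.
  have yr : (enorm (y - x) < r)%R by lra.
  split => //; apply: coneE.
    rewrite (lt_trans yr rr0) andbT lt_neqAle enorm_ge0 andbT; apply/eqP => /esym/enorm_eq0 yx.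
    have dd : (0 < dot xi (y - x))%R by apply: lt_le_trans ydot; rewrite divr_gt0// mulr_gt0.
    move: dd; rewrite yx /dot big1 ?ltxx// => j _; by rewrite mxE mulr0.
  apply: le_trans ydot; apply: (@le_trans _ _ (t * (s * L))%R).
    by rewrite ler_wpM2l// ltW.
  by rewrite /t le_eqVlt; apply/orP; left; apply/eqP; field; lra.
by move=> /filter_ex[].
Unshelve. all: by end_near. Qed.

Lemma ap_lim0P D u x : ap_lim D u x 0 <->
  forall t : R, (0 < t)%R -> has_density0 (D `&` [set y | (t <= `|u y|)%R]) x.
Proof.
split=> [h t t0|h V].
  have := h [set e | exists2 r : R, e = r%:E & (`|r| < t)%R].
  have nV : nbhs (0 : \bar R) [set e | exists2 r : R, e = r%:E & (`|r| < t)%R].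
    suff : nbhs (0 : R)%R [set r : R | [set e | exists2 r : R, e = r%:E & (`|r| < t)%R] r%:E] by [].
    apply/nbhs_ballP; exists t => //= r; rewrite /ball/= sub0r normrN => rt.
    by exists r.
  move=> /(_ nV); apply: (@has_density0_sub _ _ _ 1%R) => // y [[Dy ty] _].
  by split => //= -[r [<-]]; rewrite ltNge ty.
move=> nV; have : nbhs (0 : R)%R [set r : R | V r%:E] by [].
move=> /nbhs_ballP[t /= t0 tV].
apply: (@has_density0_sub _ _ _ 1%R) (h t t0) => // y [[Dy Vy] _]; split => //=.
rewrite leNgt; apply/negP => yt; apply: Vy; apply: tV.
by rewrite /ball/= sub0r normrN.
Qed.

(** By symmetry c2 <= c1. On a cone where (xi1 - xi2).(y - x) >= t |y - x|, the two affine functions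
    differ by at least t |y - x|, so one of the two remainders is at least half of this. The cone is
    thus covered by two sets of density 0, against [cone_density]. *)
Lemma ap_grad_unique U u x xi1 xi2 : open U -> U x ->
  is_ap_grad U u x xi1 -> is_ap_grad U u x xi2 -> xi1 = xi2.
Proof.
move=> oU Ux [c1 h1] [c2 h2].
have [r0 r00 xU] := open_eball oU Ux.
move: c1 c2 xi1 xi2 h1 h2.
suff H c1 c2 xi1 xi2 : (c2 <= c1)%R ->
    ap_lim (U `\ x) (fun y => (u y - c1 - dot xi1 (y - x)) / enorm (y - x))%R x 0 ->
    ap_lim (U `\ x) (fun y => (u y - c2 - dot xi2 (y - x)) / enorm (y - x))%R x 0 ->
    xi1 = xi2.
  move=> c1 c2 xi1 xi2 h1 h2; have [c12|/ltW c12] := leP c2 c1; first exact: (H c1 c2).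
  by apply/esym; exact: (H c2 c1).
move=> c21 /ap_lim0P h1 /ap_lim0P h2; apply/eqP; apply: contrapT => /negP.
rewrite -subr_eq0 => /cone_density[t t0 Ht].
have t2 : (0 < t / 2)%R by lra.
apply: (Ht _ x r0 r00) (has_density0U (h1 _ t2) (h2 _ t2)) => y /andP[yx yr0] ty.
have Uy : (U `\ x) y.
  split; first exact: xU.
  by move=> /= yxE; move: yx; rewrite yxE subrr /enorm /dot big1 ?sqrtr0 ?ltxx// => j _; rewrite mxE mulr0.
apply: contrapT => /not_orP[/not_andP[//|/negP]]; rewrite -ltNge => k1.
move=> /not_andP[//|/negP]; rewrite -ltNge => k2.
move: k1 k2; rewrite !normrM !normfV !(gtr0_norm yx) !ltr_pdivrMr// !ltr_norml.
by move: ty; rewrite dotBl => ty /andP[k1 _] /andP[_ k2]; lra.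
Qed.

Lemma is_ap_grad_eq U u x xi : open U -> U x -> is_ap_grad U u x xi ->
  ap_grad U u x = xi.
Proof.
move=> oU Ux h; rewrite /ap_grad; case: xgetP => [y _ /= hy|/(_ xi)//].
exact: ap_grad_unique hy h.
Qed.

Lemma ap_grad_cst U x : open U -> U x -> ap_grad U (fun=> 0%R) x = 0%R.
Proof.
move=> oU Ux; apply: is_ap_grad_eq => //; exists 0%R; apply/ap_lim0P => t t0.
apply: (@has_density0_sub _ set0 _ 1%R); [by []| |exact: has_density0_0].
move=> y [[_ /=]]; rewrite (_ : dot 0%R _ = 0%R) ?subrr ?mul0r ?normr0; first by rewrite leNgt t0.
by rewrite /dot big1// => j _; rewrite mxE mul0r.
Qed.

End density.

Lemma measurable_clip d (T : measurableType d) (R : realType) (D : set T)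
    (f : T -> R) (a b : R) : measurable_fun D f ->
  measurable_fun D (fun x => Num.max (Num.min (f x) a) b).
Proof.
by move=> mf; apply: measurable_maxr => //; exact: measurable_minr.
Qed.

Section truncation.
Context (R : realType) (n : nat).
Hypothesis n_gt0 : (0 < n)%N.
Implicit Types (x y v xi : 'rV[R]_n) (D E U : set 'rV[R]_n) (u : 'rV[R]_n -> R).
Local Notation mu := (@leb R n).
Local Notation MT := (caratheodory_type (@leb_outer R n)).

Lemma trunc_bound m u x : (`|trunc m u x| <= m%:R)%R.
Proof.
rewrite /trunc ler_norml le_max lexx orbT/= ge_max ge_min lexx orbT/=.
by rewrite (@le_trans _ _ 0%R)// oppr_le0.
Qed.

Lemma trunc_id m u x : (`|u x| <= m%:R)%R -> trunc m u x = u x.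
Proof.
rewrite ler_norml /trunc => /andP[h1 h2].
by rewrite (min_idPl h2); apply/max_idPl.
Qed.

Lemma trunc_ge m u x : (m%:R <= u x)%R -> trunc m u x = m%:R.
Proof.
move=> h; rewrite /trunc (min_idPr h); apply/max_idPl.
by rewrite (@le_trans _ _ 0%R)// oppr_le0.
Qed.

Lemma trunc_le m u x : (u x <= - m%:R)%R -> trunc m u x = (- m%:R)%R.
Proof.
move=> h; rewrite /trunc; apply/max_idPr; by rewrite ge_min h.
Qed.

Lemma trunc_cases m u x : [\/ (`|u x| <= m%:R)%R /\ trunc m u x = u x,
  (m%:R < u x)%R /\ trunc m u x = m%:R | (u x < - m%:R)%R /\ trunc m u x = (- m%:R)%R].
Proof.
have [h|h] := leP (`|u x|)%R (m%:R)%R; first by constructor 1; rewrite trunc_id.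
have [h2|h2] := ltP (m%:R)%R (u x); first by constructor 2; rewrite trunc_ge// ltW.
constructor 3; have : (u x < - m%:R)%R.
  by move: h; rewrite lter_normr => /orP[]; lra.
by move=> h3; rewrite trunc_le// ltW.
Qed.

Lemma trunc_lip m u (w : 'rV[R]_n -> R) x y :
  (`|trunc m u x - trunc m w y| <= `|u x - w y|)%R.
Proof.
have m0 : (0 <= m%:R :> R)%R by [].
case: (trunc_cases m u x) => -[h1 ->]; case: (trunc_cases m w y) => -[h2 ->] //;
  move: h1 h2; rewrite ?ler_norml => h1 h2;
  by case: (ler0P (u x - w y)%R) => h3; lra.
Qed.

Lemma trunc_trunc k m u : trunc k (trunc m u) = trunc (minn k m) u.
Proof.
apply/funext => x.
have k0 : (0 <= k%:R :> R)%R by [].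
have m0 : (0 <= m%:R :> R)%R by [].
have km : ((minn k m)%:R = Num.min k%:R m%:R :> R)%R.
  rewrite /minn; case: ifP => km; apply/esym; [apply/min_idPl|apply/min_idPr].
    by rewrite ler_nat ltnW.
  by rewrite ler_nat leqNgt km.
rewrite /trunc km; case: (leP (k%:R : R)%R (m%:R)%R) => km';
 rewrite /Num.max /Num.min; repeat case: ifPn => //; rewrite -?leNgt; lra.
Qed.

Lemma measurable_trunc m u (D' : set MT) :
  measurable_fun D' (u : MT -> R) -> measurable_fun D' (trunc m u : MT -> R).
Proof.
exact: measurable_clip.
Qed.

(** At an infinite limit the truncation equals m or -m up to a set of density 0, hence converges as
    well. *)
Lemma ap_lim_trunc m D u x (a : \bar R) : ap_lim D u x a ->
  exists b, ap_lim D (trunc m u) x b.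
Proof.
case: a => [r||] h.
- exists (trunc m (fun=> r) x)%:E => V nV.
  have : nbhs (trunc m (fun=> r) x) [set s : R | V s%:E] by [].
  move=> /nbhs_ballP[t /= t0 tV].
  have nW : nbhs (r%:E) [set e : \bar R | exists2 s : R, e = s%:E & (`|r - s| < t)%R].
    suff : nbhs r [set s : R | [set e : \bar R | exists2 s : R, e = s%:E & (`|r - s| < t)%R] s%:E] by [].
    by apply/nbhs_ballP; exists t => //= s rs; exists s.
  apply: (has_density0_sub (r0 := 1%R)) (h _ nW) => // y [[Dy Vy] _].
  split => // -[s [<-]] rs; apply: Vy; apply: tV; rewrite /ball/=.
  by apply: le_lt_trans rs; exact: (@trunc_lip m (fun=> r) u x y).
- exists m%:R%:E => V nV.
  have nW : nbhs (+oo : \bar R) [set e : \bar R | m%:R%:E < e].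
    by exists m%:R; split => //; exact: num_real.
  apply: (has_density0_sub (r0 := 1%R)) (h _ nW) => // y [[Dy Vy] _].
  split => //= uy; apply: Vy; rewrite trunc_ge; first exact: nbhs_singleton nV.
  by move: uy; rewrite lte_fin => /ltW.
- exists (- m%:R)%:E => V nV.
  have nW : nbhs (-oo : \bar R) [set e : \bar R | e < (- m%:R)%:E].
    by exists (- m%:R)%R; split => //; exact: num_real.
  apply: (has_density0_sub (r0 := 1%R)) (h _ nW) => // y [[Dy Vy] _].
  split => //= uy; apply: Vy; rewrite trunc_le; first exact: nbhs_singleton nV.
  by move: uy; rewrite lte_fin => /ltW.
Qed.

Lemma Sdisc_trunc m U u : Sdisc U (trunc m u) `<=` Sdisc U u.
Proof.
move=> x [Ux nx]; split => // -[a ha]; apply: nx; exact: ap_lim_trunc ha.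
Qed.

(* If the approximate limit of the truncation were +-m then, as the truncation
   stays on one side of it, a nonzero gradient would be violated on a cone. *)
Lemma is_ap_grad_trunc m U u x xi : open U -> U x -> xi != 0%R ->
  is_ap_grad U (trunc m u) x xi -> is_ap_grad U u x xi.
Proof.
move=> oU Ux xi0 [c] /ap_lim0P h.
have [r0 r00 xU] := open_eball oU Ux.
have notx y : (0 < enorm (y - x))%R -> y <> x.
  by move=> yx yxE; move: yx; rewrite yxE subrr /enorm /dot big1 ?sqrtr0 ?ltxx// => j _; rewrite mxE mulr0.
have tb y : (- m%:R <= trunc m u y <= m%:R)%R by rewrite -ler_norml; exact: trunc_bound.
have cm : (c < m%:R)%R.
  rewrite ltNge; apply/negP => mc.
  have [t t0 Ht] := cone_density n_gt0 xi0.
  apply: (Ht _ x r0 r00) (h t t0) => y /andP[yx yr0] ty.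
  split; first by split; [exact: xU|exact: notx].
  rewrite /= normrM normfV (gtr0_norm yx) ler_pdivlMr//.
  by rewrite ler_normr; apply/orP; right; have := tb y; lra.
have mc : (- m%:R < c)%R.
  rewrite ltNge; apply/negP => mc.
  have xi0' : (- xi)%R != 0%R by rewrite oppr_eq0.
  have [t t0 Ht] := cone_density n_gt0 xi0'.
  apply: (Ht _ x r0 r00) (h t t0) => y /andP[yx yr0]; rewrite dotNl => ty.
  split; first by split; [exact: xU|exact: notx].
  rewrite /= normrM normfV (gtr0_norm yx) ler_pdivlMr//.
  by rewrite ler_normr; apply/orP; left; have := tb y; lra.
pose l1 := (\sum_(i < n) `|xi ord0 i|)%R.
have l10 : (0 <= l1)%R by exact: sumr_ge0.
pose k := Num.min (m%:R - c)%R (c + m%:R)%R.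
have k0 : (0 < k)%R by rewrite lt_min; lra.
exists c; apply/ap_lim0P => t t0.
(* Within radius r1, a point where the truncation is saturated has |trunc - c| >= k, while the
   linear term is at most l1 |y - x|. The quotient there is at least 1 in absolute value, so such
   points form a set of density 0. *)
pose r1 := (k / (1 + l1))%R.
have r10 : (0 < r1)%R by rewrite divr_gt0//; lra.
apply: (has_density0_sub (r0 := r1)) (has_density0U (h t t0) (h 1%R ltr01)) => //.
move=> y [[Uy ty] yr1].
have yx : (0 < enorm (y - x))%R.
  rewrite lt_neqAle enorm_ge0 andbT; apply/eqP => /esym/enorm_eq0/eqP.
  by rewrite subr_eq0 => /eqP yxE; case: Uy.
have key : (k <= `|trunc m u y - c|)%R ->
    (1 <= `|(trunc m u y - c - dot xi (y - x)) / enorm (y - x)|)%R.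
  move=> kT; rewrite normrM normfV (gtr0_norm yx) ler_pdivlMr// mul1r.
  have := dot_le xi (y - x)%R; rewrite -/l1 => d1.
  have l11 : (0 < 1 + l1)%R by lra.
  move: yr1; rewrite /eball/= /r1 ltr_pdivlMr// => yr1.
  have := ler_normB (trunc m u y - c - dot xi (y - x))%R (- dot xi (y - x))%R.
  by rewrite opprK subrK normrN; lra.
have [k1 k2] : (k <= m%:R - c)%R /\ (k <= c + m%:R)%R by rewrite /k !ge_min !lexx orbT.
case: (trunc_cases m u y) => -[uy Tuy].
- by left; split => //=; rewrite Tuy.
- by right; split => //=; apply: key; rewrite Tuy ler_normr k1.
- right; split => //=; apply: key; rewrite Tuy ler_normr; apply/orP; right; lra.
Qed.

(** A nonzero approximate gradient of the truncation is one of u by [is_ap_grad_trunc]; when there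
    is none, the default value 0 of [ap_grad] settles the case. *)
Lemma enorm_ap_grad_trunc m U u x : open U -> U x ->
  (enorm (ap_grad U (trunc m u) x) <= enorm (ap_grad U u x))%R.
Proof.
move=> oU Ux; have e0 : enorm (0%R : 'rV[R]_n) = 0%R.
  by rewrite /enorm /dot big1 ?sqrtr0// => j _; rewrite mxE mulr0.
rewrite {1}/ap_grad; case: xgetP => [xi _ /= h|_]; last by rewrite e0 enorm_ge0.
have [->|xi0] := eqVneq xi 0%R; first by rewrite e0 enorm_ge0.
by rewrite (is_ap_grad_eq n_gt0 oU Ux (is_ap_grad_trunc oU Ux xi0 h)).
Qed.

(** If |a| > m, the bound |u| <= m would make the whole half-space exceptional near x; yet it
    contains a cone, which does not have density 0. *)
Lemma one_sided_bound m U u x (a : \bar R) (nu : 'rV[R]_n) : open U -> U x ->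
  nu != 0%R -> (forall y, (`|u y| <= m)%R) ->
  ap_lim (U `&` [set y | (0 < dot (y - x) nu)%R]) u x a ->
  `|a| <= m%:E.
Proof.
move=> oU Ux nu0 um h.
have [r0 r00 xU] := open_eball oU Ux.
have [t t0 Ht] := cone_density n_gt0 nu0.
rewrite leNgt; apply/negP => am.
have nV : nbhs a [set e : \bar R | m%:E < `|e|].
  case: a am {h} => [r /= rm||_].
  - suff : nbhs r [set s : R | [set e : \bar R | m%:E < `|e|] s%:E] by [].
    rewrite lte_fin in rm.
    apply/nbhs_ballP; exists (`|r| - m)%R => //=; first by rewrite subr_gt0.
    move=> s; rewrite /ball/= lte_fin => rs.
    have : (`|r| <= `|r - s| + `|s|)%R by rewrite -{1}(subrK s r) ler_normD.
    lra.
  - by move=> _; exists m; split => //; [exact: num_real|move=> e /= me; apply: lt_le_trans me _; exact: lee_abs].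
  - exists (- m)%R; split => //; [exact: num_real|move=> e /= me].
    by rewrite -abseN; apply: lt_le_trans (lee_abs _); rewrite EFinN in me; rewrite lteNr.
apply: (Ht _ x r0 r00) (h _ nV) => y /andP[yx yr0] ty.
split; last by rewrite /= lte_fin ltNge um.
split; first exact: xU.
by rewrite /= dotC; apply: lt_le_trans ty; rewrite mulr_gt0.
Qed.

End truncation.

(** * Integrals of functions of unknown measurability *)

Section lower_integral.
Context d (T : measurableType d) (R : realType) (mu : {measure set T -> \bar R}).
Implicit Types (D A : set T) (f g : T -> \bar R).

(** The integral of a nonnegative function is a supremum over the simple functions below it, hence
    monotone on arbitrary functions; approximate gradients and jumps are handled in this way. *)
Lemma ge0_le_lower_integral D f g : (forall x, D x -> 0 <= f x) ->
  (forall x, D x -> f x <= g x) -> \int[mu]_(x in D) f x <= \int[mu]_(x in D) g x.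
Proof.
move=> f0 fg; rewrite !ge0_integralE//; last by move=> x Dx; apply: le_trans (fg x Dx); exact: f0.
apply: le_ereal_sup => _ [h /= hf <-]; exists h => //= x.
apply: le_trans (hf x) _; rewrite /patch; case: ifPn => // /set_mem; exact: fg.
Qed.

Import HBNNSimple.

(** A simple function below f is at most c and vanishes outside a measurable set B contained in both
    D and A. *)
Lemma lower_integral_le_measure D A f (c : R) (N : \bar R) : (0 <= c)%R ->
  (forall x, D x -> 0 <= f x <= c%:E) -> (forall x, D x -> ~ A x -> f x = 0) ->
  (forall B, measurable B -> B `<=` D `&` A -> mu B <= N) ->
  \int[mu]_(x in D) f x <= c%:E * N.
Proof.
move=> c0 fc fA HN; rewrite ge0_integralE; last by move=> x /fc/andP[].
apply: ge_ereal_sup => _ [h /= hf <-]; rewrite -integralT_nnsfun.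
pose B := h @^-1` [set~ 0%R].
have mB : measurable B by apply: measurable_funPTI; apply: measurableC; exact: measurable_set1.
have BDA : B `<=` D `&` A.
  move=> x; rewrite /B /= => hx0.
  have h0 : 0 < (h x)%:E by rewrite lte_fin lt_neqAle fun_ge0 andbT eq_sym; apply/eqP.
  have := lt_le_trans h0 (hf x); rewrite /patch; case: ifPn => [/set_mem Dx|]; last by rewrite ltxx.
  move=> fx0; split => //; apply: contrapT => /fA -/(_ Dx) fx.
  by rewrite fx ltxx in fx0.
apply: (@le_trans _ _ (\int[mu]_x (c%:E * (\1_B x)%:E))).
  apply: ge0_le_integral => //.
  - by move=> x _; rewrite lee_fin.
  - exact/measurable_EFinP.
  - by apply: measurable_funeM; apply/measurable_EFinP; exact: measurable_indic.
  - move=> x _; rewrite indicE; have [/set_mem Bx|/negP Bx] := boolP (x \in B).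
      have [Dx Ax] := BDA _ Bx; have := hf x; rewrite mule1 /patch mem_set// => /le_trans; apply.
      by have /andP[] := fc _ Dx.
    rewrite mule0 lee_fin le_eqVlt; apply/orP; left; apply/eqP.
    by apply: contrapT => hx; apply: Bx; apply/mem_set.
rewrite ge0_integralZl//; last by apply/measurable_EFinP; exact: measurable_indic.
by rewrite integral_indic// setIT lee_wpmul2l//; exact: HN.
Qed.

(** If h is a simple function below c + f, the positive part of h - c is measurable and lies below
    f. *)
Lemma lower_integral_cstD D f (c : R) : measurable D -> (0 <= c)%R ->
  (forall x, D x -> 0 <= f x) ->
  \int[mu]_(x in D) (c%:E + f x) <= c%:E * mu D + \int[mu]_(x in D) f x.
Proof.
move=> mD c0 f0; rewrite ge0_integralE; last by move=> x /f0 fx; rewrite adde_ge0.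
apply: ge_ereal_sup => _ [h /= hf <-]; rewrite -integralT_nnsfun.
pose k (x : T) : R := Num.max (h x - c)%R 0%R.
have mh : measurable_fun D (h : T -> R) by exact: measurable_funTS.
have mk : measurable_fun D (EFin \o k).
  by apply/measurable_EFinP; apply: measurable_maxr => //; exact: measurable_funB.
apply: (@le_trans _ _ (\int[mu]_(x in D) (c%:E + (k x)%:E))).
  rewrite (_ : \int[mu]_x (h x)%:E = \int[mu]_(x in D) (h x)%:E); last first.
    rewrite [RHS]integral_mkcond; apply: eq_integral => x _; rewrite /patch.
    case: ifPn => // xD; apply/le_anti/andP; split; last by rewrite lee_fin fun_ge0.
    by have := hf x; rewrite /patch (negbTE xD).
  apply: ge0_le_integral => //.
  - by move=> x _; rewrite lee_fin.
  - exact/measurable_EFinP.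
  - exact: emeasurable_funD.
  - by move=> x _; rewrite -EFinD lee_fin -lerBlDl le_max lexx.
rewrite ge0_integralD//; last first.
  by move=> x _; rewrite lee_fin le_max lexx orbT.
rewrite integral_cst//; apply: leeD => //.
apply: ge0_le_lower_integral => x Dx; first by rewrite lee_fin le_max lexx orbT.
rewrite /k; case: (leP (h x - c)%R 0%R) => _; first exact: f0.
have := hf x; rewrite /patch mem_set// => h1.
by rewrite EFinB leeBlDl.
Qed.

(** The integrals of the positive and the negative part of f both lie between 0 and that of g, hence
    so does the absolute value of their difference, without a factor 2. *)
Lemma abse_lower_integral_le D f g : (forall x, D x -> `|f x| <= g x) ->
  `|\int[mu]_(x in D) f x| <= \int[mu]_(x in D) g x.
Proof.
move=> fg.
have g0 : 0 <= \int[mu]_(x in D) g x.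
  by apply: integral_ge0 => x Dx; apply: le_trans (fg x Dx).
have [->|goo] := eqVneq (\int[mu]_(x in D) g x) +oo; first by rewrite leey.
rewrite integralE.
have hp : \int[mu]_(x in D) f^\+ x <= \int[mu]_(x in D) g x.
  apply: ge0_le_lower_integral => // x Dx; apply: le_trans (fg _ Dx).
  by rewrite funepos.unlock ge_max lee_abs abse_ge0.
have hn : \int[mu]_(x in D) f^\- x <= \int[mu]_(x in D) g x.
  apply: ge0_le_lower_integral => // x Dx; apply: le_trans (fg _ Dx).
  by rewrite funeneg.unlock ge_max abse_ge0 andbT -abseN lee_abs.
move: hp hn; have : 0 <= \int[mu]_(x in D) f^\+ x by exact: integral_ge0.
have : 0 <= \int[mu]_(x in D) f^\- x by exact: integral_ge0.
move: (\int[mu]_(x in D) f^\+ x) (\int[mu]_(x in D) f^\- x) (\int[mu]_(x in D) g x) g0 goo.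
move=> [a||] [b||] [c||] //=; rewrite ?lee_fin => c0 _ b0 a0 ac bc.
by rewrite ler_norml; lra.
Qed.

End lower_integral.

(** * Truncation and total variation in SBV *)

Section sbv.
Context (R : realType) (n : nat).
Hypothesis n_gt0 : (0 < n)%N.
Implicit Types (x y v xi : 'rV[R]_n) (D E U W : set 'rV[R]_n) (u : 'rV[R]_n -> R).
Local Notation mu := (@leb R n).
Local Notation MT := (caratheodory_type (@leb_outer R n)).

Lemma sqr_enorm_ap_grad_trunc m U u x : open U -> U x ->
  (enorm (ap_grad U (trunc m u) x) ^+ 2 <= enorm (ap_grad U u x) ^+ 2)%R.
Proof.
move=> oU Ux; have := enorm_ap_grad_trunc n_gt0 m u oU Ux.
have := enorm_ge0 (ap_grad U (trunc m u) x).
move: (enorm (ap_grad U (trunc m u) x)) (enorm (ap_grad U u x)) => a b a0 ab.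
by rewrite !expr2; apply: ler_pM.
Qed.

Lemma int_ap_grad_trunc m U u : open U ->
  \int[mu]_(x in U) (enorm (ap_grad U (trunc m u) x) ^+ 2)%:E <=
  \int[mu]_(x in U) (enorm (ap_grad U u x) ^+ 2)%:E.
Proof.
move=> oU; apply: ge0_le_lower_integral => x Ux; rewrite lee_fin; first exact: sqr_ge0.
exact: sqr_enorm_ap_grad_trunc.
Qed.

Lemma GSBV2_trunc m U u : open U -> GSBV2 U u -> GSBV2 U (trunc m u).
Proof.
move=> oU [[Lu Su] gu hu]; split.
- split; first by have [] := Su m.
  by move=> k; rewrite trunc_trunc; exact: Su.
- by apply: le_lt_trans gu; exact: int_ap_grad_trunc.
- apply: le_lt_trans hu; apply: le_outer_measure; exact: Sdisc_trunc.
Qed.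

Lemma FeE U (e b : R) u : GSBV2 U u -> Fe U e b u =
    \int[mu]_(x in U) (enorm (ap_grad U u x) ^+ 2)%:E
    + @hausdorff R n n.-1 (Sdisc U u `&` (U `&` eps_perforated e))
    + b%:E * @hausdorff R n n.-1 (Sdisc U u `&` (U `\` eps_perforated e)).
Proof. by move=> gu; rewrite /Fe asboolT. Qed.

Lemma FeNE U (e b : R) u : ~ GSBV2 U u -> Fe U e b u = +oo.
Proof. by move=> gu; rewrite /Fe asboolF. Qed.

Lemma Fe_trunc_le m U (e b : R) u : open U -> (0 <= b)%R ->
  Fe U e b (trunc m u) <= Fe U e b u.
Proof.
move=> oU b0; have [gu|gu] := pselect (GSBV2 U u); last by rewrite (FeNE _ _ gu) leey.
rewrite (FeE _ _ gu) (FeE _ _ (GSBV2_trunc m oU gu)).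
apply: leeD; first apply: leeD.
- exact: int_ap_grad_trunc.
- by apply: le_outer_measure; apply: setSI; exact: Sdisc_trunc.
- apply: lee_wpmul2l; first by rewrite lee_fin.
  by apply: le_outer_measure; apply: setSI; exact: Sdisc_trunc.
Qed.

Lemma Sdisc0 U : Sdisc U (fun=> 0%R : R) = set0.
Proof.
apply/seteqP; split => // x [Ux []]; exists 0; apply/ap_lim0P => t t0.
apply: (@has_density0_sub _ _ _ set0 _ 1%R); [by []| |exact: has_density0_0].
by move=> y [[_ /=]]; rewrite normr0 leNgt t0.
Qed.

Lemma SBV0 U : open U -> SBV U (fun=> 0%R : R).
Proof.
move=> oU.
have g0 x : U x -> ap_grad U (fun=> 0%R) x = 0%R by exact: ap_grad_cst.
have e0 : enorm (0%R : 'rV[R]_n) = 0%R.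
  by rewrite /enorm /dot big1 ?sqrtr0// => j _; rewrite mxE mulr0.
split.
- exact: integrable0.
- by rewrite integral0_eq// => x Ux; rewrite g0// e0.
- by rewrite Sdisc0 integral_set0.
- move=> i phi _; rewrite Sdisc0 integral_set0 adde0.
  rewrite integral0_eq ?integral0_eq ?oppe0// => x Ux; last by rewrite mul0r.
  by rewrite g0// mxE mul0r.
Qed.

Lemma GSBV2_0 U : open U -> GSBV2 U (fun=> 0%R : R).
Proof.
move=> oU; have e0 : enorm (0%R : 'rV[R]_n) = 0%R.
  by rewrite /enorm /dot big1 ?sqrtr0// => j _; rewrite mxE mulr0.
split.
- split; first exact: integrable0.
  move=> m; rewrite (_ : trunc m _ = fun=> 0%R); first exact: SBV0.
  by apply/funext => x; rewrite trunc_id// normr0.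
- by rewrite integral0_eq// => x Ux; rewrite ap_grad_cst// e0 expr0n.
- by rewrite Sdisc0 measure0.
Qed.

Lemma Fe0 U (e b : R) : open U -> Fe U e b (fun=> 0%R) = 0.
Proof.
move=> oU; rewrite FeE; last exact: GSBV2_0.
have e0 : enorm (0%R : 'rV[R]_n) = 0%R.
  by rewrite /enorm /dot big1 ?sqrtr0// => j _; rewrite mxE mulr0.
rewrite Sdisc0 !set0I measure0 mule0 !adde0 integral0_eq// => x Ux.
by rewrite ap_grad_cst// e0 expr0n.
Qed.

(** The second trace is a trace from the side of -nu, so [one_sided_bound] applies to it too; where
    no jump triple exists the default value gives the jump 0. *)
Lemma jump_bound (m : R) U u x : (0 <= m)%R -> open U -> U x ->
  (forall y, (`|u y| <= m)%R) -> `|jump U u x| <= (2 * m)%:E.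
Proof.
move=> m0 oU Ux um; rewrite /jump /jump_triple; case: xgetP => [[[a b] nu] _ /= [_ nu1 ha hb]|_].
  have nu0 : nu != 0%R.
    apply/eqP => nu0; move: nu1; rewrite nu0 /enorm /dot big1 ?sqrtr0.
      by move/eqP; rewrite eq_sym oner_eq0.
    by move=> j _; rewrite mxE mulr0.
  have am := one_sided_bound n_gt0 oU Ux nu0 um ha.
  have bm : `|b| <= m%:E.
    apply: (@one_sided_bound _ _ n_gt0 m U u x b (- nu)%R oU Ux _ um).
      by rewrite oppr_eq0.
    rewrite (_ : [set y | (0 < dot (y - x) (- nu))%R] = [set y | (dot (y - x) nu < 0)%R])//.
    have dN y : dot (y - x) (- nu) = (- dot (y - x) nu)%R by rewrite dotC dotNl dotC.
    by apply/seteqP; split => y /=; rewrite dN oppr_gt0.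
  apply: le_trans (lee_abs_sub _ _) _.
  by rewrite mulr_natl mulr2n EFinD leeD.
by rewrite sube0 abse0 lee_fin mulr_ge0.
Qed.

Lemma normal_bound U u x (i : 'I_n) : (`|normal U u x ord0 i| <= 1)%R.
Proof.
rewrite /normal /jump_triple; case: xgetP => [[[a b] nu] _ /= [_ <- _ _]|_].
  exact: coord_le_enorm.
by rewrite mxE normr0.
Qed.

(** After integration by parts, the gradient is bounded by 1 + |grad u|^2 and the jump by 2 m. The
    jump part is seen only where phi is nonzero, inside W: with W the perforated set, this is the
    part of the jump set penalised with coefficient 1. *)
Lemma tv_bound (m : R) U W u (phi : 'rV[R]_n -> R) (i : 'I_n) :
  (0 <= m)%R -> open U -> SBV U u -> (forall y, (`|u y| <= m)%R) ->
  test_function (U `&` W) phi -> (forall x, (`|phi x| <= 1)%R) ->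
  `|\int[mu]_(x in U) (u x * partial i phi x)%:E| <=
   mu U + \int[mu]_(x in U) (enorm (ap_grad U u x) ^+ 2)%:E
   + (2 * m)%:E * @hausdorff R n n.-1 (Sdisc U u `&` (U `&` W)).
Proof.
move=> m0 oU [_ _ _ ibp] um [phi1 phi2 phi3 phi4] phi_le.
have tU : test_function U phi.
  by split => //; apply: subset_trans phi4 _; exact: subIsetl.
rewrite ibp// abseN; apply: le_trans (lee_abs_add _ _) _; apply: leeD.
  apply: (@le_trans _ _ (\int[mu]_(x in U) (1%:E + (enorm (ap_grad U u x) ^+ 2)%:E))).
    apply: abse_lower_integral_le => x Ux; rewrite -EFinD lee_fin normrM.
    apply: (@le_trans _ _ (enorm (ap_grad U u x))).
      by rewrite -[leRHS]mulr1; apply: ler_pM => //; exact: coord_le_enorm.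
    have := enorm_ge0 (ap_grad U u x); set z := enorm _ => z0.
    by have := sqr_ge0 (z - 1)%R; nra.
  rewrite -[X in X + _]mul1e; apply: lower_integral_cstD => //.
  - exact: (open_leb_measurable n_gt0).
  - by move=> x _; rewrite lee_fin sqr_ge0.
have phi0 x : ~ (U `&` W) x -> phi x = 0%R.
  move=> UWx; apply: contrapT => /eqP px; apply: UWx; apply: phi4.
  exact: subset_closure.
apply: (@le_trans _ _ (\int[@hausdorff R n n.-1]_(x in Sdisc U u)
   `|jump U u x * (normal U u x ord0 i * phi x)%:E|)).
  exact: abse_lower_integral_le.
apply: (@lower_integral_le_measure _ _ R (@hausdorff R n n.-1) (Sdisc U u)
  (U `&` W) (fun x => `|jump U u x * (normal U u x ord0 i * phi x)%:E|)
  (2 * m)%R _).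
- by rewrite mulr_ge0.
- move=> x [Ux _]; rewrite abse_ge0/= abseM -[leRHS]mule1; apply: lee_pmul => //.
    exact: jump_bound.
  rewrite /= lee_fin normrM -[leRHS]mulr1; apply: ler_pM => //.
  exact: normal_bound.
- by move=> x Sx /phi0 ->; rewrite mulr0 mule0 abse0.
- by move=> B _ BS; apply: le_outer_measure.
Qed.

End sbv.

(** * The perforated domain *)

Section perforation.
Context (R : realType) (n : nat).
Hypothesis n_gt0 : (0 < n)%N.
Implicit Types (x y : 'rV[R]_n).
Local Notation mu := (@leb R n).
Local Notation MT := (caratheodory_type (@leb_outer R n)).
Local Notation lmeasurable A :=
  (measurable (A : set (caratheodory_type (@leb_outer R n)))).

(* The perforated space is the union of these slabs, one family for each
   coordinate direction. *)
Definition slab (e : R) (l : 'I_n) : set 'rV[R]_n :=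
  [set x | exists q : int, (e * (q%:~R + 1 / 4) < x ord0 l < e * (q%:~R + 3 / 4))%R].

Lemma far_from_intP (t : R) : (forall q : int, 1 / 4 < `|t - q%:~R|)%R <->
  exists q : int, (q%:~R + 1 / 4 < t < q%:~R + 3 / 4)%R.
Proof.
split=> [h|[q qt] p].
  exists (Num.floor t); have := floor_le_tmp t; have := floorD1_gt t.
  have := h (Num.floor t); have := h (Num.floor t + 1)%R.
  rewrite intrD; move: (Num.floor t)%:~R => a.
  rewrite !lter_normr => /orP[] h1 /orP[] h2 h3 h4; lra.
rewrite lter_normr; apply/orP.
have [pq|qp] := leP p q.
  have pq1 : (p%:~R <= q%:~R :> R)%R by rewrite ler_int.
  by left; lra.
have qp1 : ((q + 1)%:~R <= p%:~R :> R)%R by rewrite ler_int lezD1.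
by right; move: qp1; rewrite intrD; lra.
Qed.

Lemma closure_cube (r : R) x : (0 < r)%R ->
  closure (@cube R n r) x <-> forall i, (`|x ord0 i| <= r / 2)%R.
Proof.
move=> r0; split=> [cx i|xr].
  rewrite leNgt; apply/negP => xi.
  pose d := (`|x ord0 i| - r / 2)%R; have d0 : (0 < d)%R by rewrite subr_gt0.
  have [y [yc [_ /(_ ord0 i)]]] := cx _ (nbhsx_ballx x d d0).
  rewrite /ball/= => xy; have := yc i; move: xy; rewrite /d.
  have : (`|x ord0 i| <= `|x ord0 i - y ord0 i| + `|y ord0 i|)%R by rewrite -{1}(subrK (y ord0 i) (x ord0 i)) ler_normD.
  rewrite -ltr_norml; lra.
move=> B /nbhs_ballP[e /= e0 xeB].
pose s := (e / (r + e))%R.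
have s0 : (0 < s)%R by rewrite divr_gt0//; lra.
have s1 : (s < 1)%R by rewrite ltr_pdivrMr; lra.
have sr : (s * (r / 2) < e)%R.
  rewrite /s; have -> : (e / (r + e) * (r / 2) = e * (r / 2 / (r + e)))%R by field; lra.
  by rewrite gtr_pMr// ltr_pdivrMr; lra.
(* Shrinking towards the origin brings a point of the closed cube into the open one and moves it by
   at most s r / 2 < e. *)
exists ((1 - s) *: x)%R; split.
  move=> i; rewrite mxE -ltr_norml normrM gtr0_norm; last lra.
  apply: (@le_lt_trans _ _ ((1 - s) * (r / 2))%R); first by rewrite ler_wpM2l//; lra.
  by rewrite gtr_pMl; lra.
apply: xeB; split => // j i; rewrite ord1 /ball/= mxE.
have -> : (x ord0 i - (1 - s) * x ord0 i = s * x ord0 i)%R by ring.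
rewrite normrM gtr0_norm//; apply: le_lt_trans sr.
by rewrite ler_wpM2l// ltW.
Qed.

(** A point lies in a hole when each rescaled coordinate is within 1/4 of an integer, these integers
    being the index of the hole; outside all holes some coordinate is therefore in a slab. *)
Lemma eps_perforatedE (e : R) : (0 < e)%R ->
  @eps_perforated R n e = [set x | exists l, slab e l x].
Proof.
move=> e0; apply/seteqP; split => x /=.
  move=> [y Py <-]; apply: contrapT => nl; apply: Py.
  have : forall l, exists q : int, (`|y ord0 l - q%:~R| <= 1 / 4)%R.
    move=> l; apply: contrapT => /forallNP h; apply: nl; exists l.
    have /far_from_intP[q] : (forall q : int, 1 / 4 < `|y ord0 l - q%:~R|)%R.
      by move=> q; have /negP := h q; rewrite -ltNge.
    by move=> qy; exists q; rewrite mxE !ltr_pM2l.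
  move=> /choice[z Hz]; exists (\row_l z l)%R => //.
  exists (y - map_mx intr (\row_l z l))%R; last by rewrite addrC subrK.
  by apply/closure_cube => [|i]; [lra|rewrite !mxE; have := Hz i; lra].
move=> [l [q qx]]; exists (e^-1 *: x)%R; last by rewrite scalerA divff ?scale1r// gt_eqF.
move=> [z _ [y /closure_cube]] yc yx.
have {}yc : forall i, (`|y ord0 i| <= 1 / 2 / 2)%R by apply: yc; lra.
have /far_from_intP/(_ (z ord0 l)) : exists q : int, (q%:~R + 1 / 4 < e^-1 * x ord0 l < q%:~R + 3 / 4)%R.
  exists q; move: qx; rewrite -[(q%:~R + 1 / 4 < _)%R](ltr_pM2l e0) -[(_ < q%:~R + 3 / 4)%R](ltr_pM2l e0).
  by rewrite mulrA divff ?mul1r// gt_eqF.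
have -> : (e^-1 * x ord0 l = (z ord0 l)%:~R + y ord0 l)%R.
  by move/rowP : yx => /(_ l); rewrite !mxE => <-.
rewrite addrC addKr; have := yc l; lra.
Qed.

Lemma open_coord (I : interval R) (l : 'I_n) : open [set` I] ->
  open [set x : 'rV[R]_n | x ord0 l \in I].
Proof.
move=> oI; have /continuousP/(_ _ oI) := @coord_continuous R 1 n ord0 l.
by [].
Qed.

Lemma slab_open (e : R) (l : 'I_n) : open (slab e l).
Proof.
rewrite (_ : slab e l = \bigcup_q [set x | x ord0 l \in
    `](e * (q%:~R + 1 / 4))%R, (e * (q%:~R + 3 / 4))%R[]).
  by apply: bigcup_open => q _; apply: open_coord; exact: interval_open.
apply/seteqP; split => x /=; first by move=> [q qx]; exists q => //=; rewrite in_itv.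
by move=> [q _ /=]; rewrite in_itv/= => qx; exists q.
Qed.

Lemma eps_perforated_open (e : R) : (0 < e)%R -> open (@eps_perforated R n e).
Proof.
move=> e0; rewrite eps_perforatedE//.
rewrite (_ : [set x | _] = \bigcup_l slab e l).
  by apply: bigcup_open => l _; exact: slab_open.
by apply/seteqP; split => x /= [l]; [exists l|move=> _ ?; exists l].
Qed.

Lemma hole_complement (e : R) (z : 'I_n -> int) x : (0 < e)%R ->
  (forall i, e * ((z i)%:~R - 1 / 2) <= x ord0 i < e * ((z i)%:~R + 1 / 2))%R ->
  ~ @eps_perforated R n e x <->
  cbox (\row_i (e * ((z i)%:~R - 1 / 4))%R) (\row_i (e * ((z i)%:~R + 1 / 4))%R) x.
Proof.
move=> e0 xz; rewrite eps_perforatedE//; split.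
  move=> nl i; rewrite !mxE; apply: contrapT => xi; apply: nl; exists i.
  have := xz i; have [x1|x1] := ltP (x ord0 i) (e * ((z i)%:~R - 1 / 4))%R.
    move=> /andP[x2 _]; exists (z i - 1)%R; rewrite intrB -[1%:~R]/1%R.
    have := mulr_gt0 e0; have := e0; nra.
  have [x3|x3] := ltP (e * ((z i)%:~R + 1 / 4))%R (x ord0 i).
    by move=> /andP[_ x2]; exists (z i); nra.
  by case: xi; rewrite x1 x3.
move=> hx [l [q /andP[q1 q2]]]; have := hx l; rewrite !mxE => /andP[h1 h2].
have : (q%:~R + 1 / 4 < (z l)%:~R + 1 / 4 :> R)%R by rewrite -(ltr_pM2l e0); lra.
have : ((z l)%:~R - 1 / 4 < q%:~R + 3 / 4 :> R)%R by rewrite -(ltr_pM2l e0); lra.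
move=> a1 a2.
have : (q < z l)%R by rewrite -(ltr_int R); lra.
have : (z l < q + 1)%R by rewrite -(ltr_int R) intrD; lra.
by lia.
Qed.

Lemma vol_cst (a b : 'rV[R]_n) (c : R) : (forall i, b ord0 i - a ord0 i = c)%R ->
  vol a b = (c ^+ n)%R :> R.
Proof. by move=> abc; rewrite /vol (eq_bigr (fun=> c)) ?prodr_const ?card_ord. Qed.

(** A cube of side e loses one hole of side e / 2. The cell C may be open or half-open: it is the
    unit cube in [CPE] and a grid cell in [weak_perforated]. *)
Lemma mu_cell_perforated (e : R) (z : 'I_n -> int) (C : set 'rV[R]_n) :
  (0 < e)%R -> lmeasurable C ->
  (forall x, (forall i, e * ((z i)%:~R - 1 / 2) < x ord0 i < e * ((z i)%:~R + 1 / 2))%R -> C x) ->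
  (forall x, C x ->
    forall i, (e * ((z i)%:~R - 1 / 2) <= x ord0 i < e * ((z i)%:~R + 1 / 2))%R) ->
  mu (C `&` @eps_perforated R n e) = (e ^+ n * (1 - (1 / 2) ^+ n))%:E.
Proof.
move=> e0 mC oC Cc.
pose a : 'rV[R]_n := (\row_i (e * ((z i)%:~R - 1 / 4)))%R.
pose b : 'rV[R]_n := (\row_i (e * ((z i)%:~R + 1 / 4)))%R.
pose a' : 'rV[R]_n := (\row_i (e * ((z i)%:~R - 1 / 2)))%R.
pose b' : 'rV[R]_n := (\row_i (e * ((z i)%:~R + 1 / 2)))%R.
have -> : C `&` @eps_perforated R n e = C `\` cbox a b.
  apply/seteqP; split => x [Cx].
    by move=> Px; split => // xab; have [_ /(_ xab)] := hole_complement e0 (Cc _ Cx).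
  move=> nx; split => //; apply: contrapT => nP; apply: nx.
  by have [/(_ nP)] := hole_complement e0 (Cc _ Cx).
have muC : mu C = (e ^+ n)%:E.
  rewrite (@leb_box _ _ n_gt0 a' b').
  - by congr EFin; apply: vol_cst => i; rewrite !mxE; field.
  - by move=> i; rewrite !mxE ler_pM2l//; lra.
  - by move=> x h; apply: oC => i; have := h i; rewrite !mxE.
  - by move=> x /Cc h i; rewrite !mxE; have /andP[-> /ltW ->] := h i.
have mub : mu (cbox a b) = ((e / 2) ^+ n)%:E.
  rewrite (@leb_box _ _ n_gt0 a b).
  - by congr EFin; apply: vol_cst => i; rewrite !mxE; field.
  - by move=> i; rewrite !mxE ler_pM2l//; lra.
  - by move=> x h i; have /andP[/ltW -> /ltW ->] := h i.
  - by [].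
have abC : cbox a b `<=` C.
  by move=> x h; apply: oC => i; have := h i; rewrite !mxE; nra.
have Coo : mu C < +oo by rewrite muC ltry.
have := measureD mC (cbox_measurable n_gt0 a b) Coo.
rewrite (setIidr abC) => mD; apply: (etrans mD).
transitivity ((e ^+ n)%:E - ((e / 2) ^+ n)%:E).
  by congr (_ - _); [exact: muC|exact: mub].
by rewrite -EFinB; congr EFin; rewrite !exprMn expr1n; ring.
Qed.

Lemma CPE : CP R n = (1 - (1 / 2) ^+ n)%:E.
Proof.
rewrite /CP.
have -> : @perforated R n = eps_perforated 1.
  apply/seteqP; split => x /=; first by exists x => //; rewrite scale1r.
  by move=> [y Py <-]; rewrite scale1r.
rewrite (@mu_cell_perforated 1%R (fun=> 0%R)) ?expr1n ?mul1r//.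
- rewrite (_ : cube _ = obox (const_mx (- (1 / 2)))%R (const_mx (1 / 2))%R); first exact: obox_measurable.
  by apply/seteqP; split => x h i; have := h i; rewrite !mxE.
- by move=> x h i; have := h i; lra.
- by move=> x h i; have := h i; lra.
Qed.

Lemma CP_ge : (1 / 2)%:E <= CP R n.
Proof.
rewrite CPE lee_fin; suff : ((1 / 2) ^+ n <= 1 / 2 :> R)%R by lra.
by case: n n_gt0 => // k _; rewrite exprS ler_piMr ?exprn_ile1//; lra.
Qed.

Lemma CP_le1 : CP R n <= 1.
Proof. by rewrite CPE lee_fin gerBl exprn_ge0//; lra. Qed.

End perforation.

(** * Weak convergence of the perforated sets *)

Section cell_average.
Context d (T : measurableType d) (R : realType) (mu : {measure set T -> \bar R}).

Lemma integral_cells (I : finType) (C : I -> set T) (D : set T) (f : T -> R) :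
  measurable D -> (forall i, measurable (C i)) ->
  (forall i j x, C i x -> C j x -> i = j) ->
  measurable_fun [set: T] f -> (forall x, 0 <= f x)%R ->
  (forall x, (forall i, ~ C i x) -> f x = 0%R) ->
  \int[mu]_(x in D) (f x)%:E = \sum_i \int[mu]_(x in C i `&` D) (f x)%:E.
Proof.
move=> mD mC disj mf f0 fC.
have mCD i : measurable (C i `&` D) by exact: measurableI.
have tCD : trivIset [set` index_enum I] (fun i => C i `&` D).
  by move=> i j _ _ [x [[Ci _] [Cj _]]]; exact: disj Ci Cj.
rewrite -(@ge0_integral_bigsetU _ _ _ mu _ (fun i => C i `&` D) _ (index_enum I))//.
- rewrite integral_mkcond [RHS]integral_mkcond; apply: eq_integral => x _.
  rewrite /patch -bigcup_seq; case: ifPn => [/set_mem Dx|/negP Dx].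
    case: ifPn => // /negP xU; congr EFin; apply: fC => i Ci; apply: xU.
    by apply/mem_set; exists i => //=; rewrite mem_index_enum.
  by case: ifPn => // /set_mem[i _ [_ Dx']]; case: Dx; apply/mem_set.
- exact: index_enum_uniq.
- by apply: measurable_funTS; exact/measurable_EFinP.
- by move=> x _; rewrite lee_fin.
Qed.

(** The proportion c is exact for the constant h; replacing f by h costs at most e on the cell and
    at most e on its perforated part. *)
Lemma cell_average_le (C P : set T) (f : T -> R) (h c : R) :
  measurable C -> measurable P -> measurable_fun [set: T] f ->
  (forall x, 0 <= f x)%R -> (0 <= h)%R -> (0 <= c <= 1)%R -> mu C < +oo ->
  mu (C `&` P) = c%:E * mu C ->
  forall e, e = \int[mu]_(x in C) (`|f x - h|%R)%:E ->
  \int[mu]_(x in C `&` P) (f x)%:E <= c%:E * \int[mu]_(x in C) (f x)%:E + (e + e) /\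
  c%:E * \int[mu]_(x in C) (f x)%:E <= \int[mu]_(x in C `&` P) (f x)%:E + (e + e).
Proof.
move=> mC mP mf f0 h0 /andP[c0 c1] Coo CP e eE.
have mCP : measurable (C `&` P) by exact: measurableI.
have mEf D : measurable_fun D (fun x => (f x)%:E).
  by apply: measurable_funTS; exact/measurable_EFinP.
have mfh D : measurable_fun D (fun x => (`|f x - h|%R)%:E).
  apply: measurable_funTS; apply/measurable_EFinP; apply: measurableT_comp => //.
  exact: measurable_funB.
have e0 : 0 <= e by rewrite eE; apply: integral_ge0 => x _; rewrite lee_fin.
have eP : \int[mu]_(x in C `&` P) (`|f x - h|%R)%:E <= e.
  by rewrite eE; apply: ge0_subset_integral => //.
have up D : measurable D ->
    \int[mu]_(x in D) (f x)%:E <= h%:E * mu D + \int[mu]_(x in D) (`|f x - h|%R)%:E.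
  move=> mD; rewrite -integral_cst// -ge0_integralD//.
  apply: ge0_le_integral => //.
  - by move=> x _; rewrite lee_fin.
  - by apply: emeasurable_funD => //; exact: measurable_cst.
  - move=> x _; rewrite -EFinD lee_fin; have := ler_norm (f x - h)%R; lra.
have dn D : measurable D ->
    h%:E * mu D <= \int[mu]_(x in D) (f x)%:E + \int[mu]_(x in D) (`|f x - h|%R)%:E.
  move=> mD; rewrite -integral_cst// -ge0_integralD//; last by move=> x _; rewrite lee_fin.
  apply: ge0_le_integral => //.
  - by apply: emeasurable_funD.
  - move=> x _; rewrite -EFinD lee_fin; have := ler_norm (- (f x - h))%R; rewrite normrN; lra.
have ce : c%:E * e <= e by rewrite -[leRHS]mul1e lee_wpmul2r.
have intf0 : forall D, 0 <= \int[mu]_(x in D) (f x)%:E.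
  by move=> D; apply: integral_ge0 => x _; rewrite lee_fin.
split.
  apply: le_trans (up _ mCP) _; rewrite CP muleCA [leRHS]addeA; apply: leeD => //.
  apply: (@le_trans _ _ (c%:E * (\int[mu]_(x in C) (f x)%:E + e))).
    by apply: lee_wpmul2l; rewrite ?lee_fin// eE; exact: dn.
  by rewrite ge0_muleDr//; exact: leeD2l.
apply: (@le_trans _ _ (c%:E * (h%:E * mu C + e))).
  by apply: lee_wpmul2l; rewrite ?lee_fin// eE; exact: up.
rewrite ge0_muleDr//; last by rewrite mule_ge0.
rewrite muleCA -CP [leRHS]addeA; apply: leeD => //.
by apply: le_trans (dn _ mCP) _; exact: leeD2l.
Qed.

Lemma weak_average (I : finType) (C : I -> set T) (P : set T) (f : T -> R)
    (h : I -> R) (c tau : R) :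
  measurable P -> (forall i, measurable (C i)) ->
  (forall i j x, C i x -> C j x -> i = j) ->
  measurable_fun [set: T] f -> (forall x, 0 <= f x)%R ->
  (forall x, (forall i, ~ C i x) -> f x = 0%R) ->
  (forall i, 0 <= h i)%R -> (0 <= c <= 1)%R -> (forall i, mu (C i) < +oo) ->
  (forall i, mu (C i `&` P) = c%:E * mu (C i)) ->
  \sum_i \int[mu]_(x in C i) (`|f x - h i|%R)%:E <= tau%:E ->
  \int[mu]_(x in P) (f x)%:E <= c%:E * \int[mu]_x (f x)%:E + (tau + tau)%:E /\
  c%:E * \int[mu]_x (f x)%:E <= \int[mu]_(x in P) (f x)%:E + (tau + tau)%:E.
Proof.
move=> mP mC disj mf f0 fC h0 c01 Coo CP Htau.
have intf0 : forall D, 0 <= \int[mu]_(x in D) (f x)%:E.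
  by move=> D; apply: integral_ge0 => x _; rewrite lee_fin.
rewrite (integral_cells mP mC disj mf f0 fC).
rewrite (integral_cells measurableT mC disj mf f0 fC).
under [X in c%:E * X]eq_bigr do rewrite setIT.
rewrite ge0_sume_distrr//.
have H i := cell_average_le (mC i) mP mf f0 (h0 i) c01 (Coo i) (CP i) erefl.
have S2 : \sum_i (\int[mu]_(x in C i) (`|f x - h i|%R)%:E + \int[mu]_(x in C i) (`|f x - h i|%R)%:E) <= (tau + tau)%:E.
  by rewrite big_split/= EFinD; exact: leeD.
split.
  apply: le_trans (leeD (lexx _) S2); rewrite -big_split/=; apply: lee_sum => i _.
  by have [] := H i.
apply: le_trans (leeD (lexx _) S2); rewrite -big_split/=; apply: lee_sum => i _.
by have [] := H i.
Qed.

Lemma measurable_patch (D : set T) (f : T -> R) : measurable D ->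
  measurable_fun D f -> measurable_fun [set: T] (f \_ D).
Proof. by move=> mD mf; apply/(measurable_restrictT _ mD). Qed.

Lemma integral_patch (D E : set T) (f : T -> R) :
  \int[mu]_(x in E) ((f \_ D) x)%:E = \int[mu]_(x in D `&` E) (f x)%:E.
Proof.
by rewrite setIC integral_mkcondr; apply: eq_integral => x _; rewrite restrict_EFin.
Qed.

End cell_average.

Section grid.
Context (R : realType) (n : nat).
Hypothesis n_gt0 : (0 < n)%N.
Implicit Types (x y : 'rV[R]_n).
Local Notation mu := (@leb R n).
Local Notation MT := (caratheodory_type (@leb_outer R n)).
Local Notation lmeasurable A :=
  (measurable (A : set (caratheodory_type (@leb_outer R n)))).

Definition gcell (o e : R) (m : nat) (r : {ffun 'I_n -> 'I_m}) : set 'rV[R]_n :=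
  [set x | forall i, (o + e * (r i)%:R <= x ord0 i < o + e * ((r i)%:R + 1))%R].

Lemma gcell_measurable o e m (r : {ffun 'I_n -> 'I_m}) : lmeasurable (gcell o e r).
Proof.
have := forall_measurable (fun i => coord_itv_measurable n_gt0 i
  `[(o + e * (r i)%:R)%R, (o + e * ((r i)%:R + 1))%R[).
by congr measurable; apply/seteqP; split => x /= h i; have := h i; rewrite in_itv.
Qed.

Lemma mu_gcell o e m (r : {ffun 'I_n -> 'I_m}) : (0 < e)%R ->
  mu (gcell o e r) = (e ^+ n)%:E.
Proof.
move=> e0; pose a : 'rV[R]_n := (\row_i (o + e * (r i)%:R))%R.
pose b : 'rV[R]_n := (\row_i (o + e * ((r i)%:R + 1)))%R.
rewrite (@leb_box _ _ n_gt0 a b).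
- by congr EFin; apply: vol_cst => i; rewrite !mxE; ring.
- by move=> i; rewrite !mxE; nra.
- by move=> x h i; have := h i; rewrite !mxE => /andP[/ltW -> ->].
- by move=> x h i; have := h i; rewrite !mxE => /andP[-> /ltW ->].
Qed.

Lemma natr_cell_unique (t : R) (k l : nat) : (k%:R <= t < k%:R + 1)%R ->
  (l%:R <= t < l%:R + 1)%R -> k = l.
Proof.
move=> /andP[k1 k2] /andP[l1 l2]; apply/eqP; rewrite eqn_leq.
by apply/andP; split; rewrite -ltnS -(ltr_nat R) -natr1; lra.
Qed.

Lemma gcell_disjoint o e m (r s : {ffun 'I_n -> 'I_m}) x : (0 < e)%R ->
  gcell o e r x -> gcell o e s x -> r = s.
Proof.
move=> e0 rx sx; apply/ffunP => i; apply: val_inj => /=.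
apply: (@natr_cell_unique ((x ord0 i - o) / e)%R).
  have := rx i; rewrite ler_pdivlMr// ltr_pdivrMr//; lra.
have := sx i; rewrite ler_pdivlMr// ltr_pdivrMr//; lra.
Qed.

Lemma gcell_close o e m (r : {ffun 'I_n -> 'I_m}) x y : (0 < e)%R ->
  gcell o e r x -> gcell o e r y -> ball x e y.
Proof.
move=> e0 rx ry; split => // i j; rewrite ord1 /ball/= ltr_norml.
have := rx j; have := ry j; lra.
Qed.

Lemma gcell_cover o e m x : (0 < e)%R ->
  (forall i, o <= x ord0 i < o + e * m%:R)%R -> exists r : {ffun 'I_n -> 'I_m}, gcell o e r x.
Proof.
move=> e0 xo.
have H i : exists k : 'I_m, (o + e * k%:R <= x ord0 i < o + e * (k%:R + 1))%R.
  have /andP[x1 x2] := xo i; pose t := ((x ord0 i - o) / e)%R.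
  have t0 : (0 <= t)%R by rewrite divr_ge0//; lra.
  have te : (x ord0 i = o + e * t)%R by rewrite /t; field; lra.
  have /andP[t1 t2] := truncn_itv t0.
  have tm : (Num.truncn t < m)%N.
    rewrite -(ltr_nat R); apply: le_lt_trans t1 _.
    by rewrite ltr_pdivrMr//; lra.
  exists (Ordinal tm) => /=; rewrite te lerD2l ltrD2l ler_pM2l// ltr_pM2l// t1 /=.
  by rewrite -natr1 in t2.
have [r Hr] := choice H.
by exists (finfun r) => i; rewrite ffunE; exact: Hr.
Qed.

Lemma mesh_family_gcell o e e' m : (0 < e)%R -> (e <= e')%R ->
  mesh_family (@ball R 'rV[R]_n : MT -> R -> set MT) (@gcell o e m) e'.
Proof.
move=> e0 ee'; split.
- by move=> r; exact: gcell_measurable.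
- by move=> r s x; exact: gcell_disjoint.
- by move=> r x y rx ry; apply: le_ball ee' _ _; exact: gcell_close rx ry.
Qed.

(** The threshold in [approximable] depends on f only and not on the cells, so a single e0 serves
    the grids of all periods e < e0. *)
Lemma weak_perforated (Om : set 'rV[R]_n) (f : 'rV[R]_n -> R) (tau : R) :
  open Om -> bounded_set Om -> measurable_fun (Om : set MT) f ->
  (forall x, 0 <= f x)%R -> \int[mu]_(x in Om) (f x)%:E < +oo -> (0 < tau)%R ->
  exists2 e0 : R, (0 < e0)%R & forall e : R, (0 < e < e0)%R ->
  \int[mu]_(x in Om `&` @eps_perforated R n e) (f x)%:E <=
    CP R n * \int[mu]_(x in Om) (f x)%:E + tau%:E /\
  CP R n * \int[mu]_(x in Om) (f x)%:E <=
    \int[mu]_(x in Om `&` @eps_perforated R n e) (f x)%:E + tau%:E.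
Proof.
move=> oOm bOm mf f0 foo tau0.
have mOm := open_leb_measurable n_gt0 oOm.
pose F : MT -> R := (f : MT -> R) \_ (Om : set MT).
have mF : measurable_fun [set: MT] F.
  exact: measurable_patch.
have F0 x : (0 <= F x)%R by rewrite /F /patch; case: ifP.
have FE (D : set MT) : \int[mu]_(x in D) (F x)%:E = \int[mu]_(x in (Om : set MT) `&` D) (f x)%:E.
  exact: integral_patch.
have tau2 : (0 < tau / 2)%R by lra.
have Foo : \int[mu]_x (F x)%:E < +oo by rewrite FE setIT.
have [e0 e00 He] := leb_approximable n_gt0 mF F0 Foo tau2.
exists e0 => // e /andP[e_gt0 ee0].
have [B B0 HB] := bounded_coord bOm.
have [Z ZB] : exists Z : nat, (B < e * Z%:R)%R.
  exists (Num.truncn (B / e)).+1.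
  by have := truncnS_gt (B / e)%R; rewrite ltr_pdivrMr// mulrC.
have ZE : ((Z + Z).+1%:R = Z%:R + Z%:R + 1 :> R)%R by rewrite -natr1 natrD.
(* The half shift centres the cells at points of e Z^n, so that each of them carries exactly one
   hole. *)
pose o := (- (e * (Z%:R + 1 / 2)))%R.
pose C := @gcell o e (Z + Z).+1.
have mesh : mesh_family (@ball R 'rV[R]_n : MT -> R -> set MT) C e0.
  by apply: mesh_family_gcell => //; exact: ltW.
have [h h0 Hh] := He _ _ mesh.
have := CPE R n_gt0; set c := (1 - _)%R => cE.
have c01 : (0 <= c <= 1)%R.
  rewrite -!lee_fin -cE (CP_le1 R n_gt0) andbT.
  by apply: le_trans (CP_ge R n_gt0); rewrite lee_fin; lra.
case: mesh => mC dC _.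
have [] := @weak_average _ MT R mu _ C (@eps_perforated R n e) F h c (tau / 2)%R
  (open_leb_measurable n_gt0 (@eps_perforated_open R n e e_gt0)) mC dC mF F0 _ h0 c01 _ _ Hh.
- move=> x nC; rewrite /F /patch; case: ifPn => // /set_mem /HB xB.
  have [|r /nC//] := @gcell_cover o e (Z + Z).+1 x e_gt0.
  move=> i; have := xB i; rewrite ltr_norml /o ZE; nra.
- by move=> r; rewrite mu_gcell// ltry.
- move=> r; rewrite mu_gcell// (@mu_cell_perforated _ _ n_gt0 e (fun i => (r i : nat)%:Z - Z%:Z)%R)//.
  + by rewrite -EFinM mulrC.
  + by move=> x h1 i; have := h1 i; rewrite intrB -!pmulrn /o; lra.
  + by move=> x h1 i; have := h1 i; rewrite intrB -!pmulrn /o; lra.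
rewrite !FE setIT cE.
have -> : (tau / 2 + tau / 2)%R = tau by lra.
by [].
Qed.

End grid.

(** * Mollified averages and discrete gradients *)

Section truncated_power.
Context (R : realType).
Local Open Scope ring_scope.

Definition tpow (c : R) (k : nat) (t : R) : R := Num.max (t - c) 0 ^+ k.

Lemma tpow_le (c : R) k (t : R) : t <= c -> tpow c k.+1 t = 0.
Proof. by move=> tc; rewrite /tpow (max_idPr _) ?subr_le0// expr0n. Qed.

Lemma tpow_ge (c : R) k (t : R) : c <= t -> tpow c k t = (t - c) ^+ k.
Proof. by move=> tc; rewrite /tpow (max_idPl _) ?subr_ge0. Qed.

(** At the knot the exponent is at least 2, so the difference quotient is bounded by |h|. *)
Lemma tpow_growth (c : R) (k : nat) :
  h^-1 *: ((tpow c k.+2 \o shift c) (h *: 1) - tpow c k.+2 c) @[h --> (0:R)^'] --> (0 : R).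
Proof.
apply/cvgrPdist_lt => e e0; near=> h.
have h0 : h != 0 by near: h; exact: nbhs_dnbhs_neq.
have he : `|h| < e by near: h; exact: dnbhs0_lt.
have h1 : `|h| < 1 by near: h; exact: dnbhs0_lt.
rewrite (tpow_le _ (lexx c)) subr0 sub0r normrN /= /GRing.scale/= mulr1.
have [h_le|h_gt] := leP h 0; first by rewrite tpow_le ?mulr0 ?normr0// gerDr.
have hE : `|h| = h by rewrite gtr0_norm.
rewrite tpow_ge ?lerDr// ?ltW// addrK normrM normfV normrX hE exprS mulKf//.
rewrite exprS; apply: le_lt_trans (_ : _ <= h) _; last by rewrite -hE.
by rewrite ler_piMr ?exprn_ile1// ltW// -hE.
Unshelve. all: by end_near. Qed.

Lemma is_derive_tpow (c : R) k (t : R) :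
  is_derive t (1 : R) (tpow c k.+2 : R -> R) (k.+2%:R * tpow c k.+1 t).
Proof.
have [tc|ct|->] := ltgtP t c.
- rewrite tpow_le ?ltW// mulr0.
  apply: (@near_eq_is_derive _ _ _ (cst 0 : R -> R)). 
  by near=> s; rewrite tpow_le//; apply/ltW; near: s; exact: lt_nbhsl.
- rewrite tpow_ge ?ltW//.
  apply: (@near_eq_is_derive _ _ _ ((shift (- c)) ^+ k.+2)).
    near=> s; rewrite tpow_ge//; last by apply/ltW; near: s; exact: lt_nbhsr.
    by rewrite fctE.
  by apply: is_derive_eq; rewrite /GRing.scale/= subr0 mulr1.
- rewrite tpow_le// mulr0; apply: DeriveDef.
    by apply: cvgP; exact: tpow_growth.
  by apply/cvg_lim => //; exact: tpow_growth.
Unshelve. all: by end_near. Qed.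

Lemma continuous_tpow (c : R) k : continuous (tpow c k : R -> R).
Proof.
move=> t; apply: (@continuous_comp _ _ _ (fun s : R => Num.max (s - c) 0) (fun s => s ^+ k)).
  apply: continuous_max; last exact: cst_continuous.
  by move=> ?; apply: cvgB; [exact: cvg_id|exact: cvg_cst].
exact: exprn_continuous.
Qed.

(* The smoothstep 10 t^3 - 15 t^4 + 6 t^5 on [0, 1], extended by 0 and 1: the
   second group of terms is its expansion at 1 minus 1. *)
Definition sstep (t : R) : R :=
  10 * tpow 0 3 t - 15 * tpow 0 4 t + 6 * tpow 0 5 t
  - (10 * tpow 1 3 t + 15 * tpow 1 4 t + 6 * tpow 1 5 t).

(** The derivative of [sstep], equal to 30 (t (1 - t))^2 on [0, 1]; it is itself C^1, as needed for
    a factor of a test function. *)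
Definition sbump (t : R) : R :=
  30 * tpow 0 2 t - 60 * tpow 0 3 t + 30 * tpow 0 4 t
  - (30 * tpow 1 2 t + 60 * tpow 1 3 t + 30 * tpow 1 4 t).

Definition dsbump (t : R) : R :=
  60 * tpow 0 1 t - 180 * tpow 0 2 t + 120 * tpow 0 3 t
  - (60 * tpow 1 1 t + 180 * tpow 1 2 t + 120 * tpow 1 3 t).

Lemma is_derive_sstep t : is_derive t (1 : R) sstep (sbump t).
Proof.
have D c k a := @is_deriveZ _ _ _ _ a t (1 : R) _ (is_derive_tpow c k t).
have := is_deriveB (is_deriveD (is_deriveB (D 0 1%N 10) (D 0 2%N 15)) (D 0 3%N 6))
  (is_deriveD (is_deriveD (D 1 1%N 10) (D 1 2%N 15)) (D 1 3%N 6)).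
by move=> H; apply: is_derive_eq; rewrite /GRing.scale/= /sbump; ring.
Qed.

Lemma is_derive_sbump t : is_derive t (1 : R) sbump (dsbump t).
Proof.
have D c k a := @is_deriveZ _ _ _ _ a t (1 : R) _ (is_derive_tpow c k t).
have := is_deriveB (is_deriveD (is_deriveB (D 0 0%N 30) (D 0 1%N 60)) (D 0 2%N 30))
  (is_deriveD (is_deriveD (D 1 0%N 30) (D 1 1%N 60)) (D 1 2%N 30)).
by move=> H; apply: is_derive_eq; rewrite /GRing.scale/= /dsbump; ring.
Qed.

Lemma continuous_comb (a1 a2 a3 a4 a5 a6 : R) (k1 k2 k3 : nat) :
  continuous (fun t : R => a1 * tpow 0 k1 t - a2 * tpow 0 k2 t + a3 * tpow 0 k3 t
    - (a4 * tpow 1 k1 t + a5 * tpow 1 k2 t + a6 * tpow 1 k3 t)).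
Proof.
move=> t; have C c k a : {for t, continuous (fun s => a * tpow c k s)}.
  by apply: cvgM; [exact: cvg_cst|exact: continuous_tpow].
apply: cvgB.
  apply: cvgD; last exact: C.
  by apply: cvgB; exact: C.
apply: cvgD; last exact: C.
by apply: cvgD; exact: C.
Qed.

Lemma continuous_dsbump : continuous dsbump.
Proof. exact: continuous_comb. Qed.

Lemma continuous_sbump : continuous sbump.
Proof. exact: continuous_comb. Qed.

Lemma sstep_le0 t : t <= 0 -> sstep t = 0.
Proof. by move=> t0; rewrite /sstep !tpow_le ?(le_trans t0)//; ring. Qed.

Lemma sstep_ge1 t : 1 <= t -> sstep t = 1.
Proof. by move=> t1; rewrite /sstep !tpow_ge ?(le_trans _ t1)//; ring. Qed.

Lemma sstepE t : 0 <= t <= 1 -> sstep t = t ^+ 3 * (10 - 15 * t + 6 * t ^+ 2).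
Proof.
by move=> /andP[t0 t1]; rewrite /sstep !(tpow_ge _ t0) !(tpow_le _ t1); ring.
Qed.

Lemma sbump_le0 t : t <= 0 -> sbump t = 0.
Proof. by move=> t0; rewrite /sbump !tpow_le ?(le_trans t0)//; ring. Qed.

Lemma sbump_ge1 t : 1 <= t -> sbump t = 0.
Proof. by move=> t1; rewrite /sbump !tpow_ge ?(le_trans _ t1)//; ring. Qed.

Lemma sbumpE t : 0 <= t <= 1 -> sbump t = 30 * (t * (1 - t)) ^+ 2.
Proof.
by move=> /andP[t0 t1]; rewrite /sbump !(tpow_ge _ t0) !(tpow_le _ t1); ring.
Qed.

Lemma sstep_itv t : 0 <= sstep t <= 1.
Proof.
have [t0|/ltW t0] := leP t 0; first by rewrite sstep_le0// lexx ler01.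
have [t1|/ltW t1] := leP 1 t; first by rewrite sstep_ge1// lexx ler01.
rewrite sstepE ?t0//.
(* The quadratic has its minimum 5/8 at t = 5/4. *)
have h1 : 0 <= 10 - 15 * t + 6 * t ^+ 2.
  by have := sqr_ge0 (t - 5 / 4); nra.
have h2 : 1 - t ^+ 3 * (10 - 15 * t + 6 * t ^+ 2) =
    (1 - t) ^+ 3 * (1 + 3 * t + 6 * t ^+ 2) by ring.
apply/andP; split; first by rewrite mulr_ge0// exprn_ge0.
rewrite -subr_ge0 h2 mulr_ge0//; first by rewrite exprn_ge0// subr_ge0.
by have := sqr_ge0 t; lra.
Qed.

Lemma sbump_itv t : 0 <= sbump t <= 2.
Proof.
have [t0|/ltW t0] := leP t 0; first by rewrite sbump_le0// lexx ler0n.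
have [t1|/ltW t1] := leP 1 t; first by rewrite sbump_ge1// lexx ler0n.
rewrite sbumpE ?t0//; apply/andP; split; first by rewrite mulr_ge0// sqr_ge0.
have h : 0 <= t * (1 - t) by rewrite mulr_ge0// subr_ge0.
have h4 : t * (1 - t) <= 1 / 4 by have := sqr_ge0 (t - 1 / 2); nra.
by nra.
Qed.

Lemma sbump_core t : 1 / 4 <= t <= 3 / 4 -> 1 <= sbump t.
Proof.
move=> /andP[t0 t1]; rewrite sbumpE; last by apply/andP; split; lra.
have h4 : 3 / 16 <= t * (1 - t) by nra.
by nra.
Qed.

(** Its derivative is the difference of two consecutive bumps, which turns the increment between
    adjacent averages into the derivative of a compactly supported function. *)
Definition hat (t : R) : R := sstep t - sstep (t - 1).

Lemma hat_abs t : `|hat t| <= 1.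
Proof.
by rewrite /hat ler_norml; have := sstep_itv t; have := sstep_itv (t - 1); lra.
Qed.

Lemma hat_out t : t <= 0 \/ 2 <= t -> hat t = 0.
Proof.
rewrite /hat => -[h|h]; first by rewrite !sstep_le0//; lra.
by rewrite !sstep_ge1//; lra.
Qed.

Lemma is_derive_hat t : is_derive t (1 : R) hat (sbump t - sbump (t - 1)).
Proof.
have h1 := is_derive_sstep t.
have h2 : is_derive t (1 : R) (sstep \o shift (- 1)) (sbump (t - 1) * 1).
    exact: (@is_derive1_comp _ _ (shift (- 1)) t _ _ (is_derive_sstep (t - 1)) (is_derive_shift t 1 (- 1))).
have := is_deriveB h1 h2; rewrite mulr1; exact.
Qed.

End truncated_power.

(** * Tensor product test functions *)

Section tensor.
Context (R : realType) (n : nat).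
Local Open Scope ring_scope.
Implicit Types (f df : 'I_n -> R -> R) (phi psi : 'rV[R]_n -> R) (U : set 'rV[R]_n).

Definition tensor f (x : 'rV[R]_n) : R := \prod_i f i (x ord0 i).

Lemma differentiable_tensor f df x :
  (forall i (t : R), is_derive t (1 : R) (f i) (df i t)) ->
  differentiable (tensor f) x.
Proof.
move=> fdf; rewrite /tensor; elim: (index_enum 'I_n) => [|i s ih].
  rewrite (_ : (fun y => _) = cst 1); first exact: differentiable_cst.
  by apply/funext => y; rewrite big_nil.
rewrite (_ : (fun y => _) = (fun y : 'rV[R]_n => f i (y ord0 i)) *
    (fun y : 'rV[R]_n => \prod_(j <- s) f j (y ord0 j))); last first.
  by apply/funext => y; rewrite big_cons.
apply: differentiableM ih.
apply: (@differentiable_comp _ _ _ _ (fun y : 'rV[R]_n => y ord0 i) (f i)).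
  exact: differentiable_coord.
by apply/derivable1_diffP; have [] := fdf i (x ord0 i).
Qed.

Lemma partial_tensor f df (j : 'I_n) x :
  (forall i (t : R), is_derive t (1 : R) (f i) (df i t)) ->
  partial j (tensor f) x = tensor (fun i => if i == j then df i else f i) x.
Proof.
move=> fdf; rewrite /partial /tensor (bigD1 j)//= eqxx.
under eq_bigr do rewrite ifN//.
set c := \prod_(_ < _ | _) _.
have [fj <-] := fdf j (x ord0 j).
rewrite mulrC; apply/cvg_lim => //.
rewrite [X in X @ _](_ : _ = fun h => c * (h^-1 *: ((f j \o shift (x ord0 j)) (h *: (1 : R)) - f j (x ord0 j)))).
  by apply: cvgM; [exact: cvg_cst|exact: fj].
apply/funext => h; rewrite /= (bigD1 j)//= [X in _ - X](bigD1 j)//=.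
rewrite !mxE !eqxx /=.
have -> : \prod_(i < n | i != j) f i ((h *: delta_mx ord0 j + x : 'rV[R]_n) ord0 i) = c.
  by apply: eq_bigr => i ij; rewrite !mxE (negbTE ij) andbF mulr0 add0r.
by rewrite -/c /GRing.scale/= -mulrBl mulrA [RHS]mulrC.
Qed.

Lemma continuous_tensor f : (forall i, continuous (f i)) -> continuous (tensor f).
Proof.
move=> cf; rewrite /tensor; elim: (index_enum 'I_n) => [|i s ih].
  rewrite (_ : (fun y => _) = cst 1); first exact: cst_continuous.
  by apply/funext => y; rewrite big_nil.
rewrite (_ : (fun y => _) = (fun y : 'rV[R]_n => f i (y ord0 i) *
    \prod_(j <- s) f j (y ord0 j))); last first.
  by apply/funext => y; rewrite big_cons.
move=> x; apply: (@continuousM _ _ (fun y : 'rV[R]_n => f i (y ord0 i))); last exact: ih.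
apply: (@continuous_comp _ _ _ (fun y : 'rV[R]_n => y ord0 i) (f i)).
  exact: coord_continuous.
exact: cf.
Qed.

Lemma test_function_tensor f df (a b : 'I_n -> R) U :
  (forall i (t : R), is_derive t (1 : R) (f i) (df i t)) ->
  (forall i, continuous (df i)) ->
  (forall i (t : R), f i t != 0 -> a i <= t <= b i) ->
  (forall x : 'rV[R]_n, (forall i, a i <= x ord0 i <= b i) -> U x) ->
  test_function U (tensor f).
Proof.
move=> fdf cdf supp abU.
have cf i : continuous (f i).
  move=> t; apply: differentiable_continuous; apply/derivable1_diffP.
  by have [] := fdf i t.
have sub : closure [set x | tensor f x != 0] `<=` [set x : 'rV[R]_n | forall i, `[a i, b i]%classic (x ord0 i)].
  have cl : closed [set x : 'rV[R]_n | forall i, `[a i, b i]%classic (x ord0 i)].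
    rewrite (_ : [set x | _] = \bigcap_(i in [set: 'I_n])
        ((fun x : 'rV[R]_n => x ord0 i) @^-1` `[a i, b i]%classic)).
      apply: closed_bigI => i _; apply: closed_comp; last exact: interval_closed.
      by move=> x _; exact: coord_continuous.
    by apply/seteqP; split => x /= h i; [move=> _|]; exact: h.
  rewrite [X in _ `<=` X](closure_id _).1//; apply: closure_subset => x /= fx i.
  rewrite in_itv/=; apply: supp; move: fx; rewrite /tensor (bigD1 i)//=.
  by rewrite mulf_eq0 negb_or => /andP[].
split.
- by move=> x; exact: differentiable_tensor fdf.
- move=> j; rewrite (_ : partial j _ = tensor (fun i => if i == j then df i else f i)).
    by apply: continuous_tensor => i; case: eqP.
  by apply/funext => x; exact: partial_tensor.
- apply: subclosed_compact sub; first exact: closed_closure.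
  apply: (@rV_compact _ _ (fun i => `[a i, b i]%classic)) => i.
  exact: segment_compact.
- by move=> x /sub xab; apply: abU => i; have := xab i; rewrite /= in_itv.
Qed.

Lemma test_function0 U : test_function U (fun=> 0).
Proof.
have -> : (fun=> 0) = cst 0 :> ('rV[R]_n -> R) by [].
have E : [set x : 'rV[R]_n | cst (0 : R) x != 0] = set0.
  by apply/seteqP; split => x //=; rewrite eqxx.
split; rewrite ?E ?closure0//; [|exact: compact0].
move=> i; rewrite (_ : partial i _ = cst 0); first exact: cst_continuous.
by apply/funext => x; rewrite /partial derive_cst.
Qed.

Lemma test_functionZD U (c : R) phi psi : test_function U phi ->
  test_function U psi -> test_function U (fun x => c * phi x + psi x).
Proof.
move=> [d1 c1 k1 s1] [d2 c2 k2 s2].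
have -> : (fun x => c * phi x + psi x) = c \*: phi + psi by [].
have pE i : partial i (c \*: phi + psi) = fun x => c * partial i phi x + partial i psi x.
  apply/funext => x; rewrite /partial deriveD ?deriveZ//; try exact: diff_derivable.
  by apply: derivableZ; exact: diff_derivable.
have sub : [set x | (c \*: phi + psi) x != 0] `<=` [set x | phi x != 0] `|` [set x | psi x != 0].
  move=> x /= h; apply: contrapT => /not_orP[/= /negP/negPn/eqP p1 /negP/negPn/eqP p2].
  by move: h; rewrite [X in X != 0](_ : _ = c * phi x + psi x)// p1 p2 mulr0 addr0 eqxx.
have sub' : closure [set x | (c \*: phi + psi) x != 0] `<=` closure [set x | phi x != 0] `|` closure [set x | psi x != 0].
  by rewrite -closureU; exact: closure_subset.
split.
- by move=> x; apply: differentiableD => //; exact: differentiableZ.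
- move=> i; rewrite pE => x.
  apply: (@continuousD _ _ _ (fun x => c * partial i phi x)); last exact: c2.
  apply: (@continuousM _ _ (fun=> c) (partial i phi)); [exact: cst_continuous|exact: c1].
- by apply: subclosed_compact sub'; [exact: closed_closure|exact: compactU].
- by move=> x /sub'[/s1|/s2].
Qed.

Lemma test_function_sum U (I : Type) (s : seq I) (c : I -> R) (phi : I -> 'rV[R]_n -> R) :
  (forall i, test_function U (phi i)) ->
  test_function U (fun x => \sum_(i <- s) c i * phi i x).
Proof.
move=> tphi; elim: s => [|i s ih].
  rewrite (_ : (fun x => _) = fun=> 0); first exact: test_function0.
  by apply/funext => x; rewrite big_nil.
rewrite (_ : (fun x => _) = fun x => c i * phi i x + \sum_(j <- s) c j * phi j x).
  exact: test_functionZD.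
by apply/funext => x; rewrite big_cons.
Qed.

Lemma partial_sum U (I : Type) (s : seq I) (c : I -> R) (phi : I -> 'rV[R]_n -> R) (j : 'I_n) x :
  (forall i, test_function U (phi i)) ->
  partial j (fun x => \sum_(i <- s) c i * phi i x) x = \sum_(i <- s) c i * partial j (phi i) x.
Proof.
move=> tphi; elim: s => [|i s ih].
  rewrite big_nil /partial (_ : (fun x => _) = cst 0) ?derive_cst//.
  by apply/funext => y; rewrite big_nil.
rewrite big_cons -ih (_ : (fun x => _) = c i \*: phi i + (fun x => \sum_(j <- s) c j * phi j x)); last first.
  by apply/funext => y; rewrite big_cons.
have [d1 _ _ _] := tphi i; have [d2 _ _ _] := test_function_sum s c tphi.
rewrite /partial deriveD ?deriveZ//; try exact: diff_derivable.
by apply: derivableZ; exact: diff_derivable.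
Qed.

End tensor.

(** * Weighted averages *)

Section weighted.
Context d (T : measurableType d) (R : realType) (mu : {measure set T -> \bar R}).
Local Open Scope ring_scope.

Lemma Rintegral_lincomb (I : Type) (s : seq I) (c : I -> R) (f : I -> T -> R)
    (D : set T) : measurable D ->
  (forall i, mu.-integrable D (EFin \o f i)) ->
  mu.-integrable D (EFin \o (fun x => \sum_(i <- s) c i * f i x)) /\
  \int[mu]_(x in D) (\sum_(i <- s) c i * f i x) =
  \sum_(i <- s) c i * \int[mu]_(x in D) f i x.
Proof.
move=> mD fi; elim: s => [|i s [ih1 ih2]].
  rewrite big_nil (_ : (fun x => _) = cst 0); last by apply/funext => x; rewrite big_nil.
  by split; [exact: integrable0|rewrite /Rintegral integral0].
have ci : mu.-integrable D (EFin \o (fun x => c i * f i x)).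
  exact: (integrableZl mD (c i) (fi i)).
rewrite (_ : (fun x => _) = (fun x => c i * f i x + \sum_(j <- s) c j * f j x)); last first.
  by apply/funext => x; rewrite big_cons.
split.
  exact: (integrableD mD ci ih1).
by rewrite RintegralD// RintegralZl// big_cons ih2.
Qed.

(** For the last bound, the mass k allows h to be subtracted inside the integral; the weight is then
    bounded by S on its support C. *)
Lemma weighted_average_bounds (C D : set T) (w rho : T -> R) (M S k h : R) :
  measurable C -> measurable D -> C `<=` D -> (mu D < +oo)%E ->
  measurable_fun D w -> (forall x, `|w x| <= M) ->
  measurable_fun [set: T] rho -> (forall x, 0 <= rho x <= S) ->
  (forall x, ~ C x -> rho x = 0) -> (\int[mu]_x (rho x)%:E = k%:E)%E ->
  let al := \int[mu]_(x in D) (w x * rho x) in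
  [/\ mu.-integrable D (EFin \o (fun x => w x * rho x)), `|al| <= M * k &
     ((`|al - h * k|)%:E <= S%:E * \int[mu]_(x in C) (`|w x - h|)%:E)%E].
Proof.
move=> mC mD CD Doo mw wM mrho rhoS rhoC rhok al.
have rho0 x : 0 <= rho x by have /andP[] := rhoS x.
have bnd (u v : T -> R) (a b : R) : (forall x, `|u x| <= a) -> (forall x, `|v x| <= b) ->
    [bounded (u x * v x) | x in D].
  move=> ua vb; exists (a * b); split; first exact: num_real.
  move=> y /ltW aby x Dx; apply: le_trans aby; rewrite normrM; exact: ler_pM.
have rhoN x : `|rho x| <= S by rewrite ger0_norm//; have /andP[] := rhoS x.
have mrhoD : measurable_fun D rho by exact: measurable_funTS.
have iw (u : T -> R) a : measurable_fun D u -> (forall x, `|u x| <= a) ->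
    mu.-integrable D (EFin \o (fun x => u x * rho x)).
  move=> mu' ua; apply: measurable_bounded_integrable => //; first exact: measurable_funM.
  exact: bnd rhoN.
have rhoDk : (\int[mu]_(x in D) (rho x)%:E = k%:E)%E.
  rewrite -rhok integral_mkcond; apply: eq_integral => x _; rewrite /patch.
  case: ifPn => // /negP nD; congr EFin; apply/esym/rhoC => Cx; apply: nD.
  by apply/mem_set; exact: CD.
have k0 : 0 <= k by rewrite -lee_fin -rhoDk; apply: integral_ge0 => x _; rewrite lee_fin.
have M0 : forall x : T, 0 <= M by move=> x; exact: le_trans (wM x).
have wi := iw w M mw wM.
split => //.
  apply: le_trans (le_normr_Rintegral mD wi) _.
  rewrite -lee_fin EFinM -rhoDk.
  rewrite /Rintegral fineK; last first.
    by apply: integrable_fin_num => //; exact: integrable_norm.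
  have [->|/set0P[x0 _]] := eqVneq D set0; first by rewrite !integral_set0 mule0.
  rewrite -ge0_integralZl//; last 3 first.
  - exact/measurable_EFinP.
  - by move=> x _; rewrite lee_fin.
  - by rewrite lee_fin (M0 x0).
  apply: ge0_le_integral => //.
  - apply/measurable_EFinP; apply: measurableT_comp => //; exact: measurable_funM.
  - by apply: measurable_funeM; exact/measurable_EFinP.
  - by move=> x _; rewrite -EFinM lee_fin normrM (ger0_norm (rho0 x)) ler_wpM2r.
have mwh : measurable_fun D (fun x => w x - h) by exact: measurable_funB.
have whi : mu.-integrable D (EFin \o (fun x => (w x - h) * rho x)).
  apply: (iw _ (M + `|h|)) => // x; apply: le_trans (ler_normB _ _) _.
  by rewrite lerD2r.
have ri : mu.-integrable D (EFin \o rho).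
  apply/integrableP; split; first exact/measurable_EFinP.
  rewrite (_ : (\int[mu]_(x in D) _ = \int[mu]_(x in D) (rho x)%:E)%E); first by rewrite rhoDk ltry.
  by apply: eq_integral => x _ /=; rewrite ger0_norm.
have -> : al - h * k = \int[mu]_(x in D) ((w x - h) * rho x).
  have -> : k = \int[mu]_(x in D) rho x by rewrite /Rintegral rhoDk.
  rewrite -RintegralZl// /al -RintegralB//.
    by apply: eq_Rintegral => x _; rewrite mulrBl.
  exact: (integrableZl mD h ri).
rewrite EFin_normr_Rintegral//.
have mwhi : measurable_fun D (fun x => ((w x - h) * rho x)%:E).
  by apply/measurable_EFinP; exact: measurable_funM.
apply: le_trans (le_abse_integral _ mD mwhi) _.
have mwhC : measurable_fun C (fun x => (`|w x - h|)%:E).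
  apply/measurable_EFinP; apply: measurableT_comp => //.
  exact: measurable_funS mwh.
rewrite (_ : (\int[mu]_(x in D) _ = \int[mu]_(x in C) `|((w x - h) * rho x)%:E|)%E); last first.
  rewrite integral_mkcond [RHS]integral_mkcond; apply: eq_integral => x _; rewrite /patch.
  case: ifPn => [xD|/negP nD].
    case: ifPn => // /negP nC.
    by rewrite rhoC ?mulr0 ?abse0// => Cx; apply: nC; exact/mem_set.
  by case: ifPn => // /set_mem Cx; case: nD; apply/mem_set; exact: CD.
have [->|/set0P[x0 _]] := eqVneq C set0; first by rewrite !integral_set0 mule0.
have S0 : 0 <= S by apply: le_trans (rhoN x0).
rewrite -ge0_integralZl//; apply: ge0_le_integral => //.
- by apply: measurableT_comp => //; exact: measurable_funS mwhi.
- exact: measurable_funeM.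
- by move=> x _; rewrite -EFinM /= lee_fin normrM mulrC ler_wpM2r.
Qed.

Lemma integral_sandwich (f : T -> R) (S : R) (B B' : set T) :
  measurable B -> measurable B' -> measurable_fun [set: T] f ->
  (forall x, 0 <= f x <= S) -> (forall x, ~ B x -> f x = 0) ->
  (forall x, B' x -> 1 <= f x) -> 0 <= S ->
  (mu B' <= \int[mu]_x (f x)%:E <= S%:E * mu B)%E.
Proof.
move=> mB mB' mf fS fB fB' S0.
have f0 x : 0 <= f x by have /andP[] := fS x.
have mi (A : set T) : measurable A -> measurable_fun [set: T] (fun x => (\1_A x : R)%:E).
  by move=> mA; apply/measurable_EFinP; exact: measurable_indic.
apply/andP; split.
  have -> : (mu B' = \int[mu]_x (\1_B' x)%:E)%E by rewrite integral_indic// setIT.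
  apply: ge0_le_integral => //.
  - exact: mi.
  - exact/measurable_EFinP.
  - move=> x _; rewrite lee_fin indicE.
    by have [/set_mem/fB'|_] := boolP (x \in B').
apply: (@le_trans _ _ (\int[mu]_x (S%:E * (\1_B x)%:E))%E).
  apply: ge0_le_integral => //.
  - by move=> x _; rewrite lee_fin.
  - exact/measurable_EFinP.
  - by apply: measurable_funeM; exact: mi.
  - move=> x _; rewrite -EFinM lee_fin indicE.
    have [_|/negP xb] := boolP (x \in B); first by rewrite mulr1; have /andP[] := fS x.
    by rewrite fB ?mulr0// => Bx; apply: xb; exact/mem_set.
rewrite ge0_integralZl//; last exact: mi.
by rewrite integral_indic// setIT.
Qed.

End weighted.

(** * Bumps on grid cells *)

Section scaled_bumps.
Context (R : realType) (n : nat).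
Hypothesis n_gt0 : (0 < n)%N.
Local Notation mu := (@leb R n).
Local Notation MT := (caratheodory_type (@leb_outer R n)).
Local Open Scope ring_scope.
Implicit Types (p x : 'rV[R]_n).

Lemma is_derive_scale (f df : R -> R) (p e t : R) :
  (forall t, is_derive t (1 : R) f (df t)) ->
  is_derive t (1 : R) (fun s => f (e^-1 * (s - p))) (df (e^-1 * (t - p)) * e^-1).
Proof.
move=> fdf.
have h : is_derive t (1 : R) (e^-1 \*: shift (- p)) e^-1.
  have := @is_deriveZ _ _ _ _ e^-1 t (1 : R) _ (is_derive_shift t 1 (- p)).
  by rewrite [e^-1 *: 1]mulr1.
exact: (@is_derive1_comp _ f (e^-1 \*: shift (- p)) t _ _ (fdf _) h).
Qed.

Definition rho p (e : R) : 'rV[R]_n -> R :=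
  tensor (fun l (t : R) => sbump (e^-1 * (t - p ord0 l))).

(** The test function for the increment between the cell at p and the next one in direction j: it is
    supported on these two cells, and its j-th partial derivative is the rescaled difference of
    their bumps. *)
Definition Phi (j : 'I_n) p (e : R) : 'rV[R]_n -> R :=
  tensor (fun l (t : R) => if l == j then hat (e^-1 * (t - p ord0 l))
                     else sbump (e^-1 * (t - p ord0 l))).

Lemma rho_itv p e x : 0 <= rho p e x <= 2 ^+ n.
Proof.
have b0 l : 0 <= sbump (e^-1 * (x ord0 l - p ord0 l)) by have /andP[] := sbump_itv (e^-1 * (x ord0 l - p ord0 l)).
rewrite /rho /tensor prodr_ge0//=.
rewrite -[in leRHS](card_ord n) -prodr_const; apply: ler_prod => l _.
exact: sbump_itv.
Qed.

Lemma sbump_neq0 (t : R) : sbump t != 0 -> 0 < t < 1.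
Proof.
by move=> bt; apply/andP; split; rewrite ltNge; apply: contra bt => h;
  rewrite ?(sbump_le0 h)// ?(sbump_ge1 h).
Qed.

Lemma hat_neq0 (t : R) : hat t != 0 -> 0 < t < 2.
Proof.
by move=> bt; apply/andP; split; rewrite ltNge; apply: contra bt => h;
  rewrite hat_out//; [left|right].
Qed.

Lemma scale_itv (p e t c : R) : 0 < e -> 0 < e^-1 * (t - p) < c -> p < t < p + c * e.
Proof.
move=> e0; rewrite mulrC => /andP[h1 h2].
have h3 : 0 < t - p by rewrite -(pmulr_lgt0 _ (_ : 0 < e^-1)) ?invr_gt0.
move: h2; rewrite ltr_pdivrMr//; lra.
Qed.

Lemma rho_neq0 p e x : 0 < e -> rho p e x != 0 ->
  forall l, p ord0 l < x ord0 l < p ord0 l + e.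
Proof.
move=> e0 /prodf_neq0 h l; have /sbump_neq0/(scale_itv e0) := h l isT.
by rewrite mul1r.
Qed.

Lemma continuous_scale (f : R -> R) (p e : R) : continuous f ->
  continuous (fun t : R => f (e^-1 * (t - p))).
Proof.
move=> cf t; apply: (@continuous_comp _ _ _ (fun t : R => e^-1 * (t - p)) f); last exact: cf.
apply: (@continuousM _ _ (fun=> e^-1)); first exact: cst_continuous.
by apply: (@continuousB _ _ _ id (fun=> p)); [exact: cvg_id|exact: cst_continuous].
Qed.

Lemma continuous_rho p e : continuous (rho p e).
Proof.
by apply: continuous_tensor => i; apply: continuous_scale; exact: continuous_sbump.
Qed.

Lemma measurable_rho p e : measurable_fun [set: MT] (rho p e : MT -> R).
Proof. exact: (continuous_leb_measurable n_gt0 (@continuous_rho p e)). Qed.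

Definition kappa (e : R) : R := \int[mu]_x rho 0 e x.

Lemma integral_rho_ge0 p e : (\int[mu]_x (rho p e x)%:E = \int[mu]_x (rho 0 e x)%:E)%E.
Proof.
have := @ge0_integral_translation R n n_gt0 (- p) (fun x => (rho 0 e x)%:E).
move=> <-.
- apply: eq_integral => x _; congr EFin; apply: eq_bigr => l _.
  by rewrite !mxE subr0.
- by apply/measurable_EFinP; exact: measurable_rho.
- by move=> x; rewrite lee_fin; have /andP[] := rho_itv 0 e x.
Qed.

(** The mass does not depend on p by translation; on the middle half of the cell every factor is at
    least 1 ([sbump_core]), which gives (e / 2)^n. *)
Lemma kappaP p e : 0 < e ->
  (\int[mu]_x (rho p e x)%:E = (kappa e)%:E)%E /\ (e / 2) ^+ n <= kappa e.
Proof.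
move=> e0; have r0 x : 0 <= rho 0 e x by have /andP[] := rho_itv 0 e x.
have mEr : measurable_fun [set: MT] (fun x : MT => (rho 0 e x)%:E).
  by apply/measurable_EFinP; exact: measurable_rho.
pose box (s t : R) : set MT := cbox (const_mx (s * e)) (const_mx (t * e)).
have mbox s t : measurable (box s t) by exact: cbox_measurable.
have mubox s t : s <= t -> mu (box s t) = (((t - s) * e) ^+ n)%:E.
  move=> st; rewrite (@leb_box R n n_gt0 (const_mx (s * e)) (const_mx (t * e))).
  - by congr EFin; apply: vol_cst => i; rewrite !mxE mulrBl.
  - by move=> i; rewrite !mxE ler_pM2r.
  - by move=> x h i; have /andP[/ltW -> /ltW ->] := h i.
  - by [].
have /andP[lo up] : (mu (box (1 / 4)%R (3 / 4)%R) <= \int[mu]_x (rho 0 e x)%:E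
    <= (2 ^+ n)%:E * mu (box 0%R 1%R))%E.
  apply: integral_sandwich => //.
  - exact: measurable_rho.
  - exact: rho_itv.
  - move=> x xb; apply/eqP/negPn/negP => rx; apply: xb => i; rewrite !mxE.
    by have := rho_neq0 e0 rx i; rewrite !mxE; lra.
  - move=> x xb; rewrite /rho /tensor [leLHS](_ : 1 = \prod_(l < n) (1 : R)); last by rewrite big1.
    apply: ler_prod => l _; rewrite ler01/=; apply: sbump_core.
    have := xb l; rewrite !mxE subr0 => /andP[x1 x2].
    have y_x : e^-1 * x ord0 l * e = x ord0 l by rewrite mulrAC mulVf ?mul1r// gt_eqF.
    by apply/andP; split; rewrite -(ler_pM2r e0) y_x.
rewrite mubox ?ler01// subr0 mul1r in up.
rewrite mubox in lo; last lra.
have fin : (\int[mu]_x (rho 0 e x)%:E \is a fin_num)%E.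
  by rewrite ge0_fin_numE ?(le_lt_trans up) -?EFinM ?ltry// integral_ge0// => x _; rewrite lee_fin.
rewrite integral_rho_ge0; split; first by rewrite /kappa /Rintegral fineK.
rewrite -lee_fin /kappa /Rintegral fineK//; apply: le_trans lo; rewrite lee_fin le_eqVlt.
by apply/orP; left; apply/eqP; congr (_ ^+ _); field.
Qed.

End scaled_bumps.

Lemma sum_inj_le (R : numDomainType) (I J : finType) (h : I -> J) (F : J -> R) :
  injective h -> (forall j, 0 <= F j)%R -> (\sum_i F (h i) <= \sum_j F j)%R.
Proof.
move=> hi F0.
rewrite -(big_map h xpredT F) big_uniq; last first.
  by rewrite map_inj_uniq// index_enum_uniq.
rewrite big_mkcond/=; apply: ler_sum => j _; case: ifP => // _; exact: F0.
Qed.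

Section edges.
Context (R : realType) (n : nat).
Hypothesis n_gt0 : (0 < n)%N.
Local Notation mu := (@leb R n).
Local Notation MT := (caratheodory_type (@leb_outer R n)).
Local Open Scope ring_scope.
Implicit Types (p x : 'rV[R]_n).

Lemma sum_overlap (f : R -> R) (c y : R) (k m : nat) :
  0 <= c -> (forall z, `|f z| <= c) -> (forall z, f z != 0 -> 0 < z < k%:R) ->
  \sum_(t < m) `|f (y - t%:R)| <= c * k%:R.
Proof.
move=> c0 fc fk; pose P (t : nat) := f (y - t%:R) != 0.
rewrite -(big_mkord xpredT (fun t => `|f (y - t%:R)|)).
rewrite (bigID P)/= [X in _ + X]big1 ?addr0; last first.
  by move=> t /negPn/eqP ->; rewrite normr0.
rewrite -big_filter; set s := [seq _ <- _ | _].
have sk : (size s <= k)%N.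
  have [s0|/hasPn h] := boolP (has P s); last first.
    case E : s => [//|t s']; have ts : t \in s by rewrite E mem_head.
    have nP := h _ ts.
    by move: ts; rewrite mem_filter => /andP[Pt _]; case: (negP nP).
  have exP : exists t, P t by move: s0 => /hasP[t _ Pt]; exists t.
  (* With a the smallest index of a nonzero term, all such indices lie among the k integers from a
     on. *)
  have [a Pa amin] := ex_minnP exP.
  rewrite -(size_iota a k); apply: uniq_leq_size.
    by rewrite filter_uniq// iota_uniq.
  move=> t; rewrite mem_filter => /andP[Pt _]; rewrite mem_iota amin//=.
  have /andP[_ h1] := fk _ Pa; have /andP[h2 _] := fk _ Pt.
  by rewrite -(ltr_nat R) natrD; lra.
apply: (@le_trans _ _ (\sum_(t <- s) c)); first by apply: ler_sum => t _; exact: fc.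
by rewrite big_const_seq count_predT iter_addr_0 -[c *+ _]mulr_natr ler_wpM2l// ler_nat.
Qed.

(** The sum over the grid factorises into sums over one coordinate. In direction j at most 2 hats
    bounded by 1 overlap, in the others a single bump bounded by 2, so each factor is at most 2. *)
Lemma Phi_overlap (o e : R) (m : nat) (j : 'I_n) x : 0 < e ->
  \sum_(s : {ffun 'I_n -> 'I_m}) `|Phi j (\row_l (o + e * (s l)%:R)) e x| <= 2 ^+ n.
Proof.
move=> e0.
pose y l := e^-1 * (x ord0 l - o).
pose F (l : 'I_n) (t : 'I_m) : R :=
  `|if l == j then hat (y l - t%:R) else sbump (y l - t%:R)|.
rewrite (eq_bigr (fun s : {ffun 'I_n -> 'I_m} => \prod_l F l (s l))); last first.
  move=> s _; rewrite /Phi /tensor normr_prod; apply: eq_bigr => l _.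
  rewrite /F !mxE; have -> : e^-1 * (x ord0 l - (o + e * (s l)%:R)) = y l - (s l)%:R.
    by rewrite /y; field; rewrite gt_eqF.
  by [].
rewrite -(bigA_distr_bigA F) -[in leRHS](card_ord n) -prodr_const.
apply: ler_prod => l _; apply/andP; split.
  by apply: sumr_ge0 => t _; rewrite /F.
rewrite /F; case: (l == j).
  have := @sum_overlap (@hat R) 1 (y l) 2 m ler01 (@hat_abs R) (@hat_neq0 R).
  by rewrite mul1r.
have := @sum_overlap (@sbump R) 2 (y l) 1 m (ler0n _ _) _ (@sbump_neq0 R).
rewrite mulr1; apply => z; have /andP[z0 z2] := sbump_itv z; by rewrite ger0_norm.
Qed.

Lemma partial_Phi (j : 'I_n) p e x : 0 < e ->
  partial j (Phi j p e) x = e^-1 * (rho p e x - rho (p + e *: delta_mx ord0 j) e x).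
Proof.
move=> e0.
pose df (l : 'I_n) (t : R) := (if l == j
  then (sbump (e^-1 * (t - p ord0 l)) - sbump (e^-1 * (t - p ord0 l) - 1)) * e^-1
  else dsbump (e^-1 * (t - p ord0 l)) * e^-1).
have dP l t : is_derive t (1 : R) (fun t => if l == j then hat (e^-1 * (t - p ord0 l))
    else sbump (e^-1 * (t - p ord0 l))) (df l t).
  rewrite /df; case: (l == j).
    by apply: (is_derive_scale (df := fun t => sbump t - sbump (t - 1))) => s; exact: is_derive_hat.
  by apply: is_derive_scale => s; exact: is_derive_sbump.
rewrite /Phi (partial_tensor _ _ dP).
rewrite /rho /tensor (bigD1 j)//= [in RHS](bigD1 j)//= [X in _ - X](bigD1 j)//=.
rewrite /df !eqxx !mxE !eqxx/= mulr1.
have -> : e^-1 * (x ord0 j - (p ord0 j + e)) = e^-1 * (x ord0 j - p ord0 j) - 1.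
  by field; rewrite gt_eqF.
have -> : \prod_(l < n | l != j) sbump (e^-1 * (x ord0 l - (p + e *: delta_mx ord0 j)%R ord0 l)) =
    \prod_(l < n | l != j) sbump (e^-1 * (x ord0 l - p ord0 l)).
  by apply: eq_bigr => l lj; rewrite !mxE (negbTE lj) andbF mulr0 addr0.
rewrite (eq_bigr (fun l => sbump (e^-1 * (x ord0 l - p ord0 l)))); last first.
  by move=> l /negbTE ->.
ring.
Qed.

Lemma test_function_Phi (j : 'I_n) p e (V : set 'rV[R]_n) : 0 < e ->
  (forall x, (forall l, p ord0 l <= x ord0 l <= p ord0 l + (if l == j then 2 else 1) * e) -> V x) ->
  test_function V (Phi j p e).
Proof.
move=> e0 pV.
apply: (@test_function_tensor _ _ _ (fun l t => if l == j
  then (sbump (e^-1 * (t - p ord0 l)) - sbump (e^-1 * (t - p ord0 l) - 1)) * e^-1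
  else dsbump (e^-1 * (t - p ord0 l)) * e^-1) (fun l => p ord0 l)
  (fun l => p ord0 l + (if l == j then 2 else 1) * e)) => //.
- move=> l t; case: (l == j).
    by apply: (is_derive_scale (df := fun t => sbump t - sbump (t - 1))) => s; exact: is_derive_hat.
  by apply: is_derive_scale => s; exact: is_derive_sbump.
- move=> l; case: (l == j) => t.
    apply: (@continuousM _ _ (fun t => sbump (e^-1 * (t - p ord0 l)) - sbump (e^-1 * (t - p ord0 l) - 1)) (fun=> e^-1)).
      apply: (@continuousB _ _ _ (fun t => sbump (e^-1 * (t - p ord0 l)))
        (fun t => sbump (e^-1 * (t - p ord0 l) - 1))).
        by apply: continuous_scale; exact: continuous_sbump.
      apply: (@continuous_scale _ (fun t => sbump (t - 1))) => s.
      apply: (@continuous_comp _ _ _ (fun s : R => s - 1) (@sbump R)); last exact: continuous_sbump.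
      by apply: cvgB; [exact: cvg_id|exact: cvg_cst].
    exact: cst_continuous.
  apply: (@continuousM _ _ (fun t => dsbump (e^-1 * (t - p ord0 l))) (fun=> e^-1)).
    by apply: continuous_scale; exact: continuous_dsbump.
  exact: cst_continuous.
- move=> l t; case: (l == j) => h.
    by have /(scale_itv e0)/andP[/ltW -> /ltW ->] := hat_neq0 h.
  by have /(scale_itv e0)/andP[/ltW -> /ltW ->] := sbump_neq0 h.
Qed.

(** A bound by duality on the variation in V of each distributional partial derivative of w; in the
    applications V is the perforated part of D. *)
Definition tv_le (D V : set 'rV[R]_n) (w : 'rV[R]_n -> R) (K : R) :=
  forall (j : 'I_n) phi, test_function V phi -> (forall x, `|phi x| <= 1) ->
  (`|\int[mu]_(x in D) (w x * partial j phi x)%:E| <= K%:E)%E.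

Definition mollified (D : set 'rV[R]_n) (w : 'rV[R]_n -> R) (e : R) p : R :=
  \int[mu]_(x in D) (w x * rho p e x).

(* All the increments are tested at once, each with its own sign: by the bounded
   overlap, 2^-n sum_i (sgn a_i) Phi_i is at most 1 in absolute value. *)
Lemma tv_edges (I : finType) (P : pred I) (p : I -> 'rV[R]_n) (e K : R) (j : 'I_n)
    (D V : set 'rV[R]_n) (w : 'rV[R]_n -> R) :
  0 < e -> measurable (D : set MT) -> tv_le D V w K ->
  (forall q, mu.-integrable (D : set MT) (EFin \o (fun x => w x * rho q e x))) ->
  (forall i, P i -> forall x, (forall l, p i ord0 l <= x ord0 l <=
     p i ord0 l + (if l == j then 2 else 1) * e) -> V x) ->
  (forall x, \sum_i `|Phi j (p i) e x| <= 2 ^+ n) ->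
  \sum_(i | P i) `|mollified D w e (p i) - mollified D w e (p i + e *: delta_mx ord0 j)|
    <= K * 2 ^+ n * e.
Proof.
move=> e0 mD tvK wi pV ovl.
pose a i := mollified D w e (p i) - mollified D w e (p i + e *: delta_mx ord0 j).
pose c i := (2 ^+ n)^-1 * Num.sg (a i).
pose phi i : 'rV[R]_n -> R := if P i then Phi j (p i) e else (fun=> 0).
pose s := index_enum I.
have tphi i : test_function V (phi i).
  rewrite /phi; case: ifPn => [Pi|_]; last exact: test_function0.
  by apply: test_function_Phi => //; exact: pV.
have e2 : (0 : R) < 2 ^+ n by rewrite exprn_gt0.
have phi1 x : `|\sum_(i <- s) c i * phi i x| <= 1.
  apply: le_trans (ler_norm_sum _ _ _) _.
  apply: (@le_trans _ _ (\sum_i (2 ^+ n)^-1 * `|Phi j (p i) e x|)); last first.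
    by rewrite -mulr_sumr ler_pdivrMl// mulr1.
  apply: ler_sum => i _; rewrite /c -mulrA normrM [`|_^-1|]ger0_norm ?invr_ge0 ?exprn_ge0//.
  rewrite ler_pM2l ?invr_gt0// normrM; rewrite /phi; case: (P i); last by rewrite normr0 mulr0.
  rewrite -[leRHS]mul1r ler_wpM2r// normr_sg lern1; by case: (_ != _).
have := tvK j _ (test_function_sum s c tphi) phi1.
pose f i x := if P i then e^-1 * (w x * rho (p i) e x - w x * rho (p i + e *: delta_mx ord0 j) e x) else 0.
have fE i x : w x * partial j (phi i) x = f i x.
  rewrite /phi /f; case: (P i); first by rewrite partial_Phi//; ring.
  by rewrite /partial (derive_cst (0 : R)) mulr0.
rewrite (_ : (\int[mu]_(x in D) _ = \int[mu]_(x in D) (\sum_(i <- s) c i * f i x)%:E)%E); last first.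
  apply: eq_integral => x _; congr EFin; rewrite (partial_sum _ _ _ _ tphi) mulr_sumr.
  by apply: eq_bigr => i _; rewrite -fE mulrCA.
have fi i : mu.-integrable (D : set MT) (EFin \o (f i : MT -> R)).
  rewrite /f; case: (P i); last exact: integrable0.
  exact: (integrableZl mD e^-1 (integrableB mD (wi _) (wi _))).
have [gi gE] := Rintegral_lincomb s c mD fi.
rewrite -EFin_normr_Rintegral// lee_fin gE.
have fI i : \int[mu]_(x in (D : set MT)) (f i x) = if P i then e^-1 * a i else 0.
  rewrite /f; case: (P i); last by rewrite /Rintegral integral0.
  rewrite RintegralZl//; last exact: (integrableB mD (wi _) (wi _)).
  by rewrite RintegralB.
rewrite (eq_bigr (fun i => if P i then (2 ^+ n)^-1 * e^-1 * `|a i| else 0)); last first.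
  move=> i _; rewrite fI; case: (P i); last by rewrite mulr0.
  by rewrite [`|a i|]normrEsg /c; ring.
rewrite -big_mkcond/= -mulr_sumr ger0_norm; last first.
  by rewrite mulr_ge0 ?sumr_ge0// mulr_ge0// invr_ge0 ?exprn_ge0// ltW.
rewrite -[_ / e * _]mulrA ler_pdivrMl// ler_pdivrMl// => h; apply: le_trans h _.
by rewrite [K * _]mulrC [leLHS]mulrC.
Qed.

End edges.

Section integral_distance.
Context d (T : measurableType d) (R : realType) (mu : {measure set T -> \bar R}).

Lemma measurable_distance (D : set T) (v w : T -> R) :
  measurable_fun D v -> measurable_fun D w -> measurable_fun D (fun x => `|v x - w x|%R).
Proof.
by move=> mv mw; apply: measurableT_comp => //; exact: measurable_funB.
Qed.

Lemma integral_dist_cst (C : set T) (w : T -> R) (a b : R) : measurable C ->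
  measurable_fun C w ->
  \int[mu]_(x in C) (`|w x - b|%R)%:E <=
  \int[mu]_(x in C) (`|w x - a|%R)%:E + `|a - b|%:E * mu C.
Proof.
move=> mC mw.
have md c : measurable_fun C (fun x => (`|w x - c|%R)%:E).
  apply/measurable_EFinP; apply: measurableT_comp => //; exact: measurable_funB.
rewrite -integral_cst// -ge0_integralD//; last by move=> x _; rewrite lee_fin.
apply: ge0_le_integral => //.
- by apply: emeasurable_funD.
- move=> x _; rewrite -EFinD lee_fin.
  by rewrite (_ : w x - b = (w x - a) + (a - b))%R ?ler_normD//; ring.
Qed.

(** Z will be a layer near the boundary of Om or near the faces of the slabs, where f is only known
    to be bounded. *)
Lemma integral_cover_le (I : finType) (P : pred I) (C : I -> set T) (E Z : set T)
    (f : T -> R) (S : R) :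
  (forall i, measurable (C i)) -> measurable E -> measurable Z ->
  measurable_fun [set: T] f -> (forall x, 0 <= f x <= S)%R ->
  (forall x, E x -> Z x \/ exists2 i, P i & C i x) ->
  \int[mu]_(x in E) (f x)%:E <=
  \sum_(i | P i) \int[mu]_(x in C i) (f x)%:E + S%:E * mu (E `&` Z).
Proof.
move=> mC mE mZ mf fS cov.
have [->|/set0P[x0 _]] := eqVneq E set0.
  rewrite integral_set0 set0I measure0 mule0 adde0; apply: sume_ge0 => i _.
  by apply: integral_ge0 => x _; rewrite lee_fin; have /andP[] := fS x.
have f0 x : (0 <= f x)%R by have /andP[] := fS x.
have S0 : (0 <= S)%R by have /andP[h1 h2] := fS x0; exact: le_trans h2.
have mEf : measurable_fun [set: T] (fun x => (f x)%:E) by exact/measurable_EFinP.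
have mpatch (A : set T) : measurable A ->
    measurable_fun [set: T] ((fun x => (f x)%:E) \_ A).
  by move=> mA; apply/(measurable_restrictT _ mA); exact: measurable_funTS.
have p0 (A : set T) x : 0 <= ((fun x => (f x)%:E) \_ A) x.
  by rewrite /patch; case: ifP => // _; rewrite lee_fin.
have mEZ : measurable (E `&` Z) by exact: measurableI.
have -> : S%:E * mu (E `&` Z) = \int[mu]_x (S%:E * (\1_(E `&` Z) x)%:E).
  rewrite ge0_integralZl//; first by rewrite integral_indic// setIT.
  by apply/measurable_EFinP; exact: measurable_indic.
rewrite integral_mkcond.
rewrite (eq_bigr (fun i => \int[mu]_x ((fun x => (f x)%:E) \_ (C i)) x)); last first.
  by move=> i _; rewrite integral_mkcond.
have mS : measurable_fun [set: T] (fun x => S%:E * (\1_(E `&` Z) x)%:E).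
  by apply: measurable_funeM; apply/measurable_EFinP; exact: measurable_indic.
rewrite -(big_filter (index_enum I) P) -ge0_integral_sum//; last by move=> i; exact: mpatch.
rewrite -ge0_integralD//; last 3 first.
- by move=> x _; apply: sume_ge0 => i _.
- by apply: emeasurable_sum => i; exact: mpatch.
- by move=> x _; rewrite mule_ge0 ?lee_fin.
apply: ge0_le_integral => //.
- exact: mpatch.
- apply: emeasurable_funD => //.
  by apply: emeasurable_sum => i; exact: mpatch.
- move=> x _.
  have s0 : 0 <= \sum_(i <- [seq i <- index_enum I | P i]) ((fun x => (f x)%:E) \_ (C i)) x.
    by apply: sume_ge0 => i _.
  have z0 : 0 <= S%:E * (\1_(E `&` Z) x)%:E by rewrite mule_ge0 ?lee_fin.
  rewrite {1}/patch; case: ifPn => [/set_mem Ex|_]; last exact: adde_ge0.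
  have [Zx|[i Pi Cx]] := cov x Ex.
    apply: (@le_trans _ _ (S%:E * (\1_(E `&` Z) x)%:E)); last by rewrite leeDr.
    rewrite indicE mem_set ?mule1 ?lee_fin//; by have /andP[] := fS x.
  apply: (@le_trans _ _ (((fun x => (f x)%:E) \_ (C i)) x)).
    by rewrite /patch mem_set.
  rewrite big_filter (bigD1 i)//= -addeA leeDl// adde_ge0//.
  by apply: sume_ge0 => j _.
Qed.

End integral_distance.

(** If at least 1/22 of the indices are good in each direction, at least a fraction 22^-n of the
    cells is all-good, which eliminates their number from [poincare_center]. *)
Lemma poincare_corridor (R : realType) (n N' : nat)
    (a : {ffun 'I_n -> 'I_N'.+1} -> R) (good : 'I_n -> pred 'I_N'.+1) : (1 < n)%N ->
  (forall l, N'.+1%:R <= 22 * #|good l|%:R :> R)%R ->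
  exists y : {ffun 'I_n -> 'I_N'.+1},
    (\sum_(z : {ffun 'I_n -> 'I_N'.+1} | [exists l, good l (z l)]) `|a z - a y| <=
     n%:R * 22 ^+ n * N'.+1%:R * \sum_j \sum_x edge a good j x)%R.
Proof.
move=> n1 goodN; set E := (\sum_j _)%R.
have cN : (N'.+1%:R ^+ n <= 22 ^+ n * #|all_good good|%:R :> R)%R.
  rewrite card_all_good -[in leLHS](card_ord n) -prodr_const.
  rewrite -[X in (_ <= 22 ^+ X * _)%R](card_ord n) -prodr_const -big_split/=.
  by apply: ler_prod => l _; rewrite ler0n goodN.
have N0 : (0 < N'.+1%:R :> R)%R by rewrite ltr0n.
have all0 : (0 < #|all_good good|)%N.
  rewrite lt0n; apply/negP => /eqP h; move: cN; rewrite h mulr0.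
  by rewrite leNgt exprn_gt0.
have [y _ h] := poincare_center a n1 all0; exists y.
rewrite -/E in h.
set S := (X in (X <= _)%R).
have SS : (S <= \sum_i0 \sum_(z : {ffun 'I_n -> 'I_N'.+1} | good i0 (z i0)) `|a z - a y|)%R.
  rewrite (eq_bigr (fun i0 => \sum_(z : {ffun 'I_n -> 'I_N'.+1}) if good i0 (z i0) then `|a z - a y| else 0)%R); last first.
    by move=> i _; rewrite big_mkcond.
  rewrite exchange_big /S big_mkcond/=; apply: ler_sum => z _.
  have q0 i : (0 <= if good i (z i) then `|a z - a y| else 0)%R by case: ifP.
  case: ifP => [/existsP[l gl]|_]; last exact: sumr_ge0.
  by rewrite (bigD1 l)//= gl lerDl sumr_ge0.
have S0 : (0 <= S)%R by apply: sumr_ge0.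
rewrite -(ler_pM2l (exprn_gt0 n N0)).
apply: (@le_trans _ _ (22 ^+ n * (#|all_good good|%:R * S))%R).
  by rewrite mulrA ler_wpM2r.
apply: (@le_trans _ _ (22 ^+ n * (n%:R * N'.+1%:R ^+ n.+1 * E))%R).
  rewrite ler_wpM2l ?exprn_ge0//; apply: le_trans h.
  by rewrite ler_wpM2l.
by rewrite exprS le_eqVlt; apply/orP; left; apply/eqP; ring.
Qed.

(** * Fine cells inside coarse cells *)

Section subgrid.
Context (R : realType) (n K N' : nat) (o eta : R).
Hypothesis n_gt0 : (0 < n)%N.
Hypothesis eta_gt0 : (0 < eta)%R.
Local Notation N := N'.+1.
Local Notation coarse := {ffun 'I_n -> 'I_K}.
Local Notation fine := {ffun 'I_n -> 'I_N}.
Local Open Scope ring_scope.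

Lemma glob_proof (i : 'I_K) (j : 'I_N) : (i * N + j < K * N)%N.
Proof.
apply: (@leq_trans (i.+1 * N)); first by rewrite mulSn addnC ltn_add2r.
by rewrite leq_mul2r (ltn_ord i) orbT.
Qed.

(** The fine cells of all coarse cells are indexed in one global grid, from which disjointness and
    bounded overlap are inherited. *)
Definition glob (dr : coarse * fine) : {ffun 'I_n -> 'I_(K * N)} :=
  [ffun l => Ordinal (glob_proof (dr.1 l) (dr.2 l))].

Lemma glob_inj : injective glob.
Proof.
move=> [d r] [d' r'] /ffunP h.
have H l : (d l * N + r l = d' l * N + r' l)%N by have := h l; rewrite !ffunE => -[].
congr (_, _); apply/ffunP => l; apply: val_inj => /=.
  by have := congr1 (divn^~ N) (H l); rewrite /= !divnMDl// !divn_small// !addn0.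
by have := congr1 (modn^~ N) (H l); rewrite /= !modnMDl !modn_small.
Qed.

Definition corner (d : coarse) l : R := o + eta * N%:R * (d l)%:R.

Lemma globE (d : coarse) (r : fine) l : o + eta * (glob (d, r) l)%:R = corner d l + eta * (r l)%:R.
Proof. by rewrite /corner ffunE/= natrD natrM; ring. Qed.

Definition fcell (dr : coarse * fine) : set 'rV[R]_n := gcell o eta (glob dr).

Lemma fcellE d r x : fcell (d, r) x <->
  forall l, corner d l + eta * (r l)%:R <= x ord0 l < corner d l + eta * ((r l)%:R + 1).
Proof.
split => h l; have := h l; rewrite [in X in X -> _]mulrDr ?globE.
  by rewrite !addrA globE mulrDr addrA.
by rewrite addrA -globE mulrDr addrA.
Qed.

Lemma fcell_coarse d r x : fcell (d, r) x ->
  gcell o (eta * N%:R) d x.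
Proof.
move=> /fcellE h l; have /andP[h1 h2] := h l; move: h1 h2; rewrite /corner => h1 h2.
have r0 : 0 <= (r l)%:R :> R by rewrite ler0n.
have rN : (r l)%:R + 1 <= N%:R :> R by rewrite natr1 ler_nat.
apply/andP; split; nra.
Qed.

Lemma fcell_cover d x : gcell o (eta * N%:R) d x -> exists r, fcell (d, r) x.
Proof.
move=> dx.
have [|r hr] := @gcell_cover R n o eta N (\row_l (x ord0 l - eta * N%:R * (d l)%:R)) eta_gt0.
  by move=> l; rewrite !mxE; have := dx l; rewrite mulrDr mulr1; lra.
exists r; apply/fcellE => l; have := hr l; rewrite !mxE /corner; lra.
Qed.

Definition fpoint (dr : coarse * fine) : 'rV[R]_n := \row_l (o + eta * (glob dr l)%:R).

Lemma fpoint_upd (d : coarse) (r : fine) j : (r j < N')%N ->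
  fpoint (d, upd r j (inord (r j).+1)) = fpoint (d, r) + eta *: delta_mx ord0 j.
Proof.
move=> rj; apply/rowP => l; rewrite !mxE !globE !eqxx/= ffunE.
case: (altP (l =P j)) => [->|lj]; last by rewrite mulr0 addr0.
by rewrite inordK// mulr1 -natr1; ring.
Qed.

Lemma rho_fpoint dr x : rho (fpoint dr) eta x != 0 -> fcell dr x.
Proof.
move=> rx; case: dr rx => d r rx; apply/fcellE => l.
by have := rho_neq0 eta_gt0 rx l; rewrite mxE globE mulrDr mulr1 addrA => /andP[/ltW -> ->].
Qed.

Lemma mesh_family_fcell e : eta <= e ->
  mesh_family (@ball R 'rV[R]_n : caratheodory_type (@leb_outer R n) -> R ->
    set (caratheodory_type (@leb_outer R n))) fcell e.
Proof.
move=> ee; have [m1 m2 m3] := mesh_family_gcell n_gt0 o (K * N) eta_gt0 ee; split.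
- by move=> dr; exact: m1.
- by move=> dr ds x h1 h2; apply: glob_inj; exact: m2 h1 h2.
- by move=> dr; exact: m3.
Qed.

Definition corridors (e : R) (d : coarse) (l : 'I_n) : pred 'I_N :=
  [pred r : 'I_N | in_corridor e eta (corner d l) r].

Definition closed_cell (d : coarse) : set 'rV[R]_n :=
  [set x | forall l, corner d l <= x ord0 l <= corner d l + eta * N%:R].

Lemma gcell_closed_cell d : gcell o (eta * N%:R) d `<=` closed_cell d.
Proof. by move=> x dx l; have := dx l; rewrite /corner; lra. Qed.

Lemma Phi_fpoint_overlap j x :
  \sum_dr `|Phi j (fpoint dr) eta x| <= 2 ^+ n.
Proof.
apply: le_trans (@Phi_overlap R n o eta (K * N) j x eta_gt0).
exact: (@sum_inj_le _ _ _ glob (fun s => `|Phi j (\row_l (o + eta * (s l)%:R)) eta x|) glob_inj).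
Qed.

(** The support spans two cells in direction j, the second of which is in the same coarse cell
    because r j < N', and a single cell in the direction l of the slab, where the fine interval lies
    inside the slab. *)
Lemma corridor_support (e : R) (Om : set 'rV[R]_n) (d : coarse) (r : fine) (j : 'I_n) (x : 'rV[R]_n) : 0 < e ->
  closed_cell d `<=` Om -> corridor (corridors e d) j r -> (r j < N')%N ->
  (forall l, fpoint (d, r) ord0 l <= x ord0 l <=
     fpoint (d, r) ord0 l + (if l == j then 2 else 1) * eta) ->
  (Om `&` @eps_perforated R n e) x.
Proof.
move=> e0 dOm /existsP[l /andP[lj /asboolP[q [q1 q2]]]] rj hx; split.
  apply: dOm => i; have := hx i; rewrite !mxE globE => /andP[h1 h2].
  have r0 : 0 <= (r i)%:R :> R by rewrite ler0n.
  have rN : (r i)%:R + (if i == j then 2 else 1) <= N%:R :> R.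
    case: (altP (i =P j)) => [->|_]; first by rewrite -natrD ler_nat addn2.
    by rewrite natr1 ler_nat.
  have := mulr_ge0 (ltW eta_gt0) r0; have := ler_wpM2l (ltW eta_gt0) rN.
  move: h1 h2; rewrite mulrDr [_ * eta]mulrC.
  by move: (if i == j then _ else _) => z; lra.
rewrite eps_perforatedE//; exists l; exists q.
have := hx l; rewrite !mxE globE (negbTE lj) mul1r => /andP[h1 h2].
rewrite (lt_le_trans q1)//=; apply: le_lt_trans h2 _; apply: le_lt_trans q2.
by rewrite -natr1 mulrDr mulr1 addrA.
Qed.

(** Moving the coordinate l of x by at most eta < t keeps x in the slabs, whereas the end points e
    (c + 1/4) and e (c + 3/4) belong to no slab. Hence no face of the cell reaches an end point. *)
Lemma inner_corridor (e : R) (Om : set 'rV[R]_n) (d : coarse) (r : fine) t l (x : 'rV[R]_n) : 0 < e -> eta < t ->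
  fcell (d, r) x -> inner (slab e l `&` Om) t x -> corridors e d l (r l).
Proof.
move=> e0 et /fcellE dx ix; have x0 := ix x (ballxx x (lt_trans eta_gt0 et)).
case: x0 => -[q /andP[q1 q2]] _; apply/asboolP; exists q.
have /andP[h1 h2] := dx l.
have moved (y : R) : `|x ord0 l - y| <= eta -> exists q' : int, e * (q'%:~R + 1 / 4) < y < e * (q'%:~R + 3 / 4).
  move=> yt.
  have [|[q' hq'] _] := ix (\row_i (if i == l then y else x ord0 i)).
    split => //; first exact: lt_trans et.
    move=> i k; rewrite ord1 /ball/= mxE; case: (altP (k =P l)) => [->|_].
      exact: le_lt_trans et.
    by rewrite subrr normr0 (lt_trans _ et).
  by exists q'; move: hq'; rewrite mxE eqxx.
have no (c : int) (y : R) : y = e * (c%:~R + 1 / 4) \/ y = e * (c%:~R + 3 / 4) ->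
    ~ exists q' : int, e * (q'%:~R + 1 / 4) < y < e * (q'%:~R + 3 / 4).
  move=> yc [q' /andP[a1 a2]].
  have b1 : (q'%:~R : R) < c%:~R + 1 by case: yc => yc; rewrite yc ltr_pM2l// in a1; rewrite yc ltr_pM2l// in a2; lra.
  have b2 : (c%:~R : R) < q'%:~R + 1 by case: yc => yc; rewrite yc ltr_pM2l// in a1; rewrite yc ltr_pM2l// in a2; lra.
  have cq : c = q'.
    apply/eqP; rewrite eq_le -!ltzD1 -2!(ltr_int R) !intrD.
    by apply/andP.
  by case: yc => yc; rewrite yc cq ltr_pM2l// in a1; rewrite yc cq ltr_pM2l// in a2; lra.
split; rewrite ltNge; apply/negP => h.
  apply: (no q _ (or_introl erefl)); apply: moved.
  rewrite ler_norml; rewrite (mulrDr eta) mulr1 in h2; lra.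
apply: (no q _ (or_intror erefl)); apply: moved.
rewrite -[(r l).+1%:R]natr1 (mulrDr eta) mulr1 in h; rewrite (mulrDr eta) mulr1 in h2.
rewrite ler_norml; lra.
Qed.

End subgrid.

Section mollified_cells.
Context (R : realType) (n : nat) (Om : set 'rV[R]_n) (w : 'rV[R]_n -> R) (M eta : R).
Local Notation mu := (@leb R n).
Local Notation MT := (caratheodory_type (@leb_outer R n)).
Hypothesis n_gt0 : (0 < n)%N.
Hypothesis oOm : open Om.
Hypothesis bOm : bounded_set Om.
Hypothesis mw : measurable_fun [set: MT] (w : MT -> R).
Hypothesis wM : forall x, (`|w x| <= M)%R.
Hypothesis eta_gt0 : (0 < eta)%R.

Let mOm : measurable (Om : set MT).
Proof. exact: open_leb_measurable. Qed.

Let Omoo : mu Om < +oo.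
Proof. exact: bounded_leb_lty. Qed.

Let kappa_gt0 : (0 < kappa n eta :> R)%R.
Proof.
have [_] := kappaP n_gt0 (0 : 'rV[R]_n)%R eta_gt0; apply: lt_le_trans.
by rewrite exprn_gt0// divr_gt0.
Qed.

Lemma mollified_integrable q :
  mu.-integrable (Om : set MT) (EFin \o (fun x => w x * rho q eta x)%R).
Proof.
have mwO : measurable_fun (Om : set MT) (w : MT -> R) by exact: measurable_funTS.
have mr : measurable_fun (Om : set MT) (rho q eta : MT -> R).
  by apply: measurable_funTS; exact: measurable_rho.
apply: (measurable_bounded_integrable mOm Omoo); first exact: measurable_funM.
exists (M * 2 ^+ n)%R; split; first exact: num_real.
move=> y /ltW yM x _; apply: le_trans yM; rewrite normrM ler_pM//.
by have /andP[r0 r2] := rho_itv q eta x; rewrite ger0_norm.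
Qed.

Definition average (q : 'rV[R]_n) : R := (mollified Om w eta q / kappa n eta)%R.

Let avg_bounds (C : set 'rV[R]_n) q h : measurable (C : set MT) -> C `<=` Om ->
  (forall x, rho q eta x != 0 -> C x)%R ->
  (`|average q| <= M)%R /\
  (`|mollified Om w eta q - h * kappa n eta|%R)%:E <=
    (2 ^+ n)%:E * \int[mu]_(x in C) (`|w x - h|)%:E.
Proof.
move=> mC COm rC.
have mwO : measurable_fun (Om : set MT) (w : MT -> R) by exact: measurable_funTS.
have rC' x : ~ C x -> rho q eta x = 0%R.
  by move=> Cx; apply/eqP/negPn/negP => /rC.
have [ik _] := kappaP n_gt0 q eta_gt0.
have [_ h1 h2] := weighted_average_bounds h mC mOm COm Omoo mwO wM
  (measurable_rho n_gt0 q eta) (rho_itv q eta) rC' ik.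
split; last exact: h2.
by rewrite /average normrM normfV (gtr0_norm kappa_gt0) ler_pdivrMr.
Qed.

Lemma average_le (C : set 'rV[R]_n) q : measurable (C : set MT) -> C `<=` Om ->
  (forall x, rho q eta x != 0 -> C x)%R -> (`|average q| <= M)%R.
Proof. by move=> mC CO rC; have [] := avg_bounds 0%R mC CO rC. Qed.

(** The average is as good as any constant h up to a factor: one 2^n is the maximum of the bump, the
    other bounds eta^n / kappa, hence 4^n. *)
Lemma average_oscillation (C : set 'rV[R]_n) q (h : R) : measurable (C : set MT) ->
  C `<=` Om -> (forall x, rho q eta x != 0 -> C x)%R -> mu C = (eta ^+ n)%:E ->
  \int[mu]_(x in C) (`|w x - average q|%R)%:E <=
  (1 + 4 ^+ n)%:E * \int[mu]_(x in C) (`|w x - h|%R)%:E.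
Proof.
move=> mC CO rC muC.
have mwC : measurable_fun (C : set MT) (w : MT -> R) by exact: measurable_funTS.
apply: (le_trans (integral_dist_cst mu h (average q) mC mwC)).
have [_ hb] := avg_bounds h mC CO rC.
have i0 : 0 <= \int[mu]_(x in C) (`|w x - h|%R)%:E.
  by apply: integral_ge0 => x _; rewrite lee_fin.
move: (integral _ _ _) hb i0 => J hb J0.
rewrite EFinD ge0_muleDl ?lee_fin ?exprn_ge0// mul1e; apply: leeD => //.
have [_ kl] := kappaP n_gt0 (0 : 'rV[R]_n)%R eta_gt0.
apply: (@le_trans _ _ ((2 ^+ n)%:E * (`|mollified Om w eta q - h * kappa n eta|)%:E)).
  rewrite muC -!EFinM lee_fin.
  have -> : (h - average q = - (mollified Om w eta q - h * kappa n eta) / kappa n eta)%R.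
    by rewrite /average; field; rewrite gt_eqF.
  rewrite normrM normrN normfV (gtr0_norm kappa_gt0) mulrAC ler_pdivrMr//.
  rewrite mulrC [leRHS]mulrAC ler_wpM2r//.
  apply: le_trans (ler_wpM2l (exprn_ge0 n (ler0n R 2)) kl).
  by rewrite -exprMn mulrC divfK.
apply: le_trans (lee_wpmul2l _ hb) _; first by rewrite lee_fin exprn_ge0.
by rewrite muleA -EFinM -exprMn -natrM.
Qed.

End mollified_cells.

Section edges_total.
Context (R : realType) (n K N' : nat) (o eta e M Kc : R) (Om : set 'rV[R]_n) (w : 'rV[R]_n -> R).
Local Notation mu := (@leb R n).
Local Notation MT := (caratheodory_type (@leb_outer R n)).
Hypothesis n_gt0 : (0 < n)%N.
Hypothesis oOm : open Om.
Hypothesis bOm : bounded_set Om.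
Hypothesis mw : measurable_fun [set: MT] (w : MT -> R).
Hypothesis wM : forall x, (`|w x| <= M)%R.
Hypothesis eta_gt0 : (0 < eta)%R.
Hypothesis e_gt0 : (0 < e)%R.
Hypothesis tvw : tv_le Om (Om `&` @eps_perforated R n e) w Kc.
Local Notation N := N'.+1.
Local Notation coarse := {ffun 'I_n -> 'I_K}.
Local Notation fine := {ffun 'I_n -> 'I_N}.
Local Open Scope ring_scope.

(** A single application of [tv_edges] handles the edges of all coarse cells at once, so the
    variation bound [Kc] is paid once per direction, not once per cell. The factor (2 / eta)^n comes
    from the division by [kappa]. *)
Lemma edges_total :
  \sum_(d : coarse | `[< closed_cell N' o eta d `<=` Om >])
    \sum_j \sum_(r : fine) edge (fun r => average Om w eta (fpoint o eta (d, r)))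
       (corridors o eta e d) j r
  <= n%:R * (Kc * 2 ^+ n * eta) * (2 / eta) ^+ n.
Proof.
have [_ kl] := kappaP n_gt0 (0 : 'rV[R]_n)%R eta_gt0.
have e2 : 0 < (eta / 2) ^+ n by rewrite exprn_gt0// divr_gt0.
have k0 : 0 < kappa n eta :> R by exact: lt_le_trans kl.
have ki : (kappa n eta)^-1 <= (2 / eta) ^+ n :> R.
  rewrite -[(2 / eta)]invf_div exprVn lef_pV2//.
have H (j : 'I_n) : \sum_(d : coarse | `[< closed_cell N' o eta d `<=` Om >])
    \sum_(r : fine) edge (fun r => average Om w eta (fpoint o eta (d, r)))
       (corridors o eta e d) j r <= (2 / eta) ^+ n * (Kc * 2 ^+ n * eta).
  pose P (dr : coarse * fine) := `[< closed_cell N' o eta dr.1 `<=` Om >] &&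
    (corridor (corridors o eta e dr.1) j dr.2 && (dr.2 j < N')%N).
  have suppP dr : P dr -> forall x : 'rV[R]_n, (forall l, fpoint o eta dr ord0 l <= x ord0 l <=
      fpoint o eta dr ord0 l + (if l == j then 2 else 1) * eta) ->
      (Om `&` @eps_perforated R n e) x.
    case: dr => d r /andP[/asboolP dO /andP[cr rj]] x; exact: corridor_support rj.
  have := @tv_edges R n _ P (fpoint o eta) eta Kc j Om _ w eta_gt0
    (open_leb_measurable n_gt0 oOm) tvw
    (@mollified_integrable R n Om w M eta n_gt0 oOm bOm mw wM) suppP
    (@Phi_fpoint_overlap R n K N' o eta eta_gt0 j).
  set S := \sum_(i | P i) _ => SK.
  have S0 : 0 <= S by exact: sumr_ge0.
  rewrite [leLHS](_ : _ = (kappa n eta)^-1 * S).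
    apply: le_trans (ler_wpM2r S0 ki) _.
    by rewrite ler_wpM2l// exprn_ge0// divr_ge0// ltW.
  rewrite pair_big_dep/= /S mulr_sumr big_mkcond [RHS]big_mkcond/=.
  apply: eq_bigr => -[d r] _; rewrite /P andbT/=; case: asboolP => //= _; rewrite /edge.
  case: ifPn => // /andP[_ rj]; rewrite fpoint_upd// distrC /average -mulrBl normrM.
  by rewrite mulrC normfV (gtr0_norm k0).
rewrite exchange_big/=; apply: le_trans (ler_sum _ (fun j _ => H j)) _.
rewrite sumr_const card_ord -[leLHS]mulr_natl -[leRHS]mulrA.
by rewrite [X in _ <= _ * X]mulrC.
Qed.

End edges_total.

(** * Oscillation on coarse cells *)

Section coarse_step.
Context (R : realType) (n K N' : nat) (o eta e t M Kc tau1 tau2 : R)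
  (Om : set 'rV[R]_n) (w : 'rV[R]_n -> R).
Local Notation mu := (@leb R n).
Local Notation MT := (caratheodory_type (@leb_outer R n)).
Local Notation N := N'.+1.
Local Notation coarse := {ffun 'I_n -> 'I_K}.
Local Notation fine := {ffun 'I_n -> 'I_N}.
Hypothesis n_gt1 : (1 < n)%N.
Hypothesis oOm : open Om.
Hypothesis bOm : bounded_set Om.
Hypothesis mw : measurable_fun [set: MT] (w : MT -> R).
Hypothesis wM : forall x, (`|w x| <= M)%R.
Hypothesis eta_gt0 : (0 < eta)%R.
Hypothesis e_gt0 : (0 < e)%R.
Hypothesis tvw : tv_le Om (Om `&` @eps_perforated R n e) w Kc.
Hypothesis eta_e : (64 * eta <= e)%R.
Hypothesis eN : (5 * e <= 2 * (N%:R * eta))%R.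
Hypothesis eta_t : (eta < t)%R.
Variable h : coarse * fine -> R.
Let inside (d : coarse) : bool := `[< closed_cell N' o eta d `<=` Om >].
Hypothesis h_approx : \sum_(dr | inside dr.1) \int[mu]_(x in fcell o eta dr) (`|w x - h dr|%R)%:E <= tau1%:E.
Let O l : set 'rV[R]_n := slab e l `&` Om.
Hypothesis leftover : forall l, mu (O l `\` inner (O l) t) <= tau2%:E.

Let n_gt0 : (0 < n)%N. Proof. exact: ltnW. Qed.

Let mOm : measurable (Om : set MT). Proof. exact: open_leb_measurable. Qed.

(** The points of a slab too close to its faces or to the boundary of Om; their fine cells may fail
    to be corridors. *)
Let Z : set 'rV[R]_n := [set x | exists l, (O l `\` inner (O l) t) x].

Let mO l : measurable (O l `\` inner (O l) t : set MT).
Proof.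
apply: measurableD; last exact: inner_measurable.
by apply: open_leb_measurable => //; apply: openI => //; exact: slab_open.
Qed.

Let mZ : measurable (Z : set MT).
Proof.
rewrite (_ : Z = \bigcup_(l in [set: 'I_n]) (O l `\` inner (O l) t)); last first.
  by apply/seteqP; split => x [l]; [exists l|exists l].
exact: (@fin_bigcup_measurable _ MT).
Qed.

Let muZ : mu Z <= (n%:R * tau2)%:E.
Proof.
have I1 (C : set MT) : measurable C -> \int[mu]_(x in C) (1%R)%:E = mu C.
  by move=> mC; rewrite integral_cst// mul1e.
rewrite -[leLHS](I1 _ mZ).
have c (x : MT) : (Z : set MT) x -> (set0 : set MT) x \/
    exists2 l, xpredT l & (O l `\` inner (O l) t : set MT) x.
  by move=> [l xl]; right; exists l.
have b (x : MT) : (0 <= (fun=> 1 : R) x <= 1)%R by rewrite ler01 lexx.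
have L := @integral_cover_le _ MT R mu _ xpredT _ _ _ _ 1%R mO mZ measurable0 (measurable_cst (1%R:R)) b c.
apply: (le_trans L).
rewrite setI0 measure0 mule0 adde0.
apply: (@le_trans _ _ (\sum_(l < n) tau2%:E)).
  apply: lee_sum => l _; apply: le_trans (leftover l).
  by rewrite -[leRHS](I1 _ (mO l)).
by rewrite sumEFin sumr_const card_ord mulr_natl.
Qed.

(** The three terms are the Poincare inequality for the averages, the distance from w to its
    averages on fine cells, and the contribution of Z. In the first one eta^n (2 / eta)^n = 2^n
    leaves only the product eta N, and 88 = 22 * 2 * 2. *)
Lemma coarse_step : exists c : coarse -> R, (forall d, (`|c d| <= M)%R) /\
  \sum_(d | inside d) \int[mu]_(x in gcell o (eta * N%:R) d `&` @eps_perforated R n e)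
     (`|w x - c d|%R)%:E <=
  (n%:R ^+ 2 * 88 ^+ n * Kc * (eta * N%:R) + (1 + 4 ^+ n) * tau1 + 2 * M * (n%:R * tau2))%:E.
Proof.
pose a (d : coarse) (r : fine) := average Om w eta (fpoint o eta (d, r)).
have goodN (d : coarse) l : (N%:R <= 22 * #|corridors (N' := N') o eta e d l|%:R :> R)%R.
  exact: good_count.
have yex d := poincare_corridor (a d) n_gt1 (goodN d).
have [y yP] := choice yex.
have M0 : (0 <= M)%R := le_trans (normr_ge0 _) (wM 0%R).
pose c d := if inside d then a d (y d) else 0%R.
have fO (d : coarse) (r : fine) : inside d -> fcell o eta (d, r) `<=` Om.
  move=> /asboolP dO x /fcell_coarse/gcell_closed_cell; exact: dO.
have mf (dr : coarse * fine) : measurable (fcell (N' := N') o eta dr : set MT) by exact: gcell_measurable.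
have aM (d : coarse) (r : fine) : inside d -> (`|a d r| <= M)%R.
  move=> idd; rewrite /a.
  have L := @average_le R n Om w M eta n_gt0 oOm bOm mw wM eta_gt0 _ (fpoint o eta (d, r)) (mf (d, r)) (fO d r idd).
  by apply: L => x; exact: rho_fpoint.
exists c; split.
  by move=> d; rewrite /c; case: ifPn => [/aM//|_]; rewrite normr0.
pose E (d : coarse) := (\sum_j \sum_r edge (a d) (corridors (N' := N') o eta e d) j r)%R.
have [J JE] : exists J : coarse * fine -> \bar R, forall dr,
    \int[mu]_(x in fcell o eta dr) (`|w x - h dr|%R)%:E = J dr.
  by exists (fun dr => \int[mu]_(x in fcell o eta dr) (`|w x - h dr|%R)%:E).
have J0 dr : 0 <= J dr by rewrite -JE; apply: integral_ge0 => x _; rewrite lee_fin.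
have [X XE] : exists X : coarse -> \bar R, forall d,
    \int[mu]_(x in gcell o (eta * N%:R) d) (\1_Z x)%:E = X d.
  by exists (fun d => \int[mu]_(x in gcell o (eta * N%:R) d) (\1_Z x)%:E).
have X0 d : 0 <= X d by rewrite -XE; apply: integral_ge0 => x _; rewrite lee_fin.
pose A (d : coarse) := \sum_(r : fine) J (d, r).
have A0 d : 0 <= A d by apply: sume_ge0.
have mG (d : coarse) : measurable (gcell o (eta * N%:R) d : set MT) by exact: gcell_measurable.
have mP : measurable (@eps_perforated R n e : set MT).
  by apply: open_leb_measurable => //; exact: eps_perforated_open.
have step d : inside d ->
    \int[mu]_(x in gcell o (eta * N%:R) d `&` @eps_perforated R n e) (`|w x - c d|%R)%:E <=
    (1 + 4 ^+ n)%:E * A d + (eta ^+ n * (n%:R * 22 ^+ n * N%:R * E d))%:E + (2 * M)%:E * X d.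
  move=> idd; have dO : closed_cell N' o eta d `<=` Om by apply/asboolP.
  have cd : c d = a d (y d) by rewrite /c idd.
  pose P (r : fine) := [exists l, corridors (N' := N') o eta e d l (r l)].
  (* A point of the perforated set lies in some slab: either deep enough, and then its fine cell is
     good in that direction, or it belongs to Z. *)
  have cov (x : MT) : (gcell o (eta * N%:R) d `&` @eps_perforated R n e : set MT) x ->
      (Z : set MT) x \/ exists2 r, P r & (fcell o eta (d, r) : set MT) x.
    move=> [xd]; rewrite eps_perforatedE// => -[l xl].
    have Ox : O l x by split => //; apply: dO; exact: gcell_closed_cell.
    have [ix|ix] := pselect (inner (O l) t x); last by left; exists l.
    have [r xr] := fcell_cover eta_gt0 xd.
    right; exists r => //; apply/existsP; exists l.
    exact: inner_corridor xr ix.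
  have bnd (x : MT) : (0 <= `|w x - c d| <= 2 * M)%R.
    rewrite normr_ge0/=; apply: le_trans (ler_normB _ _) _.
    by have := wM x; have := aM d (y d) idd; rewrite -cd; lra.
  have mwc : measurable_fun [set: MT] (fun x : MT => `|w x - c d|%R).
    exact: (measurable_distance mw (measurable_cst _)).
  have mGP : measurable (gcell o (eta * N%:R) d `&` @eps_perforated R n e : set MT).
    exact: measurableI.
  have L := @integral_cover_le _ MT R mu _ P _ _ _ _ _ (fun r => mf (d, r)) mGP mZ mwc bnd cov.
  apply: (le_trans L).
  apply: leeD; last first.
    apply: lee_wpmul2l; first by rewrite lee_fin mulr_ge0.
    rewrite -XE integral_indic//; apply: le_measure; rewrite ?inE.
    - exact: measurableI.
    - exact: measurableI.
    - by move=> x [[xd _] xZ]; split.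
  apply: (@le_trans _ _ (\sum_(r | P r) ((1 + 4 ^+ n)%:E * J (d, r) +
      (`|a d r - a d (y d)| * eta ^+ n)%:E))).
    apply: lee_sum => r _; rewrite cd.
    have mwf : measurable_fun (fcell o eta (d, r) : set MT) (w : MT -> R) by exact: measurable_funTS.
    apply: le_trans (integral_dist_cst mu (a d r) _ (mf (d, r)) mwf) _.
    apply: leeD.
      rewrite -JE; have L' := @average_oscillation R n Om w M eta n_gt0 oOm bOm mw wM eta_gt0 _
        (fpoint o eta (d, r)) (h (d, r)) (mf (d, r)) (fO d r idd).
      apply: L'; first by move=> x; exact: rho_fpoint.
      exact: mu_gcell.
    rewrite EFinM; apply: lee_wpmul2l => //.
    by rewrite [leLHS](mu_gcell n_gt0).
  rewrite big_split/=; apply: leeD.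
    rewrite -ge0_sume_distrr//.
    apply: lee_wpmul2l; first by rewrite lee_fin addr_ge0// exprn_ge0.
    rewrite /A big_mkcond/=; by apply: lee_sum => r _; case: ifP.
  rewrite sumEFin lee_fin -mulr_suml mulrC.
  apply: ler_wpM2l; first by rewrite exprn_ge0// ltW.
  exact: yP.
apply: le_trans (lee_sum _ step) _.
rewrite !big_split/= [leRHS]EFinD; apply: leeD.
  rewrite [leRHS]EFinD [leLHS]addeC; apply: leeD.
    rewrite sumEFin lee_fin -!mulr_sumr.
    have SE := @edges_total R n K N' o eta e M Kc Om w n_gt0 oOm bOm mw wM eta_gt0 e_gt0 tvw.
    have n0 : (0 <= n%:R * 22 ^+ n * N%:R :> R)%R by rewrite !mulr_ge0// exprn_ge0.
    have en : (0 < eta ^+ n :> R)%R by rewrite exprn_gt0.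
    apply: (le_trans (ler_wpM2l (ltW en) (ler_wpM2l n0 SE))).
    rewrite le_eqVlt; apply/orP; left; apply/eqP.
    have e1 : (eta ^+ n * (2 / eta) ^+ n = 2 ^+ n :> R)%R.
      by rewrite -exprMn mulrC divfK// gt_eqF.
    have -> : (88 ^+ n = 22 ^+ n * 2 ^+ n * 2 ^+ n :> R)%R.
      by rewrite -!exprMn -!natrM.
    apply: (@eq_trans _ _ ((eta ^+ n * (2 / eta) ^+ n) *
        (n%:R * 22 ^+ n * N%:R * (n%:R * (Kc * 2 ^+ n * eta))))%R).
      by move: (eta ^+ n)%R ((2 / eta) ^+ n)%R => p q; ring.
    by rewrite e1; ring.
  rewrite -ge0_sume_distrr//.
  rewrite EFinM; apply: lee_wpmul2l; first by rewrite lee_fin addr_ge0// exprn_ge0.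
  apply: le_trans h_approx; rewrite /A pair_big_dep/= le_eqVlt; apply/orP; left; apply/eqP.
  by apply: eq_big => [[d r]|[d r] _]; rewrite ?andbT//= JE.
rewrite -ge0_sume_distrr//.
rewrite [leRHS]EFinM; apply: lee_wpmul2l; first by rewrite lee_fin mulr_ge0.
apply: le_trans muZ.
rewrite (eq_bigr (fun d => \int[mu]_(x in gcell o (eta * N%:R) d) (\1_Z x)%:E)); last by move=> d _; rewrite XE.
have -> : mu Z = \int[mu]_(x in [set: MT]) (\1_Z x)%:E by rewrite integral_indic// setIT.
have dj (d d' : coarse) (x : MT) : inside d -> inside d' ->
    gcell o (eta * N%:R) d x -> gcell o (eta * N%:R) d' x -> d = d'.
  by move=> _ _; apply: gcell_disjoint; rewrite mulr_gt0.
have mI : measurable_fun [set: MT] (fun x : MT => (\1_Z x : R)%:E).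
  by apply/measurable_EFinP; exact: measurable_indic.
have I0 (x : MT) : 0 <= (\1_Z x : R)%:E by rewrite lee_fin.
have sT (d : coarse) : inside d -> (gcell o (eta * N%:R) d : set MT) `<=` [set: MT] by [].
exact: (@sum_disjoint_integral_le _ MT R mu _ _ _ _ _ measurableT mG dj sT mI I0).
Qed.

End coarse_step.

Lemma finite_pos_lower (R : realFieldType) (I : finType) (t : I -> R) :
  (forall i, 0 < t i)%R -> exists2 t0 : R, (0 < t0)%R & forall i, (t0 <= t i)%R.
Proof.
move=> t_gt0; have s0 : (0 <= \sum_i (t i)^-1)%R by apply: sumr_ge0 => i _; rewrite invr_ge0 ltW.
have s1 : (0 < 1 + \sum_i (t i)^-1)%R by lra.
exists (1 + \sum_i (t i)^-1)^-1%R; first by rewrite invr_gt0.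
move=> i; rewrite -[leRHS]invrK lef_pV2 ?posrE ?invr_gt0//.
rewrite (bigD1 i)//= addrCA lerDl addr_ge0// sumr_ge0// => j _.
by rewrite invr_ge0 ltW.
Qed.

(** [leb_approximable] concerns nonnegative integrable functions: w is shifted by M and cut off
    outside D. The shift is undone later on the constants h. *)
Lemma shifted_restriction d (T : measurableType d) (R : realType)
    (mu : {measure set T -> \bar R}) (D : set T) (w : T -> R) (M : R) :
  measurable D -> mu D < +oo -> measurable_fun [set: T] w ->
  (forall x, `|w x| <= M)%R ->
  [/\ measurable_fun [set: T] (fun x => (w x + M) * \1_D x)%R,
      forall x, (0 <= (w x + M) * \1_D x)%R &
      \int[mu]_x ((w x + M) * \1_D x)%:E < +oo].
Proof.
move=> mD Doo mw wM.
have w0 x : (0 <= w x + M <= 2 * M)%R by have := wM x; rewrite ler_norml; lra.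
have f0 x : (0 <= (w x + M) * \1_D x)%R.
  by rewrite mulr_ge0//; have /andP[] := w0 x.
have mf : measurable_fun [set: T] (fun x => (w x + M) * \1_D x)%R.
  by apply: measurable_funM; [exact: measurable_funD|exact: measurable_indic].
split => //.
apply: (@le_lt_trans _ _ (\int[mu]_x ((2 * M)%:E * (\1_D x)%:E))).
  apply: ge0_le_integral => //.
  - by move=> x _; rewrite lee_fin.
  - exact/measurable_EFinP.
  - by apply: measurable_funeM; apply/measurable_EFinP; exact: measurable_indic.
  - by move=> x _; rewrite -EFinM lee_fin ler_wpM2r//; have /andP[] := w0 x.
have [->|/set0P[x0 _]] := eqVneq D set0.
  by rewrite integral0_eq ?ltry// => x _; rewrite indic0 mule0.
have M0 : (0 <= 2 * M)%R by have := w0 x0; lra.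
rewrite ge0_integralZl ?lee_fin//.
  by rewrite integral_indic// setIT lte_mul_pinfty// lee_fin.
by apply/measurable_EFinP; exact: measurable_indic.
Qed.

Lemma dist_integral_ge0 d (T : measurableType d) (R : realType)
    (mu : {measure set T -> \bar R}) (D : set T) (f : T -> R) (c : R) :
  0 <= \int[mu]_(x in D) (`|f x - c|%R)%:E.
Proof. by apply: integral_ge0 => x _; rewrite lee_fin. Qed.

Lemma sum_cond_le (R : realDomainType) (I : finType) (P : pred I) (F : I -> \bar R) :
  (forall i, 0 <= F i) -> \sum_(i | P i) F i <= \sum_i F i.
Proof.
by move=> F0; rewrite big_mkcond/=; apply: lee_sum => i _; case: ifP.
Qed.

(** The fine mesh [eta], a submultiple of delta, is chosen here after w and e; the resulting bound
    depends only on delta and on the prescribed error tau. *)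
Lemma coarse_poincare (R : realType) (n K : nat) (o delta e M Kc tau : R)
  (Om : set 'rV[R]_n) (w : 'rV[R]_n -> R) :
  (1 < n)%N -> open Om -> bounded_set Om ->
  measurable_fun [set: caratheodory_type (@leb_outer R n)] w ->
  (forall x, `|w x| <= M)%R -> (0 < e)%R -> (0 < delta)%R -> (0 < tau)%R ->
  (5 * e <= 2 * delta)%R -> tv_le Om (Om `&` @eps_perforated R n e) w Kc ->
  exists c : {ffun 'I_n -> 'I_K} -> R, (forall d, (`|c d| <= M)%R) /\
  \sum_(d : {ffun 'I_n -> 'I_K} | `[< forall x : 'rV[R]_n, (forall l, o + delta * (d l)%:R <= x ord0 l <=
      o + delta * (d l)%:R + delta)%R -> Om x >])
     \int[@leb R n]_(x in gcell o delta d `&` @eps_perforated R n e) (`|w x - c d|%R)%:E <=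
  (n%:R ^+ 2 * 88 ^+ n * Kc * delta + tau)%:E.
Proof.
move=> n1 oOm bOm mw wM e0 delta0 tau0 e_delta tvw.
have n0 : (0 < n)%N by exact: ltnW.
have mOm := open_leb_measurable n0 oOm.
have Omoo := bounded_leb_lty bOm.
have [mf f0 foo] := shifted_restriction mOm Omoo mw wM.
have M0 : (0 <= M)%R := le_trans (normr_ge0 _) (wM 0%R).
pose tau1 := (tau / (2 * (1 + 4 ^+ n)))%R.
have q0 : (0 < 1 + 4 ^+ n :> R)%R by rewrite addr_gt0// exprn_gt0.
have tau10 : (0 < tau1)%R by rewrite divr_gt0// mulr_gt0.
have nR : (0 < n%:R :> R)%R by rewrite ltr0n.
pose tau2 := (tau / (4 * (M + 1) * n%:R))%R.
have tau20 : (0 < tau2)%R by rewrite divr_gt0// !mulr_gt0//; lra.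
have [e1 e10 He1] := leb_approximable n0 mf f0 foo tau10.
have /choice[t tP] (l : 'I_n) : exists t, (0 < t)%R /\
    @leb R n ((slab e l `&` Om) `\` inner (slab e l `&` Om) t) <= tau2%:E.
  have oO : open (slab e l `&` Om) by apply: openI => //; exact: slab_open.
  have Ooo : @leb R n (slab e l `&` Om) < +oo.
    apply: le_lt_trans Omoo; apply: le_outer_measure; exact: subIsetr.
  by have [t t0 ht] := inner_small n0 oO Ooo tau20; exists t.
have [t0 t00 t0P] := finite_pos_lower (fun l => (tP l).1).
(* Three thresholds: e1 makes w close to constants on fine cells, e / 64 is required by
   [good_count], and t0 / 2 keeps the leftover of every slab below tau2. *)
pose thr := Num.min e1 (Num.min (e / 64) (t0 / 2))%R.
have thr0 : (0 < thr)%R by rewrite !lt_min e10 !divr_gt0.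
pose N' := Num.truncn (delta / thr).
have N1 : (delta / thr < N'.+1%:R)%R by exact: truncnS_gt.
pose eta := (delta / N'.+1%:R)%R.
have N0 : (0 < N'.+1%:R :> R)%R by rewrite ltr0n.
have eta0 : (0 < eta)%R by rewrite divr_gt0.
have eta_thr : (eta <= thr)%R.
  by move: N1; rewrite ltr_pdivrMr// /eta ler_pdivrMr// mulrC => /ltW.
have etaN : (eta * N'.+1%:R = delta)%R by rewrite divfK// gt_eqF.
have /and3P[eta1 eta2 eta3] : [&& eta <= e1, eta <= e / 64 & eta <= t0 / 2]%R.
  by move: eta_thr; rewrite !le_min.
have [h _ hP] := He1 _ _ (@mesh_family_fcell R n K N' o eta n0 eta0 e1 eta1).
have h_approx : \sum_(dr : {ffun 'I_n -> 'I_K} * {ffun 'I_n -> 'I_N'.+1} |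
      `[< closed_cell N' o eta dr.1 `<=` Om >])
    \int[@leb R n]_(x in fcell o eta dr) (`|w x - (h dr - M)|%R)%:E <= tau1%:E.
  apply: le_trans (le_trans (sum_cond_le _ _) hP).
    apply: lee_sum => -[d r] /asboolP dO.
    have E (x : 'rV[R]_n) : fcell o eta (d, r) x ->
        (w x - (h (d, r) - M) = (w x + M) * \1_Om x - h (d, r))%R.
      move=> xd; rewrite indicE mem_set ?mulr1; first ring.
      by apply: dO; apply: gcell_closed_cell; exact: fcell_coarse xd.
    rewrite le_eqVlt; apply/orP; left; apply/eqP.
    by apply: eq_integral => x /set_mem xd; rewrite E.
  by move=> dr; exact: dist_integral_ge0.
have eta_e : (64 * eta <= e)%R by lra.
have eN : (5 * e <= 2 * (N'.+1%:R * eta))%R by rewrite [(_ * eta)%R]mulrC etaN.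
have eta_t : (eta < t0)%R by lra.
have leftover (l : 'I_n) : @leb R n ((slab e l `&` Om) `\` inner (slab e l `&` Om) t0) <= tau2%:E.
  apply: le_trans (tP l).2; apply: le_outer_measure => x [Ox ix]; split => // h1.
  by apply: ix; exact: le_inner (t0P l) _ h1.
have [c [cM cP]] := @coarse_step R n K N' o eta e t0 M Kc tau1 tau2 Om w n1 oOm bOm mw wM eta0 e0 tvw
  eta_e eN eta_t (fun dr => h dr - M)%R h_approx leftover.
exists c; split => //; move: cP; rewrite /closed_cell /corner etaN => cP.
apply: le_trans cP _; rewrite lee_fin -addrA lerD2l.
have -> : ((1 + 4 ^+ n) * tau1 = tau / 2)%R by rewrite /tau1; field; rewrite gt_eqF.
suff : (2 * M * (n%:R * tau2) <= tau / 2)%R by lra.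
have -> : (2 * M * (n%:R * tau2) = (M / (M + 1)) * (tau / 2))%R.
  have Mn : (M + 1 != 0)%R by apply: lt0r_neq0; lra.
  by rewrite /tau2; field; rewrite ?Mn ?(lt0r_neq0 nR).
rewrite -[leRHS]mul1r ler_wpM2r//; first lra.
by rewrite ler_pdivrMr; lra.
Qed.

(** * Compactness on the perforated domain *)

Section step_functions.
Context (R : realType) (n K : nat) (o delta : R).
Hypothesis n_gt0 : (0 < n)%N.
Hypothesis delta_gt0 : (0 < delta)%R.
Local Notation MT := (caratheodory_type (@leb_outer R n)).
Local Notation coarse := {ffun 'I_n -> 'I_K}.
Local Open Scope ring_scope.

Definition step_fun (v : coarse -> R) (x : 'rV[R]_n) : R :=
  \sum_(d : coarse) v d * \1_(gcell o delta d) x.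

Lemma step_funE v d x : gcell o delta d x -> step_fun v x = v d.
Proof.
move=> dx; rewrite /step_fun (bigD1 d)//= big1 ?addr0.
  by rewrite indicE mem_set// mulr1.
move=> d' d'd; rewrite indicE memNset ?mulr0// => d'x.
by move/eqP: d'd; apply; exact: gcell_disjoint d'x dx.
Qed.

Lemma step_fun_le v (M : R) x : 0 <= M -> (forall d, `|v d| <= M) -> `|step_fun v x| <= M.
Proof.
move=> M0 vM; have [[d dx]|nd] := pselect (exists d : coarse, gcell o delta d x).
  by rewrite (step_funE v dx).
rewrite /step_fun big1 ?normr0// => d _; rewrite indicE memNset ?mulr0// => dx.
by apply: nd; exists d.
Qed.

Lemma measurable_step_fun v : measurable_fun [set: MT] (step_fun v : MT -> R).
Proof.
apply: measurable_sum => d; apply: measurable_funM; first exact: measurable_cst.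
by apply: measurable_indic; exact: gcell_measurable.
Qed.

End step_functions.

Definition quantum (R : realType) (M : R) (L : nat) (v : nat) : R := (v%:R / L%:R - M)%R.

Lemma quantum_bound (R : realType) (M : R) (L : nat)
    (v : 'I_(Num.truncn (2 * M * L%:R)%R).+1) : (0 < L)%N -> (0 <= M)%R ->
  (`|quantum M L v| <= M)%R.
Proof.
move=> L0 M0; have LR : (0 < L%:R :> R)%R by rewrite ltr0n.
have vl : (v%:R <= 2 * M * L%:R :> R)%R.
  rewrite -truncn_ge_nat; first by rewrite -ltnS ltn_ord.
  by rewrite !mulr_ge0.
rewrite /quantum ler_norml; apply/andP; split; first by rewrite lerBrDl subrr divr_ge0.
by rewrite lerBlDr ler_pdivrMr//; lra.
Qed.

Lemma quantumP (R : realType) (M : R) (L : nat) (c : R) : (0 < L)%N -> (`|c| <= M)%R ->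
  exists v : 'I_(Num.truncn (2 * M * L%:R)%R).+1, (`|c - quantum M L v| <= L%:R^-1)%R.
Proof.
move=> L0 cM; have LR : (0 < L%:R :> R)%R by rewrite ltr0n.
have /andP[c1 c2] : (- M <= c <= M)%R by rewrite -ler_norml.
have M0 : (0 <= M)%R by lra.
have p0 : (0 <= (c + M) * L%:R)%R by rewrite mulr_ge0//; lra.
have /andP[t1 t2] := truncn_itv p0; set t := Num.truncn _ in t1 t2.
have tl : (t < (Num.truncn (2 * M * L%:R)%R).+1)%N.
  rewrite ltnS truncn_ge_nat ?mulr_ge0//; apply: le_trans t1 _.
  by rewrite ler_wpM2r//; lra.
exists (Ordinal tl); rewrite /quantum/=.
have -> : (c - (t%:R / L%:R - M) = ((c + M) * L%:R - t%:R) / L%:R)%R by field; rewrite gt_eqF.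
rewrite normrM normfV (gtr0_norm LR) ler_pdivrMr// mulVf ?gt_eqF// ler_norml.
by move: t2; rewrite -natr1; lra.
Qed.

Section total_boundedness.
Local Notation MT := (caratheodory_type (@leb_outer _ _)).

(** The net consists of step functions on the coarse grid with values on a grid of mesh 1 / L. The
    tolerance tau is shared equally by the Poincare term, the remaining error of [coarse_poincare],
    the rounding of values and the boundary layer of Om. *)
Lemma perforated_totally_bounded (R : realType) (n : nat) (M Kc tau : R) (Om : set 'rV[R]_n) :
  (1 < n)%N -> open Om -> bounded_set Om -> (0 <= M)%R -> (0 < tau)%R ->
  exists (I : finType) (s : I -> 'rV[R]_n -> R) (e0 : R),
  [/\ forall i, measurable_fun [set: caratheodory_type (@leb_outer R n)] (s i),
      forall i x, (`|s i x| <= M)%R, (0 < e0)%R &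
      forall (e : R) (w : 'rV[R]_n -> R), (0 < e < e0)%R ->
        measurable_fun [set: caratheodory_type (@leb_outer R n)] w ->
        (forall x, `|w x| <= M)%R -> tv_le Om (Om `&` @eps_perforated R n e) w Kc ->
        exists i, \int[@leb R n]_(x in Om `&` @eps_perforated R n e) (`|w x - s i x|%R)%:E <= tau%:E].
Proof.
move=> n1 oOm bOm M0 tau0.
have n0 : (0 < n)%N by exact: ltnW.
have mOm := open_leb_measurable n0 oOm.
have Omoo := bounded_leb_lty bOm.
have [B B0 OmB] := bounded_coord bOm.
have tau4 : (0 < tau / (8 * (M + 1)))%R by rewrite divr_gt0//; lra.
have [t t0 ht] := inner_small n0 oOm Omoo tau4.
pose C1 := (n%:R ^+ 2 * 88 ^+ n * `|Kc|)%R.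
have C10 : (0 <= C1)%R by rewrite !mulr_ge0// exprn_ge0.
(* With delta <= t / 2, a coarse cell meeting [inner Om t] lies in Om; the other threshold bounds
   the Poincare term by tau / 4. *)
pose thr := Num.min (t / 2)%R (tau / (4 * (C1 + 1)))%R.
have thr0 : (0 < thr)%R by rewrite lt_min !divr_gt0//; lra.
pose K := (Num.truncn (2 * B / thr)%R).+1.
have KR : (0 < K%:R :> R)%R by rewrite ltr0n.
pose delta := (2 * B / K%:R)%R.
have delta0 : (0 < delta)%R by rewrite divr_gt0//; lra.
have delta_thr : (delta <= thr)%R.
  have : (2 * B / thr < K%:R)%R by exact: truncnS_gt.
  by rewrite ltr_pdivrMr// /delta ler_pdivrMr// [(thr * _)%R]mulrC => /ltW.
have /andP[delta_t delta_C] : (delta <= t / 2)%R && (delta <= tau / (4 * (C1 + 1)))%R.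
  by move: delta_thr; rewrite le_min.
have deltaK : (delta * K%:R = 2 * B)%R by rewrite divfK// gt_eqF.
pose L := (Num.truncn ((2 * B) ^+ n / (tau / 4))%R).+1.
have LR : (0 < L%:R :> R)%R by rewrite ltr0n.
have hL : ((2 * B) ^+ n / L%:R <= tau / 4)%R.
  have : ((2 * B) ^+ n / (tau / 4) < L%:R)%R by exact: truncnS_gt.
  rewrite ltr_pdivrMr; last lra.
  by move=> /ltW h; rewrite ler_pdivrMr// [leRHS]mulrC.
pose I := {ffun {ffun 'I_n -> 'I_K} -> 'I_(Num.truncn (2 * M * L%:R)%R).+1}.
pose s (i : I) := step_fun (- B) delta (fun d => quantum M L (i d)).
(* The bound on e is the requirement 5 e <= 2 N eta of [good_count], where N eta = delta. *)
exists I, s, (2 / 5 * delta)%R; split.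
- move=> i; refine (@measurable_step_fun R n K (- B)%R delta n0 (fun d => quantum M L (i d))).
- by move=> i x; apply: (@step_fun_le R n K (- B)%R delta delta0 _ M x M0) => d; exact: quantum_bound.
- by rewrite mulr_gt0//; lra.
move=> e w /andP[e0 ed] mw wM tvw.
have tau4' : (0 < tau / 4)%R by lra.
have e_delta : (5 * e <= 2 * delta)%R by lra.
have [c [cM cP]] := @coarse_poincare R n K (- B)%R delta e M Kc (tau / 4)%R Om w
  n1 oOm bOm mw wM e0 delta0 tau4' e_delta tvw.
have qv d := quantumP (isT : (0 < L)%N) (cM d).
have [v vP] := choice qv.
exists [ffun d => v d]; set i := [ffun d => v d].
pose inside (d : {ffun 'I_n -> 'I_K}) := `[< forall x : 'rV[R]_n, (forall l, - B + delta * (d l)%:R <= x ord0 l <=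
      - B + delta * (d l)%:R + delta)%R -> Om x >].
pose P := @eps_perforated R n e.
have mP : measurable (P : set MT) by apply: open_leb_measurable => //; exact: eps_perforated_open.
have mD (d : {ffun 'I_n -> 'I_K}) : measurable (gcell (- B) delta d `&` P : set MT).
  by apply: measurableI => //; exact: gcell_measurable.
have mZ : measurable (Om `\` inner Om t : set MT).
  by apply: measurableD => //; exact: inner_measurable.
have mOP : measurable (Om `&` P : set MT) by exact: measurableI.
have ms : measurable_fun [set: MT] (s i : MT -> R) by refine (@measurable_step_fun R n K (- B)%R delta n0 (fun d => quantum M L (i d))).
have sM x : (`|s i x| <= M)%R by apply: (@step_fun_le R n K (- B)%R delta delta0 _ M x M0) => d; exact: quantum_bound.
have mf : measurable_fun [set: MT] (fun x : MT => `|w x - s i x|%R) by exact: measurable_distance.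
have f2M (x : MT) : (0 <= `|w x - s i x| <= 2 * M)%R.
  rewrite normr_ge0/=; apply: le_trans (ler_normB _ _) _.
  by have := wM x; have := sM x; lra.
have cov (x : MT) : (Om `&` P : set MT) x -> (Om `\` inner Om t : set MT) x \/
    exists2 d, inside d & (gcell (- B) delta d `&` P : set MT) x.
  move=> [Ox Px]; have [ix|ix] := pselect (inner Om t x); last by left.
  have [|d dx] := @gcell_cover R n (- B)%R delta K x delta0.
    by move=> l; have := OmB x Ox l; rewrite ltr_norml deltaK => /andP[/ltW -> h2] /=; lra.
  right; exists d => //; apply/asboolP => y dy; apply: ix; split => //.
  move=> i0 l; rewrite ord1 /ball/= ltr_norml; have := dx l; have := dy l.
  by rewrite mulrDr mulr1; lra.
have L' := @integral_cover_le _ MT R (@leb R n) _ inside _ _ _ _ _ mD mOP mZ mf f2M cov.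
apply: (le_trans L').
have -> : (tau = (tau / 4 + tau / 4 + tau / 4) + tau / 4)%R by lra.
rewrite EFinD; apply: leeD; last first.
  apply: (@le_trans _ _ ((2 * M)%:E * (tau / (8 * (M + 1)))%:E)).
    apply: lee_wpmul2l; first by rewrite lee_fin; lra.
    by apply: le_trans ht; apply: le_outer_measure; exact: subIsetr.
  rewrite -EFinM lee_fin.
  have -> : (2 * M * (tau / (8 * (M + 1))) = (M / (M + 1)) * (tau / 4))%R.
    by field; apply: lt0r_neq0; lra.
  rewrite -[leRHS]mul1r ler_wpM2r//; first exact: ltW.
  by rewrite ler_pdivrMr; lra.
have cell d : \int[@leb R n]_(x in gcell (- B) delta d `&` P) (`|w x - s i x|%R)%:E <=
    \int[@leb R n]_(x in gcell (- B) delta d `&` P) (`|w x - c d|%R)%:E +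
    (L%:R^-1 * delta ^+ n)%:E.
  have E : \int[@leb R n]_(x in gcell (- B) delta d `&` P) (`|w x - s i x|%R)%:E =
     \int[@leb R n]_(x in gcell (- B) delta d `&` P) (`|w x - quantum M L (v d)|%R)%:E.
    apply: eq_integral => x /set_mem[dx _].
    by rewrite /s (step_funE delta0 _ dx) ffunE.
  rewrite E.
  have mwD : measurable_fun (gcell (- B) delta d `&` P : set MT) (w : MT -> R) by exact: measurable_funTS.
  have L'' := integral_dist_cst (@leb R n) (c d) (quantum M L (v d)) (mD d) mwD.
  apply: (le_trans L''); apply: leeD => //.
  rewrite EFinM; apply: lee_pmul => //; first by rewrite lee_fin vP.
  rewrite -(mu_gcell n0 (- B)%R d delta0).
  by apply: le_outer_measure; exact: subIsetl.
apply: le_trans (lee_sum _ (fun d _ => cell d)) _.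
rewrite big_split/= EFinD; apply: leeD.
  apply: (le_trans cP); rewrite lee_fin lerD2r.
  apply: (@le_trans _ _ (C1 * delta)%R).
    apply: ler_wpM2r; first exact: ltW.
    by apply: ler_wpM2l; [rewrite !mulr_ge0// exprn_ge0|exact: ler_norm].
  apply: (@le_trans _ _ (C1 * (tau / (4 * (C1 + 1))))%R); first exact: ler_wpM2l.
  have -> : (C1 * (tau / (4 * (C1 + 1))) = (C1 / (C1 + 1)) * (tau / 4))%R.
    by field; apply: lt0r_neq0; lra.
  rewrite -[leRHS]mul1r ler_wpM2r//; first exact: ltW.
  by rewrite ler_pdivrMr; lra.
apply: (@le_trans _ _ (\sum_(d : {ffun 'I_n -> 'I_K}) (L%:R^-1 * delta ^+ n)%:E)).
  apply: sum_cond_le => d; rewrite lee_fin mulr_ge0// ?invr_ge0 ?exprn_ge0//; exact: ltW.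
rewrite sumEFin lee_fin sumr_const card_ffun !card_ord -[leLHS]mulr_natl natrX.
by rewrite mulrCA -exprMn [(K%:R * _)%R]mulrC deltaK mulrC.
Qed.

End total_boundedness.

(** * Extraction of subsequences and rapidly Cauchy sequences *)

Lemma strict_choice (P : nat -> nat -> Prop) :
  (forall l k0, exists2 k, (k0 <= k)%N & P l k) ->
  exists2 sigma : nat -> nat, {homo sigma : i j / (i < j)%N} & forall l, P l (sigma l).
Proof.
move=> H; have [f fP] := choice (fun lk : nat * nat => let: ex_intro2 k h1 h2 := H lk.1 lk.2 in
   ex_intro (fun k => (lk.2 <= k)%N /\ P lk.1 k) k (conj h1 h2)).
pose sigma := fix s l := if l is l'.+1 then f (l, (s l').+1) else f (0%N, 0%N).
exists sigma.
  apply: homo_ltn; first exact: ltn_trans.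
  by move=> i /=; have [h _] := fP (i.+1, (sigma i).+1).
by case=> [|l] /=; [have [] := fP (0%N, 0%N)|have [] := fP (l.+1, (sigma l).+1)].
Qed.

(* The choices s j are made along one ultrafilter, so that finitely many of
   them are always compatible. *)
Lemma diagonal_extraction (S : Type) (Q : nat -> nat -> S -> Prop) :
  (forall j, exists (I : finType) (f : I -> S), \forall k \near \oo, exists i, Q j k (f i)) ->
  exists (s : nat -> S) (sigma : nat -> nat), {homo sigma : i j / (i < j)%N} /\
    forall j l, (j <= l)%N -> Q j (sigma l) (s j).
Proof.
move=> H; have [G [uG oG]] := ultraFilterLemma (eventually_filter : ProperFilter \oo).
have pG : ProperFilter G by exact: ultra_proper.
have pick j : exists s, \forall k \near G, Q j k s.
  have [I [f fP]] := H j; apply: contrapT => /forallNP nG.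
  have : \forall k \near G, forall i, ~ Q j k (f i).
    apply: (@filter_forall _ I (fun i k => ~ Q j k (f i))) => i.
    by have [/nG|] := in_ultra_setVsetC [set k | Q j k (f i)] uG.
  have {}fP : \forall k \near G, exists i, Q j k (f i) by exact: oG.
  by move=> nQ; have [k [[i Qi] nQk]] := filter_ex (filterI fP nQ); exact: nQk Qi.
have [s sP] := choice pick; exists s.
have [l k0|sigma s_homo sQ] := @strict_choice (fun l k => forall j, (j <= l)%N -> Q j k (s j)).
  have h1 : \forall k \near G, forall j : 'I_l.+1, Q j k (s j).
    by apply: (@filter_forall _ 'I_l.+1 (fun j k => Q j k (s j))) => j; exact: sP.
  have h2 : \forall k \near G, (k0 <= k)%N by apply: oG; exact: nbhs_infty_ge.
  have [k [k1 k2]] := filter_ex (filterI h1 h2).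
  by exists k => // j jl; exact: (k1 (Ordinal (jl : (j < l.+1)%N))).
by exists sigma; split => // j l jl; exact: sQ.
Qed.

Lemma limn_esup_itv (R : realType) (u : nat -> \bar R) (a b : \bar R) (N : nat) :
  (forall l, (N <= l)%N -> a <= u l <= b) -> a <= limn_esup u <= b.
Proof.
move=> uab; apply/andP; split.
  apply: le_ereal_inf_tmp => _ [V [N' _ NV] <-].
  apply: (@le_trans _ _ (u (maxn N N'))).
    by have /andP[] := uab _ (leq_maxl N N').
  by apply: ereal_sup_ubound; exists (maxn N N') => //; apply: NV => /=; exact: leq_maxr.
apply: ge_ereal_inf; exists (ereal_sup [set u x | x in [set l | (N <= l)%N]]).
  by exists [set l | (N <= l)%N] => //; exact: nbhs_infty_ge.
by apply: ge_ereal_sup => _ [l Nl <-]; have /andP[] := uab _ Nl.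
Qed.

Section rapidly_cauchy.
Context d (T : measurableType d) (R : realType) (mu : {measure set T -> \bar R}).

(** The limit is defined at every point as an upper limit, finite because of the bound M. The
    telescoping estimate holds pointwise, trivially where the series diverges, and is then
    integrated term by term. *)
Lemma rapidly_cauchy_limit (D : set T) (s : nat -> T -> R) (M c : R) : measurable D ->
  (forall j, measurable_fun [set: T] (s j)) -> (forall j x, `|s j x| <= M)%R ->
  (forall j, \int[mu]_(x in D) (`|s j.+1 x - s j x|%R)%:E <= (c / 2 ^+ j)%:E) ->
  exists U : T -> R, [/\ measurable_fun [set: T] U, forall x, (`|U x| <= M)%R &
    forall i, \int[mu]_(x in D) (`|U x - s i x|%R)%:E <= (2 * c / 2 ^+ i)%:E].
Proof.
move=> mD ms sM sc; pose E x := limn_esup (fun j => (s j x)%:E).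
have Eb x i (r : R) : (forall l, (i <= l)%N -> `|s l x - s i x| <= r)%R ->
    ((s i x - r)%:E <= E x <= (s i x + r)%:E).
  move=> H; apply: (@limn_esup_itv _ _ _ _ i) => l /H; rewrite ler_norml !lee_fin.
  by move=> /andP[h1 h2]; apply/andP; split; lra.
have EM x : (- M)%:E <= E x <= M%:E.
  apply: (@limn_esup_itv _ _ _ _ 0) => l _; rewrite !lee_fin.
  by have := sM l x; rewrite ler_norml.
have Efin x : E x \is a fin_num.
  by have := EM x; case: (E x) => [r| |] //= /andP[].
pose U x := fine (E x); have UE x : (U x)%:E = E x by rewrite fineK.
have mU : measurable_fun [set: T] U.
  apply: (@measurableT_comp _ _ _ _ _ _ fine _ E); first exact: fine_measurable.
  by apply: measurable_fun_limn_esup => j; exact/measurable_EFinP.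
exists U; split => //.
  by move=> x; rewrite ler_norml -!lee_fin UE EM.
move=> i.
have md j : measurable_fun D (fun x => (`|s j.+1 x - s j x|%R)%:E).
  apply/measurable_EFinP; apply: measurable_funTS; exact: measurable_distance.
pose V x := \sum_(0 <= j <oo) (`|s (i + j).+1 x - s (i + j)%N x|%R)%:E.
apply: (@le_trans _ _ (\int[mu]_(x in D) V x)).
  apply: ge0_le_integral => //.
  - by apply/measurable_EFinP; apply: measurable_funTS; exact: measurable_distance.
  - apply: ge0_emeasurable_sum; first by move=> *; rewrite lee_fin.
    by move=> j _; exact: md.
  - move=> x _; have part l : (\sum_(0 <= j < l) `|s (i + j).+1 x - s (i + j)%N x|%R)%:E <= V x.
      rewrite -sumEFin; apply: (@nneseries_lim_ge R (fun j => (`|s (i + j).+1 x - s (i + j)%N x|%R)%:E) xpredT) => j _ _.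
      by rewrite lee_fin.
    have tel l : (`|s (i + l)%N x - s i x| <= \sum_(0 <= j < l) `|s (i + j).+1 x - s (i + j)%N x|)%R.
      elim: l => [|l ih]; first by rewrite addn0 subrr normr0 big_nil.
      rewrite big_nat_recr//= addnS.
      have -> : (s (i + l).+1 x - s i x = (s (i + l)%N x - s i x) + (s (i + l).+1 x - s (i + l)%N x))%R by ring.
      by apply: le_trans (ler_normD _ _) _; rewrite lerD2r.
    move: part; case: (V x) => [r| |] part; last by have := part 0%N; rewrite big_nil leeNy_eq.
      rewrite lee_fin ler_distl -!lee_fin UE; apply: Eb => l il.
      by rewrite -(subnKC il); apply: le_trans (tel _) _; rewrite -lee_fin.
    by rewrite leey.
rewrite integral_nneseries//; apply: lime_le.
  by apply: is_cvg_nneseries => j _ _; apply: integral_ge0 => x _; rewrite lee_fin.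
apply: nearW => N.
have c0 : (0 <= c)%R.
  have := sc 0%N; rewrite expr0 divr1 -lee_fin; apply: le_trans.
  by apply: integral_ge0 => x _; rewrite lee_fin.
apply: (@le_trans _ _ (\sum_(0 <= j < N) (c / 2 ^+ (i + j))%:E)); first exact: lee_sum.
rewrite sumEFin lee_fin.
have -> : (\sum_(0 <= j < N) c / 2 ^+ (i + j) = 2 * c / 2 ^+ i * (1 - (2 ^+ N)^-1))%R.
  elim: N => [|N ih]; first by rewrite big_nil expr0 invr1 subrr mulr0.
  rewrite big_nat_recr//= ih exprD [in RHS]exprS.
  have p k : (2 ^+ k != 0 :> R)%R by rewrite expf_neq0.
  by field; rewrite !p.
have p i0 : (0 < 2 ^+ i0 :> R)%R by rewrite exprn_gt0.
rewrite -[leRHS]mulr1 ler_wpM2l ?divr_ge0 ?mulr_ge0 ?(ltW (p i))//.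
Qed.

End rapidly_cauchy.

Section integral_distance2.
Context d (T : measurableType d) (R : realType) (mu : {measure set T -> \bar R}).

Lemma integral_dist_triangle (D : set T) (u v w : T -> R) : measurable D ->
  measurable_fun D u -> measurable_fun D v -> measurable_fun D w ->
  \int[mu]_(x in D) (`|u x - w x|%R)%:E <=
  \int[mu]_(x in D) (`|u x - v x|%R)%:E + \int[mu]_(x in D) (`|v x - w x|%R)%:E.
Proof.
move=> mD mu' mv mw.
have md (f g : T -> R) : measurable_fun D f -> measurable_fun D g ->
    measurable_fun D (fun x => (`|f x - g x|%R)%:E).
  by move=> mf mg; apply/measurable_EFinP; exact: measurable_distance.
rewrite -ge0_integralD//; last 2 first.
- exact: md.
- exact: md.
apply: ge0_le_integral => //.
- exact: md.
- by apply: emeasurable_funD; exact: md.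
- by move=> x _; rewrite -EFinD lee_fin; exact: ler_distD.
Qed.

Lemma integral_dist_bounded (D : set T) (u v : T -> R) (M : R) : measurable D ->
  mu D < +oo -> measurable_fun D u -> measurable_fun D v ->
  (forall x, `|u x| <= M)%R -> (forall x, `|v x| <= M)%R ->
  \int[mu]_(x in D) (`|u x - v x|%R)%:E < +oo.
Proof.
move=> mD Doo mu' mv uM vM.
apply: (@le_lt_trans _ _ (\int[mu]_(x in D) (2 * M)%:E)).
  apply: ge0_le_integral => //.
  - by apply/measurable_EFinP; exact: measurable_distance.
  - move=> x _; rewrite lee_fin; apply: le_trans (ler_normB _ _) _.
    by have := uM x; have := vM x; lra.
rewrite integral_cst//; have [D0|D0] := eqVneq D set0.
  by rewrite D0 measure0 mule0 ltry.
have /set0P[x0 _] := D0.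
by rewrite lte_mul_pinfty// lee_fin; have := le_trans (normr_ge0 _) (uM x0); lra.
Qed.

Lemma ge0_subset_integral_dist (A B : set T) (f g : T -> R) : measurable A -> measurable B ->
  measurable_fun B f -> measurable_fun B g -> A `<=` B ->
  \int[mu]_(x in A) (`|f x - g x|%R)%:E <= \int[mu]_(x in B) (`|f x - g x|%R)%:E.
Proof.
move=> mA mB mf mg AB; apply: ge0_subset_integral => //.
by apply/measurable_EFinP; exact: measurable_distance.
Qed.

End integral_distance2.

Section compactness.
Context (R : realType) (n : nat).
Local Notation mu := (@leb R n).
Local Notation MT := (caratheodory_type (@leb_outer R n)).

Lemma perforated_compact (Om : set 'rV[R]_n) (eps : nat -> R) (M Kc : R)
    (w : nat -> 'rV[R]_n -> R) :
  (1 < n)%N -> open Om -> bounded_set Om ->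
  (forall k, 0 < eps k)%R -> eps @ \oo --> (0%R : R) ->
  (forall k, measurable_fun [set: MT] (w k : MT -> R)) -> (forall k x, `|w k x| <= M)%R ->
  (forall k, tv_le Om (Om `&` @eps_perforated R n (eps k)) (w k) Kc) ->
  exists (sigma : nat -> nat) (U : 'rV[R]_n -> R),
  [/\ {homo sigma : i j / (i < j)%N}, measurable_fun [set: MT] (U : MT -> R),
      forall x, (`|U x| <= M)%R &
      \int[mu]_(x in Om `&` @eps_perforated R n (eps (sigma k))) (`|w (sigma k) x - U x|%R)%:E
        @[k --> \oo] --> 0].
Proof.
move=> n1 oOm bOm eps0 eps_cvg mw wM tvw.
have n0 : (0 < n)%N by exact: ltnW.
have M0 : (0 <= M)%R := le_trans (normr_ge0 _) (wM 0%N 0%R).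
have mOm := open_leb_measurable n0 oOm.
have Omoo := bounded_leb_lty bOm.
pose A k := Om `&` @eps_perforated R n (eps k).
have mA k : measurable (A k : set MT).
  by apply: measurableI => //; apply: open_leb_measurable => //; exact: eps_perforated_open.
pose a j : R := (2 ^+ j)^-1%R.
have a0 j : (0 < a j)%R by rewrite invr_gt0 exprn_gt0.
pose Q j k (s : 'rV[R]_n -> R) := [/\ measurable_fun [set: MT] (s : MT -> R),
  forall x, (`|s x| <= M)%R & \int[mu]_(x in A k) (`|w k x - s x|%R)%:E <= (a j)%:E].
have eps_small e0 : (0 < e0)%R -> \forall k \near \oo, (eps k < e0)%R.
  move=> e00; have /cvgrPdist_lt/(_ _ e00) := eps_cvg.
  apply: filterS => k; rewrite sub0r normrN; exact: le_lt_trans (ler_norm _).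
have [s [sigma [sigma_homo sQ]]] : exists (s : nat -> 'rV[R]_n -> R) (sigma : nat -> nat),
    {homo sigma : i j / (i < j)%N} /\ forall j l, (j <= l)%N -> Q j (sigma l) (s j).
  apply: diagonal_extraction => j.
  have [I [f [e0 [mf fM e00 fP]]]] := perforated_totally_bounded Kc n1 oOm bOm M0 (a0 j).
  exists I, f; near=> k.
  have ke : (0 < eps k < e0)%R by rewrite eps0/=; near: k; exact: eps_small.
  have [i iP] := fP (eps k) (w k) ke (mw k) (wM k) (tvw k).
  by exists i; split; [exact: mf|exact: fM|exact: iP].
have ms j : measurable_fun [set: MT] (s j : MT -> R) by have [] := sQ j j (leqnn j).
have sM j x : (`|s j x| <= M)%R by have [_ h _] := sQ j j (leqnn j); exact: h.
have sD j l : (j <= l)%N -> \int[mu]_(x in A (sigma l)) (`|w (sigma l) x - s j x|%R)%:E <= (a j)%:E.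
  by move=> /sQ[].
have sigma_ge l : (l <= sigma l)%N.
  by elim: l => // l ih; exact: leq_ltn_trans ih (sigma_homo l l.+1 (ltnSn l)).
(* Two approximations of the same w are close on its perforated set, and [weak_perforated] carries
   this to Om at the cost of a factor 2, as [CP] is at least 1/2. In units of 2^-j the bound is 2
   (1/2 + 1 + 1/2) = 4. *)
have cauchy j : \int[mu]_(x in Om) (`|s j.+1 x - s j x|%R)%:E <= (4 / 2 ^+ j)%:E.
  have mf : measurable_fun (Om : set MT) (fun x : MT => `|s j.+1 x - s j x|%R).
    by apply: measurable_funTS; exact: measurable_distance.
  have mo k : measurable_fun (A k : set MT) (w k : MT -> R) by exact: measurable_funTS.
  have msA k i : measurable_fun (A k : set MT) (s i : MT -> R) by exact: measurable_funTS.
  have msO i : measurable_fun (Om : set MT) (s i : MT -> R) by exact: measurable_funTS.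
  have foo : \int[mu]_(x in Om) (`|s j.+1 x - s j x|%R)%:E < +oo.
    exact: (integral_dist_bounded mOm Omoo (msO _) (msO _) (sM _) (sM _)).
  have [e0 e00 wp] := weak_perforated n0 oOm bOm mf (fun x => normr_ge0 _) foo
    (divr_gt0 (a0 j) (ltr0Sn R 1)).
  have [l [jl le0]] : exists l, (j.+1 <= l)%N /\ (eps (sigma l) < e0)%R.
    have [N _ NP] := eps_small _ e00.
    exists (maxn j.+1 N); split; first exact: leq_maxl.
    by apply: NP => /=; apply: leq_trans (sigma_ge _); exact: leq_maxr.
  have [|_ hl] := wp (eps (sigma l)); first by rewrite eps0.
  have tri := integral_dist_triangle mu (mA (sigma l)) (msA _ j.+1) (mo _) (msA _ j).
  have ub : \int[mu]_(x in A (sigma l)) (`|s j.+1 x - s j x|%R)%:E <= (a j.+1 + a j)%:E.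
    apply: (le_trans tri); rewrite EFinD; apply: leeD; last exact: sD _ _ (ltnW jl).
    apply: le_trans (sD _ _ jl); rewrite le_eqVlt; apply/orP; left; apply/eqP.
    by apply: eq_integral => x _; rewrite distrC.
  have {}hl := le_trans hl (leeD2r _ ub).
  have J0 : 0 <= \int[mu]_(x in Om) (`|s j.+1 x - s j x|%R)%:E.
    by apply: integral_ge0 => x _; rewrite lee_fin.
  have {hl} := le_trans (lee_wpmul2r J0 (CP_ge R n0)) hl.
  move: foo J0; move: (integral _ _ _) => J; case: J => [r| |]// _ _.
  rewrite -!EFinD -EFinM !lee_fin /a exprS invfM => h.
  by have : (2 ^- j = 1 / 2 ^+ j :> R)%R; [rewrite div1r|lra].
have [U [mU UM Us]] := rapidly_cauchy_limit mOm ms sM cauchy.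
exists sigma, U; split => //.
(* The constant 9 is 1 for the distance from w to s l plus 2 * 4 for the distance from s l to U. *)
have bound l : 0 <= \int[mu]_(x in A (sigma l)) (`|w (sigma l) x - U x|%R)%:E <=
    (9 * (1 / 2) ^+ l)%:E.
  apply/andP; split; first by apply: integral_ge0 => x _; rewrite lee_fin.
  have mwA : measurable_fun (A (sigma l) : set MT) (w (sigma l) : MT -> R) by exact: measurable_funTS.
  have msA : measurable_fun (A (sigma l) : set MT) (s l : MT -> R) by exact: measurable_funTS.
  have mUA : measurable_fun (A (sigma l) : set MT) (U : MT -> R) by exact: measurable_funTS.
  apply: le_trans (integral_dist_triangle mu (mA (sigma l)) mwA msA mUA) _.
  have -> : (9 * (1 / 2) ^+ l = a l + 2 * 4 / 2 ^+ l :> R)%R.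
    by rewrite /a expr_div_n expr1n; field; rewrite expf_neq0.
  rewrite EFinD; apply: leeD; first exact: sD.
  apply: le_trans (Us l).
  rewrite [leRHS](_ : _ = \int[mu]_(x in Om) (`|s l x - U x|%R)%:E); last first.
    by apply: eq_integral => x _; rewrite distrC.
  apply: (ge0_subset_integral_dist mu (mA (sigma l)) mOm (measurable_funTS (ms l)) (measurable_funTS mU)); exact: subIsetl.
apply: (@squeeze_cvge _ _ _ _ (fun=> 0) _ (fun l => (9 * (1 / 2) ^+ l)%:E)).
- by near=> l; exact: bound.
- exact: cvg_cst.
- apply: cvg_EFin; first exact: nearW.
  rewrite -[X in _ --> X](mulr0 9%R); apply: cvgM; first exact: cvg_cst.
  by apply: cvg_expr; rewrite ger0_norm; lra.
Unshelve. all: by end_near.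
Qed.

End compactness.

(** * Convergence of minimizers *)

Section clipping.
Context d (T : measurableType d) (R : realType) (mu : {measure set T -> \bar R}).

(* Clipping u at the level M >= |g| moves u towards g without overshooting:
   |u - g| = |u - Tu| + |Tu - g|. *)
Lemma clip_minimal_ae (D : set T) (u g : T -> R) (M : R) :
  let Tu x := Num.max (Num.min (u x) M) (- M)%R in
  measurable D -> mu D < +oo -> measurable_fun D u -> measurable_fun D g ->
  (forall x, `|g x| <= M)%R ->
  \int[mu]_(x in D) (`|u x - g x|%R)%:E <= \int[mu]_(x in D) (`|Tu x - g x|%R)%:E ->
  {ae mu, forall x, D x -> Tu x = u x}.
Proof.
move=> Tu mD Doo mu' mg gM ugT.
have mT : measurable_fun D Tu by exact: measurable_clip.
have [D0|/set0P[x0 _]] := eqVneq D set0.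
  by apply: aeW => x; rewrite D0.
have M0 : (0 <= M)%R := le_trans (normr_ge0 _) (gM x0).
have TM x : (`|Tu x| <= M)%R.
  by rewrite /Tu ler_norml le_max lexx orbT/= ge_max ge_min lexx orbT/=; lra.
have foo := integral_dist_bounded mD Doo mT mg TM gM.
have J0 : 0 <= \int[mu]_(x in D) (`|Tu x - g x|%R)%:E.
  by apply: integral_ge0 => x _; rewrite lee_fin.
have I0 : 0 <= \int[mu]_(x in D) (`|Tu x - u x|%R)%:E.
  by apply: integral_ge0 => x _; rewrite lee_fin.
have md (v w : T -> R) : measurable_fun D v -> measurable_fun D w ->
    measurable_fun D (fun x => (`|v x - w x|%R)%:E).
  by move=> mv mw; apply/measurable_EFinP; exact: measurable_distance.
have split : \int[mu]_(x in D) (`|u x - g x|%R)%:E =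
    \int[mu]_(x in D) (`|Tu x - u x|%R)%:E + \int[mu]_(x in D) (`|Tu x - g x|%R)%:E.
  rewrite -ge0_integralD//; last 2 first.
  - exact: md.
  - exact: md.
  apply: eq_integral => x _; rewrite -EFinD; congr (_%:E).
  have := gM x; rewrite ler_norml => /andP[g1 g2]; rewrite /Tu.
  have [h1|h1] := leP (u x) M; last first.
    rewrite (max_idPl _); last by lra.
    by rewrite [`|u x - g x|%R]ger0_norm ?[`|M - u x|%R]ler0_norm ?ger0_norm; lra.
  have [h2|h2] := leP (- M)%R (u x); first by rewrite subrr normr0 add0r.
  by rewrite [`|u x - g x|%R]ler0_norm ?[`|- M - u x|%R]ger0_norm ?ler0_norm; lra.
move: split ugT => ->.
move: foo J0 I0; case E : (\int[mu]_(x in D) (`|Tu x - u x|%R)%:E) => [r| |]//;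
  case: (\int[mu]_(x in D) (`|Tu x - g x|%R)%:E) => [s| |]//= _ _.
rewrite -EFinD !lee_fin => r0 rs.
have {}r0 : r = 0%R by lra.
have /(ae_eq_integral_abs mu mD)[+ _] : measurable_fun D (fun x => (Tu x - u x)%:E).
  by apply/measurable_EFinP; exact: measurable_funB.
rewrite r0 in E; move=> /(_ E); apply: filterS => x /[apply] -[] /eqP.
by rewrite subr_eq0 => /eqP.
Qed.

Lemma ae_eq_integral_dist (D : set T) (u v g : T -> R) : measurable D ->
  measurable_fun D u -> measurable_fun D v -> measurable_fun D g ->
  {ae mu, forall x, D x -> u x = v x} ->
  \int[mu]_(x in D) (`|u x - g x|%R)%:E = \int[mu]_(x in D) (`|v x - g x|%R)%:E.
Proof.
move=> mD mu' mv mg uv; apply: ae_eq_integral => //.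
- by apply/measurable_EFinP; exact: measurable_distance.
- by apply/measurable_EFinP; exact: measurable_distance.
- by apply: filterS uv => x h Dx; rewrite h.
Qed.

Lemma integral_norm_le (D : set T) (f : T -> R) (M : R) : measurable D ->
  measurable_fun D f -> (forall x, `|f x| <= M)%R ->
  \int[mu]_(x in D) (`|f x|%R)%:E <= M%:E * mu D.
Proof.
move=> mD mf fM; rewrite -integral_cst//; apply: ge0_le_integral => //.
- by apply/measurable_EFinP; exact: measurableT_comp.
- by move=> x _; rewrite lee_fin.
Qed.

End clipping.

(** * A priori bounds for minimizers *)

Section minimizer_bounds.
Context (R : realType) (n : nat) (Om : set 'rV[R]_n) (g : 'rV[R]_n -> R) (m : nat).
Local Notation mu := (@leb R n).
Local Notation MT := (caratheodory_type (@leb_outer R n)).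
Hypothesis n_gt0 : (0 < n)%N.
Hypothesis oOm : open Om.
Hypothesis bOm : bounded_set Om.
Hypothesis mg : measurable_fun [set: MT] (g : MT -> R).
Hypothesis gm : forall x, (`|g x| <= m%:R)%R.
Local Notation A e := (Om `&` @eps_perforated R n e).

Let mOm : measurable (Om : set MT). Proof. exact: open_leb_measurable. Qed.

Let Omoo : mu Om < +oo. Proof. exact: bounded_leb_lty. Qed.

Let mA e : (0 < e)%R -> measurable (A e : set MT).
Proof.
by move=> e0; apply: measurableI => //; apply: open_leb_measurable => //; exact: eps_perforated_open.
Qed.

Let muOm : mu Om = (fine (mu Om))%:E.
Proof. by rewrite fineK// ge0_fin_numE. Qed.

Definition energy_bound : R := (m%:R * fine (mu Om))%R.

Lemma Fe_ge0 e b u : (0 <= b)%R -> 0 <= Fe Om e b u.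
Proof.
move=> b0; have [gu|gu] := pselect (GSBV2 Om u); last by rewrite FeNE// leey.
rewrite FeE//; apply: adde_ge0; first apply: adde_ge0.
- by apply: integral_ge0 => x _; rewrite lee_fin sqr_ge0.
- exact: measure_ge0.
- by apply: mule_ge0; [rewrite lee_fin|exact: measure_ge0].
Qed.

Lemma Ge_ge0 e u : 0 <= Ge Om g e u.
Proof. by apply: integral_ge0 => x _; rewrite lee_fin. Qed.

Lemma Ge0_bound e : (0 < e)%R -> Ge Om g e (fun=> 0%R) <= energy_bound%:E.
Proof.
move=> e0; rewrite /energy_bound EFinM -muOm.
apply: (@le_trans _ _ (m%:R%:E * mu (A e))); last first.
  apply: lee_wpmul2l; first by rewrite lee_fin.
  by apply: le_outer_measure; exact: subIsetl.
have mg0 : measurable_fun (A e : set MT) (fun x : MT => 0 - g x)%R.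
  by apply: measurable_funB; [exact: measurable_cst|exact: measurable_funTS].
apply: (integral_norm_le mu (mA e0) mg0) => x; by rewrite sub0r normrN.
Qed.

(** The competitor 0 bounds the energy by m times the measure of Om, which controls both the
    gradient and the jump set in [tv_bound]; the competitor [trunc m u] gives the bound by m. *)
Lemma minimizer_bounds e b u : (0 < e)%R -> (0 <= b)%R ->
  is_minimizer Om (fun v => Fe Om e b v + Ge Om g e v) u ->
  [/\ Fe Om e b u + Ge Om g e u <= energy_bound%:E, GSBV2 Om u,
      {ae mu, forall x, A e x -> trunc m u x = u x} &
      tv_le Om (A e) (trunc m u \_ Om)
        (fine (mu Om) + energy_bound + 2 * m%:R * energy_bound)%R].
Proof.
move=> e0 b0 [L1u umin].
have E0 : Fe Om e b u + Ge Om g e u <= energy_bound%:E.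
  have := umin _ (integrable0 _ _ : L1 Om (fun=> 0%R)).
  by rewrite (Fe0 n_gt0)// add0e => /le_trans; apply; exact: Ge0_bound.
have Fu : Fe Om e b u <= energy_bound%:E.
  by apply: le_trans E0; rewrite leeDl// Ge_ge0.
have Foo : Fe Om e b u \is a fin_num.
  by rewrite ge0_fin_numE ?Fe_ge0// (le_lt_trans Fu) ?ltry.
have gu : GSBV2 Om u by apply: contrapT => /FeNE h; move: Foo; rewrite h.
have mu' : measurable_fun (Om : set MT) (u : MT -> R).
  by have /measurable_EFinP := measurable_int _ L1u.
have gT := GSBV2_trunc n_gt0 m oOm gu.
have FT := Fe_trunc_le n_gt0 m e u oOm b0.
have SBVT : SBV Om (trunc m u) by have [[_ h] _ _] := gu; exact: h.
have L1T : L1 Om (trunc m u) by have [] := SBVT.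
have mT : measurable_fun (Om : set MT) (trunc m u : MT -> R) by exact: measurable_trunc.
split => //.
  (* Truncation does not increase the finite term [Fe], so minimality prevents it from lowering the
     data term, and [clip_minimal_ae] applies. *)
  have GT : Ge Om g e u <= Ge Om g e (trunc m u).
    rewrite -(leeD2lE _ _ Foo); apply: le_trans (umin _ L1T) _.
    by rewrite leeD2r.
  have muA : mu (A e) < +oo.
    by apply: le_lt_trans Omoo; apply: le_outer_measure; exact: subIsetl.
  exact: (clip_minimal_ae (mA e0) muA (measurable_funS mOm (@subIsetl _ _ _) mu')
    (measurable_funTS mg) gm GT).
move=> j phi tphi phi1.
rewrite (_ : (\int[mu]_(x in Om) _) = \int[mu]_(x in Om) (trunc m u x * partial j phi x)%:E); last first.
  by apply: eq_integral => x xO; rewrite /patch xO.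
have TV := tv_bound n_gt0 j (ler0n R m) oOm SBVT (trunc_bound m u) tphi phi1.
apply: (le_trans TV).
move: (le_trans FT Fu); rewrite FeE//.
set I := \int[mu]_(x in Om) _; set H := hausdorff R n n.-1 _; set H' := hausdorff R n n.-1 _.
have I0 : 0 <= I by apply: integral_ge0 => x _; rewrite lee_fin sqr_ge0.
have H0 : 0 <= H by exact: measure_ge0.
have H'0 : 0 <= b%:E * H' by apply: mule_ge0; [rewrite lee_fin|exact: measure_ge0].
move=> S; rewrite !EFinD -muOm; apply: leeD; first apply: leeD => //.
  by apply: le_trans S; rewrite -addeA leeDl// adde_ge0.
rewrite [leRHS]EFinM; apply: lee_wpmul2l; first by rewrite lee_fin mulr_ge0.
by apply: le_trans S; rewrite -addeA addeCA leeDl// adde_ge0.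
Qed.

End minimizer_bounds.

Lemma nneg_cvg0P (R : realType) (x : nat -> \bar R) : (forall k, 0 <= x k) ->
  (x @ \oo --> 0 <-> forall e : R, (0 < e)%R -> \forall k \near \oo, x k < e%:E).
Proof.
move=> x0; split => [/fine_cvgP[fx /cvgrPdist_lt h] e e0|h].
  have := h _ e0; apply: filterS2 fx => k fk; rewrite sub0r normrN => hk.
  by rewrite -(fineK fk) lte_fin; apply: le_lt_trans hk; exact: ler_norm.
apply/fine_cvgP; split.
  have := h _ ltr01; apply: filterS => k hk.
  by rewrite ge0_fin_numE// (lt_trans hk)// ltry.
apply/cvgrPdist_lt => e e0; have := h _ e0; apply: filterS => k hk.
have fk : x k \is a fin_num by rewrite ge0_fin_numE// (lt_trans hk)// ltry.
rewrite sub0r normrN /= ger0_norm ?fine_ge0//.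
by rewrite -lte_fin fineK.
Qed.

Lemma limn_esup_lt (R : realType) (x : nat -> \bar R) (c : \bar R) :
  limn_esup x < c -> \forall k \near \oo, x k < c.
Proof.
move=> /ereal_inf_lt[_ [V oV <-] Vc]; apply: filterS oV => k Vk.
by apply: le_lt_trans Vc; apply: ereal_sup_ubound; exists k.
Qed.

Lemma limn_einf_le (R : realType) (x : nat -> \bar R) (c : \bar R) :
  (forall N, exists2 k, (N <= k)%N & x k <= c) -> limn_einf x <= c.
Proof.
move=> H; rewrite /limn_einf leeNl; apply: le_ereal_inf_tmp => _ [V [N _ NV] <-].
have [k Nk kc] := H N; apply: (@le_trans _ _ (- x k)); first by rewrite leeN2.
by apply: ereal_sup_ubound; exists k => //; exact: NV.
Qed.

Lemma limn_esup_ge0 (R : realType) (x : nat -> \bar R) :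
  (forall k, 0 <= x k) -> 0 <= limn_esup x.
Proof.
move=> x0; apply: le_ereal_inf_tmp => _ [V [N _ NV] <-].
by apply: (le_trans (x0 N)); apply: ereal_sup_ubound; exists N => //; apply: NV => /=.
Qed.

Lemma ae_imply d (T : measurableType d) (R : realType) (mu : {measure set T -> \bar R})
    (P Q : T -> Prop) : (forall x, P x -> Q x) ->
  {ae mu, forall x, P x} -> {ae mu, forall x, Q x}.
Proof. by move=> PQ; apply: filterS. Qed.

(** * Limits of minimizers and of their energies *)

Section minimizers.
Context (R : realType) (n : nat) (Om : set 'rV[R]_n) (g : 'rV[R]_n -> R) (m : nat)
  (eps b : nat -> R) (Fh : ('rV[R]_n -> R) -> \bar R) (u : nat -> 'rV[R]_n -> R).
Local Notation mu := (@leb R n).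
Local Notation MT := (caratheodory_type (@leb_outer R n)).
Hypothesis n_gt1 : (1 < n)%N.
Hypothesis oOm : open Om.
Hypothesis bOm : bounded_set Om.
Hypothesis mg : measurable_fun [set: MT] (g : MT -> R).
Hypothesis gm : forall x, (`|g x| <= m%:R)%R.
Hypothesis eps_gt0 : forall k, (0 < eps k)%R.
Hypothesis b_ge0 : forall k, (0 <= b k)%R.
Hypothesis eps_cvg : eps @ \oo --> (0%R : R).
Hypothesis Gcvg : Gamma_cvg Om eps (fun k => Fe Om (eps k) (b k)) Fh.
Hypothesis u_min : forall k,
  is_minimizer Om (fun v => Fe Om (eps k) (b k) v + Ge Om g (eps k) v) (u k).
Local Notation A k := (Om `&` @eps_perforated R n (eps k)).

Let n_gt0 : (0 < n)%N. Proof. exact: ltnW. Qed.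

Let mOm : measurable (Om : set MT). Proof. exact: open_leb_measurable. Qed.

Let Omoo : mu Om < +oo. Proof. exact: bounded_leb_lty. Qed.

Let mA k : measurable (A k : set MT).
Proof.
by apply: measurableI => //; apply: open_leb_measurable => //; exact: eps_perforated_open.
Qed.

Definition energy k := Fe Om (eps k) (b k) (u k) + Ge Om g (eps k) (u k).

Lemma energy_ge0 k : 0 <= energy k.
Proof. by apply: adde_ge0; [exact: Fe_ge0|exact: Ge_ge0]. Qed.

Let w k : 'rV[R]_n -> R := trunc m (u k) \_ Om.

Let mE k := minimizer_bounds n_gt0 oOm bOm mg gm (eps_gt0 k) (b_ge0 k) (u_min k).

Let L1u k : L1 Om (u k). Proof. by have [] := u_min k. Qed.

Let mL1 v : L1 Om v -> measurable_fun (Om : set MT) (v : MT -> R).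
Proof. by move=> /measurable_int/measurable_EFinP. Qed.

Let mw k : measurable_fun [set: MT] (w k : MT -> R).
Proof. by apply: measurable_patch => //; apply: measurable_trunc; exact: mL1. Qed.

Let wM k x : (`|w k x| <= m%:R)%R.
Proof.
by rewrite /w /patch; case: ifP => _; [exact: trunc_bound|rewrite normr0].
Qed.

Let L1_bounded (v : 'rV[R]_n -> R) (M : R) : measurable_fun [set: MT] (v : MT -> R) ->
  (forall x, `|v x| <= M)%R -> L1 Om v.
Proof.
move=> mv vM; apply: (measurable_bounded_integrable mOm Omoo); first exact: measurable_funTS.
by exists M; split; [exact: num_real|move=> y /ltW My x _; exact: le_trans My].
Qed.

(** The function equal to w k on the perforated part of Om and to U elsewhere: the extension of u k
    that [perf_cvg] asks for, whose distance to U is the one measured on the perforated part. *)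
Let filled (U : 'rV[R]_n -> R) k (x : 'rV[R]_n) : R := (U x + ((fun y => w k y - U y) \_ (A k)) x)%R.

Let filled_L1 U k : measurable_fun [set: MT] (U : MT -> R) ->
  (forall x, `|U x| <= m%:R)%R -> L1 Om (filled U k).
Proof.
move=> mU Um; apply: (@L1_bounded _ (m%:R + (m%:R + m%:R))%R).
  apply: (measurable_funD mU); apply: measurable_patch; first exact: mA.
  by apply: measurable_funB; apply: measurable_funTS.
move=> x; apply: le_trans (ler_normD _ _) _; rewrite lerD//.
rewrite /patch; case: ifP => _; last by rewrite normr0 addr_ge0.
by apply: le_trans (ler_normB _ _) _; rewrite lerD.
Qed.

Let filled_ae U k : {ae mu, forall x, A k x -> filled U k x = u k x}.
Proof.
have [_ _ + _] := mE k; apply: ae_imply => x h Ax; rewrite -(h Ax) /filled /patch mem_set//.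
by rewrite /w /patch mem_set; [ring|case: Ax].
Qed.

Let filled_dist U k : \int[mu]_(x in Om) (`|filled U k x - U x|%R)%:E =
  \int[mu]_(x in A k) (`|w k x - U x|%R)%:E.
Proof.
have := @integral_patch _ MT R mu (A k) Om (fun x => `|w k x - U x|%R).
rewrite (_ : A k `&` Om = A k); last by rewrite setIAC setIid.
move=> <-; apply: eq_integral => x _; congr (_%:E); rewrite /filled addrC addKr /patch.
by case: ifP => // _; rewrite normr0.
Qed.

(** It is stated along a subsequence because [minimizers_converge] uses it for the whole sequence
    and again for a subsequence of low energies. *)
Lemma minimizers_compact (sigma0 : nat -> nat) : {homo sigma0 : i j / (i < j)%N} ->
  exists (sigma1 : nat -> nat) (U : 'rV[R]_n -> R),
  [/\ {homo sigma1 : i j / (i < j)%N}, measurable_fun [set: MT] (U : MT -> R),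
      forall x, (`|U x| <= m%:R)%R &
      \int[mu]_(x in A (sigma0 (sigma1 k))) (`|w (sigma0 (sigma1 k)) x - U x|%R)%:E
        @[k --> \oo] --> 0].
Proof.
move=> homo0; have sigma_ge l : (l <= sigma0 l)%N.
  by elim: l => // l ih; exact: leq_ltn_trans ih (homo0 l l.+1 (ltnSn l)).
have eps_cvg0 : (eps \o sigma0) @ \oo --> (0%R : R).
  apply: cvg_comp eps_cvg; apply/cvgnyPge => N; near=> l.
  by apply: leq_trans (sigma_ge l); near: l; exact: nbhs_infty_ge.
pose Kc := (fine (mu Om) + energy_bound Om m + 2 * m%:R * energy_bound Om m)%R.
have tv k : tv_le Om (A (sigma0 k)) (w (sigma0 k)) Kc by have [] := mE (sigma0 k).
exact: (@perforated_compact R n Om (eps \o sigma0) m%:R Kc (w \o sigma0)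
  n_gt1 oOm bOm (fun k => eps_gt0 _) eps_cvg0 (fun k => mw _) (fun k => wM _) tv).
Unshelve. all: by end_near.
Qed.

Let CPfin : exists2 c : R, (0 <= c)%R & CP R n = c%:E.
Proof.
exists (1 - (1 / 2) ^+ n)%R; last exact: CPE.
by have := CP_ge R n_gt0; rewrite CPE// lee_fin; lra.
Qed.

Lemma Glim_weak v : L1 Om v ->
  [/\ 0 <= Glim Om g v, Glim Om g v < +oo & forall tau : R, (0 < tau)%R ->
    \forall k \near \oo, Ge Om g (eps k) v <= Glim Om g v + tau%:E /\
      Glim Om g v <= Ge Om g (eps k) v + tau%:E].
Proof.
move=> L1v; have mv := mL1 L1v; have mgO : measurable_fun (Om : set MT) (g : MT -> R) by exact: measurable_funTS.
have md : measurable_fun (Om : set MT) (fun x : MT => `|v x - g x|%R) by exact: measurable_distance.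
have foo : \int[mu]_(x in Om) (`|v x - g x|%R)%:E < +oo.
  have L1g : L1 Om g by exact: L1_bounded mg gm.
  have /integrableP[_ h] := integrableB mOm L1v L1g.
  exact: h.
have J0 : 0 <= \int[mu]_(x in Om) (`|v x - g x|%R)%:E.
  by apply: integral_ge0 => x _; rewrite lee_fin.
have [c c0 cE] := CPfin; rewrite /Glim cE; split.
- by apply: mule_ge0; rewrite ?lee_fin.
- by apply: lte_mul_pinfty; rewrite ?lee_fin.
move=> tau tau0; have [e0 e00 H] := weak_perforated n_gt0 oOm bOm md (fun x => normr_ge0 _) foo tau0.
have /cvgrPdist_lt/(_ _ e00) := eps_cvg; apply: filterS => k; rewrite sub0r normrN => ke.
have [|h1 h2] := H (eps k); first by rewrite eps_gt0 (le_lt_trans _ ke)// ler_norm.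
by rewrite -cE; split.
Qed.

Lemma limit_ge0 v : L1 Om v -> 0 <= Fh v.
Proof.
move=> L1v; have [_ [r [_ _ h]]] := Gcvg L1v; apply: le_trans h.
by apply: limn_esup_ge0 => k; exact: Fe_ge0.
Qed.

(** A recovery sequence of v is a competitor for u k; on the perforated set it agrees with functions
    converging to v in L^1(Om), so its data term is close to that of v. *)
Lemma energy_limsup v c : L1 Om v -> Fh v + Glim Om g v < c ->
  \forall k \near \oo, energy k <= c.
Proof.
move=> L1v vc; have [_ [r [L1r [v_ [L1v_ ae_v v_cvg]] Fr]]] := Gcvg L1v.
have F0 := limit_ge0 L1v; have [G0 Goo Gw] := Glim_weak L1v.
case: c vc => [c| |] vc; last by move: vc; rewrite ltNge leNye.
- have [a Fa] : exists a, Fh v = a%:E.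
    by move: vc F0; case: (Fh v) => [a| |]//; [exists a|move: Goo G0; case: (Glim Om g v)].
  have [s Gs] : exists s, Glim Om g v = s%:E.
    by move: Goo G0; case: (Glim Om g v) => [s| |]// _ _; exists s.
  rewrite Fa Gs -EFinD lte_fin in vc.
  (* A third of the gap for each of three errors: in [Fe], in the L^1 distance to v, and in the data
     term of v. *)
  pose tau := ((c - (a + s)) / 3)%R; have tau0 : (0 < tau)%R by rewrite divr_gt0//; lra.
  have h1 : \forall k \near \oo, Fe Om (eps k) (b k) (r k) < (a + tau)%:E.
    apply: limn_esup_lt; apply: le_lt_trans Fr _; rewrite Fa lte_fin; lra.
  have h2 := Gw _ tau0.
  have vr0 k : 0 <= \int[mu]_(x in Om) (`|v_ k x - v x|%R)%:E.
    by apply: integral_ge0 => x _; rewrite lee_fin.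
  have h3 := (nneg_cvg0P vr0).1 v_cvg _ tau0.
  near=> k.
  have hk1 : Fe Om (eps k) (b k) (r k) < (a + tau)%:E by near: k.
  have [hk2 _] : Ge Om g (eps k) v <= Glim Om g v + tau%:E /\
      Glim Om g v <= Ge Om g (eps k) v + tau%:E by near: k.
  have hk3 : \int[mu]_(x in Om) (`|v_ k x - v x|%R)%:E < tau%:E by near: k.
  have [_ min] := u_min k; apply: le_trans (min _ (L1r k)) _.
  have sub (f : MT -> R) : measurable_fun (Om : set MT) f -> measurable_fun (A k : set MT) f.
    by move=> mf; apply: measurable_funS mf => //; exact: subIsetl.
  have mgA : measurable_fun (A k : set MT) (g : MT -> R) by exact: measurable_funTS.
  have -> : Ge Om g (eps k) (r k) = Ge Om g (eps k) (v_ k).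
    apply/esym; exact: (ae_eq_integral_dist (mA k) (sub _ (mL1 (L1v_ k))) (sub _ (mL1 (L1r k))) mgA (ae_v k)).
  have tri := integral_dist_triangle mu (mA k) (sub _ (mL1 (L1v_ k))) (sub _ (mL1 L1v)) mgA.
  have d1 : \int[mu]_(x in A k) (`|v_ k x - v x|%R)%:E <= tau%:E.
    apply: le_trans (ltW hk3).
    apply: (ge0_subset_integral_dist mu (mA k) mOm (mL1 (L1v_ k)) (mL1 L1v)); exact: subIsetl.
  apply: (@le_trans _ _ ((a + tau)%:E + (tau%:E + (s%:E + tau%:E)))).
    apply: leeD; first exact: (ltW hk1).
    apply: (le_trans tri); apply: leeD => //; rewrite -Gs; exact: hk2.
  by rewrite -!EFinD lee_fin /tau; lra.
by near=> k; exact: leey.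
Unshelve. all: by end_near.
Qed.

Lemma minimizers_perf_cvg (sigma : nat -> nat) U :
  measurable_fun [set: MT] (U : MT -> R) -> (forall x, `|U x| <= m%:R)%R ->
  \int[mu]_(x in A (sigma k)) (`|w (sigma k) x - U x|%R)%:E @[k --> \oo] --> 0 ->
  perf_cvg Om (eps \o sigma) (u \o sigma) U.
Proof.
move=> mU Um h; exists (fun l => filled U (sigma l)); split.
- by move=> l; exact: filled_L1.
- by move=> l; exact: filled_ae.
- by rewrite (_ : (fun l => _) = (fun l => \int[mu]_(x in A (sigma l)) (`|w (sigma l) x - U x|%R)%:E))//;
    apply/funext => l; exact: filled_dist.
Qed.

Let homo_ge (sigma : nat -> nat) : {homo sigma : i j / (i < j)%N} -> forall l, (l <= sigma l)%N.
Proof. by move=> h; elim=> // l ih; exact: leq_ltn_trans ih (h l l.+1 (ltnSn l)). Qed.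

(* The subsequence is completed by a recovery sequence of U, so that the
   Gamma-liminf inequality for the whole sequence applies to it. *)
Lemma energy_liminf (sigma : nat -> nat) U c : {homo sigma : i j / (i < j)%N} ->
  measurable_fun [set: MT] (U : MT -> R) -> (forall x, `|U x| <= m%:R)%R ->
  \int[mu]_(x in A (sigma k)) (`|w (sigma k) x - U x|%R)%:E @[k --> \oo] --> 0 ->
  (\forall l \near \oo, energy (sigma l) <= c) -> Fh U + Glim Om g U <= c.
Proof.
move=> sigma_homo mU Um d_cvg Ec; have L1U : L1 Om U by exact: L1_bounded mU Um.
have [liminf [r [L1r [v_ [L1v_ ae_v v_cvg]] _]]] := Gcvg L1U.
have [G0 Goo Gw] := Glim_weak L1U; have F0 := limit_ge0 L1U.
pose hit k := `[< exists l, sigma l = k >].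
pose z k := if hit k then u k else r k.
pose v k := if hit k then filled U k else v_ k.
have d0 l : 0 <= \int[mu]_(x in A (sigma l)) (`|w (sigma l) x - U x|%R)%:E.
  by apply: integral_ge0 => x _; rewrite lee_fin.
have d_small := (nneg_cvg0P d0).1 d_cvg.
have sigma_oo : sigma @ \oo --> \oo.
  apply/cvgnyPge => N; near=> l.
  by apply: leq_trans (homo_ge sigma_homo l); near: l; exact: nbhs_infty_ge.
have z_cvg : perf_cvg Om eps z U.
  exists v; split.
  - by move=> k; rewrite /v; case: (hit k) => //; exact: filled_L1.
  - move=> k; rewrite /v /z; case: (hit k); [exact: filled_ae|exact: ae_v].
  - have v0 k : 0 <= \int[mu]_(x in Om) (`|v k x - U x|%R)%:E.
      by apply: integral_ge0 => x _; rewrite lee_fin.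
    have vr0 k : 0 <= \int[mu]_(x in Om) (`|v_ k x - U x|%R)%:E.
      by apply: integral_ge0 => x _; rewrite lee_fin.
    apply/(nneg_cvg0P v0) => e e0.
    have [N _ NP] := d_small _ e0.
    have := (nneg_cvg0P vr0).1 v_cvg _ e0; apply: filterS2 (nbhs_infty_ge (sigma N)) => k kN h.
    rewrite /v; case: ifPn => [/asboolP[l lk]|_]; last exact: h.
    (* As sigma is increasing, k = sigma l >= sigma N forces l >= N. *)
    rewrite filled_dist -lk; apply: NP => /=; rewrite leqNgt; apply/negP => lN.
    by have := leq_trans (sigma_homo _ _ lN) kN; rewrite lk ltnn.
have L1z k : L1 Om (z k) by rewrite /z; case: (hit k).
have {}liminf := liminf z L1z z_cvg.
case: c Ec => [c| |] Ec; first last.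
- have [k /=] := filter_ex Ec.
  by rewrite leeNy_eq => /eqP h; have := energy_ge0 (sigma k); rewrite h.
- exact: leey.
have [s Gs] : exists s, Glim Om g U = s%:E.
  by move: Goo G0; case: (Glim Om g U) => [s| |]// _ _; exists s.
apply/lee_addgt0Pr => tau tau0; have tau2 : (0 < tau / 2)%R by rewrite divr_gt0.
(* Gamma-convergence controls [Fe] alone, so the data term, nearly s along sigma, is subtracted from
   the energy bound. The estimate holds at infinitely many indices, which suffices for a lower
   limit. *)
have step N : exists2 k, (N <= k)%N & Fe Om (eps k) (b k) (z k) <= (c - s + tau)%:E.
  have near_l : \forall l \near \oo, [/\ (N <= l)%N, energy (sigma l) <= c%:E,
      \int[mu]_(x in A (sigma l)) (`|w (sigma l) x - U x|%R)%:E < (tau / 2)%:E &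
      Ge Om g (eps (sigma l)) U <= Glim Om g U + (tau / 2)%:E /\
      Glim Om g U <= Ge Om g (eps (sigma l)) U + (tau / 2)%:E].
    near=> l; split; near: l.
    - exact: nbhs_infty_ge.
    - exact: Ec.
    - exact: d_small.
    - exact: (sigma_oo _ (Gw _ tau2)).
  have [l [Nl El dl [_ Gl]]] := filter_ex near_l.
  exists (sigma l); first exact: leq_trans Nl (homo_ge sigma_homo l).
  have -> : z (sigma l) = u (sigma l).
    by rewrite /z /hit; case: asboolP => // -[]; exists l.
  have mgA : measurable_fun (A (sigma l) : set MT) (g : MT -> R) by exact: measurable_funTS.
  have mwA : measurable_fun (A (sigma l) : set MT) (w (sigma l) : MT -> R) by exact: measurable_funTS.
  have mUA : measurable_fun (A (sigma l) : set MT) (U : MT -> R) by exact: measurable_funTS.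
  have muA : measurable_fun (A (sigma l) : set MT) (u (sigma l) : MT -> R).
    by apply: measurable_funS (mL1 (L1u _)) => //; exact: subIsetl.
  have tri := integral_dist_triangle mu (mA (sigma l)) mUA mwA mgA.
  have GE : \int[mu]_(x in A (sigma l)) (`|w (sigma l) x - g x|%R)%:E = Ge Om g (eps (sigma l)) (u (sigma l)).
    apply: (ae_eq_integral_dist (mA _) mwA muA mgA).
    have [_ _ + _] := mE (sigma l); apply: ae_imply => x h Ax; rewrite -(h Ax).
    by rewrite /w /patch mem_set//; case: Ax.
  rewrite GE in tri.
  have dl' : \int[mu]_(x in A (sigma l)) (`|U x - w (sigma l) x|%R)%:E <= (tau / 2)%:E.
    rewrite [leLHS](_ : _ = \int[mu]_(x in A (sigma l)) (`|w (sigma l) x - U x|%R)%:E) ?ltW//.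
    by apply: eq_integral => x _; rewrite distrC.
  have {tri dl'} GU := le_trans tri (leeD2r _ dl').
  have {}GU := le_trans Gl (leeD2r _ GU).
  move: GU El (Fe_ge0 Om (eps (sigma l)) (u (sigma l)) (b_ge0 (sigma l))) (Ge_ge0 Om g (eps (sigma l)) (u (sigma l))).
  rewrite /energy Gs.
  move: (Fe Om (eps (sigma l)) (b (sigma l)) (u (sigma l))) => F.
  move: (Ge Om g (eps (sigma l)) (u (sigma l))) => G; case: F => [f| |]//; case: G => [q| |]//.
  rewrite -!EFinD !lee_fin; lra.
have := le_trans liminf (limn_einf_le step).
move: F0; rewrite Gs; case: (Fh U) => [f| |]//; rewrite -!EFinD !lee_fin; lra.
Unshelve. all: by end_near.
Qed.

Lemma minimizers_converge : exists (sigma : nat -> nat) (U : 'rV[R]_n -> R),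
  [/\ {homo sigma : i j / (i < j)%N}, perf_cvg Om (eps \o sigma) (u \o sigma) U,
      (forall x, `|U x| <= m%:R)%R /\ Fh U < +oo,
      is_minimizer Om (fun v => Fh v + Glim Om g v) U &
      energy k @[k --> \oo] --> Fh U + Glim Om g U].
Proof.
have J0 v : L1 Om v -> 0 <= Fh v + Glim Om g v.
  by move=> L1v; have [G0 _ _] := Glim_weak L1v; apply: adde_ge0 => //; exact: limit_ge0.
have EC k : energy k <= (energy_bound Om m)%:E by have [] := mE k.
have id_homo : {homo (@id nat) : i j / (i < j)%N} by [].
have [sigma [U [sh mU Um d_cvg]]] := minimizers_compact id_homo.
have L1U : L1 Om U by exact: L1_bounded mU Um.
have lim_le c : (\forall k \near \oo, energy k <= c) -> Fh U + Glim Om g U <= c.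
  move=> [N _ NP]; apply: (energy_liminf sh mU Um d_cvg); exists N => // l Nl /=.
  by apply: NP => /=; exact: leq_trans Nl (homo_ge sh l).
have JC : Fh U + Glim Om g U <= (energy_bound Om m)%:E.
  by apply: lim_le; exact: nearW.
have [r Jr] : exists r, Fh U + Glim Om g U = r%:E.
  by move: JC (J0 _ L1U); case: (_ + _) => [r| |]// _ _; exists r.
(* The energy of v bounds the energies of the minimizers up to tau from some index on, and [lim_le]
   passes this bound to U. *)
have minU v : L1 Om v -> Fh U + Glim Om g U <= Fh v + Glim Om g v.
  move=> L1v; have := J0 _ L1v; case Jv : (Fh v + Glim Om g v) => [a| |]// _; last exact: leey.
  apply/lee_addgt0Pr => tau tau0; apply: lim_le; apply: (energy_limsup L1v).
  by rewrite Jv -EFinD lte_fin; lra.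
exists sigma, U; split => //.
- exact: (minimizers_perf_cvg mU Um d_cvg).
- split => //; have [G0 _ _] := Glim_weak L1U.
  by rewrite (le_lt_trans (leeDl (Fh U) G0))// Jr ltry.
- rewrite Jr; have Efin k : energy k \is a fin_num.
    by rewrite ge0_fin_numE ?energy_ge0// (le_lt_trans (EC k))// ltry.
  apply/fine_cvgP; split; first exact: nearW.
  apply/cvgrPdist_le => tau tau0.
  have up : \forall k \near \oo, energy k <= (r + tau)%:E.
    by apply: (energy_limsup L1U); rewrite Jr lte_fin; lra.
  (* Otherwise infinitely many energies stay below r - tau; compactness along them yields a function
     U' whose limit energy is less than the minimum r. Hence the energies converge along the whole
     sequence, without extraction. *)
  have lo : \forall k \near \oo, (r - tau)%:E <= energy k.
    apply: contrapT => nlo.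
    have freq (l k0 : nat) : exists2 k, (k0 <= k)%N & energy k <= (r - tau)%:E.
      apply: contrapT => h; apply: nlo; exists k0 => // k k0k /=.
      by rewrite leNgt; apply/negP => /ltW h'; apply: h; exists k.
    have [sigma0 sh0 Es0] := strict_choice freq.
    have [sigma1 [U' [sh1 mU' Um' d_cvg']]] := minimizers_compact sh0.
    have sh01 : {homo (sigma0 \o sigma1) : i j / (i < j)%N} by move=> i j ij; exact/sh0/sh1.
    have L1U' : L1 Om U' by exact: L1_bounded mU' Um'.
    have := minU _ L1U'; rewrite Jr => h.
    have Es01 : \forall l \near \oo, energy (sigma0 (sigma1 l)) <= (r - tau)%:E.
      by apply: nearW => l; exact: Es0.
    have h2 := @energy_liminf (sigma0 \o sigma1) U' _ sh01 mU' Um' d_cvg' Es01.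
    by have := le_trans h h2; rewrite lee_fin; lra.
  apply: filterS2 up lo => k; rewrite -(fineK (Efin k)) !lee_fin => h1 h2.
  by rewrite ler_distl; apply/andP; split => /=; lra.
Qed.

End minimizers.

(** * The data term for essentially bounded g *)

Section data_term.
Context (R : realType) (n : nat) (Om : set 'rV[R]_n) (g : 'rV[R]_n -> R).
Local Notation mu := (@leb R n).
Local Notation MT := (caratheodory_type (@leb_outer R n)).
Hypothesis n_gt0 : (0 < n)%N.
Hypothesis oOm : open Om.

(** The preceding section assumes |g| <= m at every point and measurability on the whole space.
    Truncation and extension by 0 achieve this without changing g almost everywhere in Om, hence
    without changing the data terms. *)
Lemma Linfty_bounded_version : Linfty Om g -> exists (m : nat) (g' : 'rV[R]_n -> R),
  [/\ measurable_fun [set: MT] (g' : MT -> R), forall x, (`|g' x| <= m%:R)%R &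
      {ae mu, forall x, Om x -> g' x = g x}].
Proof.
move=> [mg [M gM]]; have mOm := open_leb_measurable n_gt0 oOm.
exists (Num.truncn M).+1, (trunc (Num.truncn M).+1 g \_ Om); split.
- by apply: measurable_patch => //; exact: measurable_trunc.
- by move=> x; rewrite /patch; case: ifP => _; [exact: trunc_bound|rewrite normr0].
- apply: ae_imply gM => x h Ox; rewrite /patch mem_set// trunc_id//.
  by apply: le_trans (h Ox) _; apply/ltW; exact: truncnS_gt.
Qed.

Variable g' : 'rV[R]_n -> R.
Hypothesis mg : measurable_fun (Om : set MT) (g : MT -> R).
Hypothesis mg' : measurable_fun [set: MT] (g' : MT -> R).
Hypothesis gg' : {ae mu, forall x, Om x -> g' x = g x}.

Let dist_eq (D : set 'rV[R]_n) v : measurable (D : set MT) -> D `<=` Om -> L1 Om v ->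
  \int[mu]_(x in D) (`|v x - g x|%R)%:E = \int[mu]_(x in D) (`|v x - g' x|%R)%:E.
Proof.
move=> mD DO L1v; have mOm := open_leb_measurable n_gt0 oOm.
have mv : measurable_fun (D : set MT) (v : MT -> R).
  by apply: (measurable_funS mOm DO); exact/measurable_EFinP/measurable_int/L1v.
have mgD : measurable_fun (D : set MT) (g : MT -> R) by exact: measurable_funS mOm DO mg.
have mg'D : measurable_fun (D : set MT) (g' : MT -> R) by exact: measurable_funTS.
rewrite (_ : \int[mu]_(x in D) (`|v x - g x|%R)%:E = \int[mu]_(x in D) (`|g x - v x|%R)%:E); last first.
  by apply: eq_integral => x _; rewrite distrC.
rewrite (_ : \int[mu]_(x in D) (`|v x - g' x|%R)%:E = \int[mu]_(x in D) (`|g' x - v x|%R)%:E); last first.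
  by apply: eq_integral => x _; rewrite distrC.
apply: (ae_eq_integral_dist mD mgD mg'D mv).
by apply: ae_imply gg' => x h /DO/h.
Qed.

Lemma Ge_ae e v : (0 < e)%R -> L1 Om v -> Ge Om g e v = Ge Om g' e v.
Proof.
move=> e0; apply: dist_eq; last exact: subIsetl.
by apply: measurableI; apply: open_leb_measurable => //; exact: eps_perforated_open.
Qed.

Lemma Glim_ae v : L1 Om v -> Glim Om g v = Glim Om g' v.
Proof.
by move=> L1v; congr (_ * _); apply: dist_eq => //; exact: open_leb_measurable.
Qed.

End data_term.

Lemma eq_is_minimizer (R : realType) (n : nat) (Om : set 'rV[R]_n)
    (J J' : ('rV[R]_n -> R) -> \bar R) u : (forall v, L1 Om v -> J v = J' v) ->
  is_minimizer Om J u -> is_minimizer Om J' u.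
Proof. by move=> JJ' [L1u h]; split => // v L1v; rewrite -!JJ'//; exact: h. Qed.

Lemma eq_inf_value (R : realType) (n : nat) (Om : set 'rV[R]_n)
    (J J' : ('rV[R]_n -> R) -> \bar R) : (forall v, L1 Om v -> J v = J' v) ->
  inf_value Om J = inf_value Om J'.
Proof. by move=> JJ'; congr ereal_inf; apply: eq_imagel => v; exact: JJ'. Qed.

Lemma inf_value_minimizer (R : realType) (n : nat) (Om : set 'rV[R]_n)
    (J : ('rV[R]_n -> R) -> \bar R) u : is_minimizer Om J u -> inf_value Om J = J u.
Proof.
move=> [L1u um]; apply/eqP; rewrite eq_le; apply/andP; split.
  by apply: ereal_inf_lbound; exists u.
by apply: le_ereal_inf_tmp => _ [v L1v <-]; exact: um.
Qed.

Theorem proposition3p8 (R : realType) (n : nat) (n_ge2 : (2 <= n)%N)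
  (Om : set 'rV[R]_n) (Om_open : open Om) (Om_bounded : bounded_set Om)
  (Om_lipschitz : lipschitz_boundary Om)
  (beta : R -> R)
  (beta_bounds : forall eps : R, (0 < eps)%R -> (0 < beta eps <= 1)%R)
  (beta_monotone : forall eps eps' : R,
     (0 < eps)%R -> (eps <= eps')%R -> (beta eps <= beta eps')%R)
  (beta_cvg : beta eps @[eps --> 0%R^'+] --> (0%R : R))
  (ell : \bar R)
  (ell_lim : (beta eps / eps)%:E @[eps --> 0%R^'+] --> ell)
  (fhom : 'rV[R]_n -> R)
  (fhom_ge0 : forall xi, (0 <= fhom xi)%R)
  (fhom_convex : convex_function setT fhom)
  (fhom_lower : forall xi, fhat xi <= (fhom xi)%:E)
  (fhom_upper : forall xi, (fhom xi <= enorm xi ^+ 2)%R)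
  (Qn : 'rV[R]_n -> set 'rV[R]_n)
  (Qn_cube : forall nu, enorm nu = 1%R -> is_unit_cube nu (Qn nu))
  (eps : nat -> R)
  (eps_gt0 : forall k, (0 < eps k)%R)
  (eps_decreasing : nonincreasing_seq eps)
  (eps_cvg : eps @ \oo --> (0%R : R))
  (F_Gamma_cvg : Gamma_cvg Om eps (fun k => Fe Om (eps k) (beta (eps k)))
                   (Fhom Om fhom (ghat Qn)))
  (g : 'rV[R]_n -> R) (g_bounded : Linfty Om g)
  (u : nat -> 'rV[R]_n -> R)
  (u_min : forall k, is_minimizer Om
     (fun v => Fe Om (eps k) (beta (eps k)) v + Ge Om g (eps k) v) (u k)) :
  (exists (sigma : nat -> nat) (ubar : 'rV[R]_n -> R),
     [/\ {homo sigma : i j / (i < j)%N},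
         perf_cvg Om (eps \o sigma) (u \o sigma) ubar,
         SBV2 Om ubar &
         is_minimizer Om
           (fun v => Fhom Om fhom (ghat Qn) v + Glim Om g v) ubar]) /\
  inf_value Om (fun v => Fe Om (eps k) (beta (eps k)) v + Ge Om g (eps k) v)
    @[k --> \oo] -->
  inf_value Om (fun v => Fhom Om fhom (ghat Qn) v + Glim Om g v).
Proof.
have n_gt0 : (0 < n)%N by exact: ltnW.
have [mg _] := g_bounded.
have [m [g' [mg' g'm g'g]]] := Linfty_bounded_version n_gt0 Om_open g_bounded.
have E k v : L1 Om v -> Fe Om (eps k) (beta (eps k)) v + Ge Om g (eps k) v =
    Fe Om (eps k) (beta (eps k)) v + Ge Om g' (eps k) v.
  by move=> L1v; rewrite (Ge_ae n_gt0 Om_open mg mg' g'g (eps_gt0 k) L1v).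
have J v : L1 Om v -> Fhom Om fhom (ghat Qn) v + Glim Om g' v =
    Fhom Om fhom (ghat Qn) v + Glim Om g v.
  by move=> L1v; rewrite (Glim_ae n_gt0 Om_open mg mg' g'g L1v).
have beta_ge0 k : (0 <= beta (eps k))%R by have /andP[/ltW] := beta_bounds _ (eps_gt0 k).
have u_min' k := eq_is_minimizer (E k) (u_min k).
have [sigma [U [sh Ucvg [Um UFoo] Umin ecvg]]] := minimizers_converge n_ge2 Om_open Om_bounded
  mg' g'm eps_gt0 beta_ge0 eps_cvg F_Gamma_cvg u_min'.
have Umin' := eq_is_minimizer J Umin.
split; last first.
  rewrite -(eq_inf_value J) (inf_value_minimizer Umin).
  rewrite (_ : (fun k => _) = energy Om g' eps (beta \o eps) u)//; apply/funext => k.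
  by rewrite (inf_value_minimizer (u_min k)) E//; have [] := u_min k.
exists sigma, U; split => //.
(* Finite limit energy puts U in GSBV^2, and |U| <= m makes U equal to its truncation at level m,
   which is in SBV by definition of GSBV. *)
have [[[_ Usbv] U2 US]] : GSBV2 Om U.
  by apply: contrapT => h; move: UFoo; rewrite /Fhom asboolF.
by split => //; rewrite (_ : U = trunc m U)//; apply/funext => x; rewrite trunc_id.
Qed.
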